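(* Let $a,b,c\in\mathbb{N}$ with $\gcd(a,b,c)=1$, $a\ge 2$ and $a<c\le b$. Let $$\sigma_{a,b,c}=\sum_{\substack{(n_1,n_2,n_3)\in\mathbb{N}^3\\ n_1^a=n_2^bn_3^c}}(n_1n_2n_3)^{-1/2},$$ which is a computable constant satisfying $\sigma_{a,b,c}>1$ (in particular the series converges), and define $E_{a,b,c}(T)$ by $$I_{a,b,c}(T)=\sigma_{a,b,c}T+E_{a,b,c}(T).$$ Then for large $T$ one has $$E_{a,b,c}(T)\ll T^{1-\frac{1}{2a}+\frac{1}{2c}}(\log T)^{\eta},$$ where $\eta=1$ if $b=c$ and $\eta=0$ otherwise. Moreover, if Conjecture W (stated in the context) holds, then for every $\varepsilon>0$, $$E_{a,b,c}(T)\ll T^{\frac12+\frac{a}{a+c}+\varepsilon}+T^{3/4}\log T.$$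
   Context: $\mathbb{N}=\{1,2,\dots\}$. $\zeta$ is the Riemann zeta function and, for $a,b,c\in\mathbb{R}^+$ and $T>1$, $$I_{a,b,c}(T)=\int_0^T\zeta(1/2+ait)\,\zeta(1/2-bit)\,\zeta(1/2-cit)\,dt.$$ Implicit constants may depend on $a,b,c$ (and on $\varepsilon$ where it appears). Conjecture W (a weak form of the $abc$ conjecture): let $\varepsilon>0$ and $a,b,c\in\mathbb{N}$ be fixed. For $n_1,n_2,n_3\in\mathbb{N}$ put $D=n_1^a-n_2^bn_3^c$. If $D\ne0$, then $|D|\gg n_1^{a-1-\varepsilon}n_2^{-1}n_3^{-1}$, with an implicit constant depending only on $\varepsilon$ (the exponents $a,b,c$ being fixed), not on $n_1,n_2,n_3$. *)

(* Defs.v *)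
From Stdlib Require Import Reals Lra Lia Psatz Arith List.
From Coquelicot Require Import Coquelicot.
Open Scope R_scope.

Definition Cexp (z : C) : C :=
  (exp (Re z) * cos (Im z), exp (Re z) * sin (Im z)).

(* [rcpow x s] is x^s for real x > 0, with the real logarithm. *)
Definition rcpow (x : R) (s : C) : C := Cexp (s * RtoC (ln x)).

(* Partial sums 1^(-s) + ... + (N+1)^(-s), corrected by (N+1)^(1-s)/(1-s). *)
Definition zeta_approx (s : C) (N : nat) : C :=
  (sum_n (fun n => rcpow (INR (S n)) (- s)) N
   - rcpow (INR (S N)) (1 - s) / (1 - s))%C.

(* The Riemann zeta function on the half-plane Re s > 0, s <> 1, as
   lim_N (sum_(n <= N) n^(-s) - N^(1-s)/(1-s)).  For Re s > 1 the correction
   term tends to 0; [ZetaContinuation.zeta_spec] below proves that this is the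
   holomorphic continuation of sum_n n^(-s).  The formula is not meaningful
   for Re s <= 0, where [zeta] is not used. *)
Definition zeta (s : C) : C :=
  (real (Lim_seq (fun N => Re (zeta_approx s N))),
   real (Lim_seq (fun N => Im (zeta_approx s N)))).

Definition I_abc (a b c T : R) : C :=
  RInt (V := C_R_CompleteNormedModule)
    (fun t : R =>
       (zeta (RtoC (1/2) + RtoC a * Ci * RtoC t)
        * zeta (RtoC (1/2) - RtoC b * Ci * RtoC t)
        * zeta (RtoC (1/2) - RtoC c * Ci * RtoC t))%C) 0 T.

Definition solution (a b c : nat) (n : nat * nat * nat) : Prop :=
  let '(n1, n2, n3) := n in
  (1 <= n1)%nat /\ (1 <= n2)%nat /\ (1 <= n3)%nat
  /\ (n1 ^ a = n2 ^ b * n3 ^ c)%nat.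

Definition sigma_term (n : nat * nat * nat) : R :=
  let '(n1, n2, n3) := n in Rpower (INR n1 * INR n2 * INR n3) (- (1/2)).

(* The terms are positive, so the sum over the set of solutions is the
   supremum of its finite subsums; it is finite iff the series converges. *)
Definition sigma_abc (a b c : nat) : Rbar :=
  Lub_Rbar (fun x : R => exists l : list (nat * nat * nat),
    NoDup l /\ List.Forall (solution a b c) l
    /\ x = fold_right Rplus 0 (map sigma_term l)).

Definition E_abc (a b c : nat) (T : R) : C :=
  (I_abc (INR a) (INR b) (INR c) T - RtoC (real (sigma_abc a b c) * T))%C.

(* f(T) << g(T) for large T. *)
Definition dominated_at_infty (f : R -> C) (g : R -> R) : Prop :=
  exists K T0 : R, forall T : R, T0 <= T -> Cmod (f T) <= K * g T.

Definition ConjectureW : Prop :=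
  forall (eps : R) (a b c : nat),
    0 < eps -> (1 <= a)%nat -> (1 <= b)%nat -> (1 <= c)%nat ->
    exists K : R, 0 < K /\
      forall n1 n2 n3 : nat,
        (1 <= n1)%nat -> (1 <= n2)%nat -> (1 <= n3)%nat ->
        let D := INR n1 ^ a - INR n2 ^ b * INR n3 ^ c in
        D <> 0 ->
        K * (Rpower (INR n1) (INR a - 1 - eps) * / INR n2 * / INR n3)
        <= Rabs D.

(* Total recursive functions.  A function of several variables is a function
   of a list of arguments, missing arguments being read as 0. *)
Inductive recursive : (list nat -> nat) -> Prop :=
| rec_zero : recursive (fun _ => 0%nat)
| rec_succ : recursive (fun l => S (nth 0 l 0%nat))
| rec_proj (i : nat) : recursive (fun l => nth i l 0%nat)
| rec_comp (f : list nat -> nat) (gs : list (list nat -> nat)) :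
    recursive f -> List.Forall recursive gs ->
    recursive (fun l => f (map (fun g => g l) gs))
| rec_prim (f g : list nat -> nat) :
    recursive f -> recursive g ->
    recursive (fun l => nat_rec (fun _ => nat) (f (tl l))
                          (fun n r => g (n :: r :: tl l)) (nth 0 l 0%nat))
| rec_min (f h : list nat -> nat) :
    recursive f ->
    (forall l, f (h l :: l) = 0%nat
               /\ forall m, (m < h l)%nat -> f (m :: l) <> 0%nat) ->
    recursive h.

(* x is computable: (p(n) - q(n)) / (n+1) approximates x within 1/(n+1), for
   some total recursive p and q. *)
Definition computable_real (x : R) : Prop :=
  exists p q : list nat -> nat, recursive p /\ recursive q /\
    forall n : nat,
      Rabs (x - (INR (p (n :: nil)) - INR (q (n :: nil))) / INR (S n))
      <= / INR (S n).

Module ZetaContinuation.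

Definition rderive (f : R -> C) (x : R) (l : C) : Prop :=
  is_derive (fun t => fst (f t)) x (fst l) /\
  is_derive (fun t => snd (f t)) x (snd l).

Lemma rderive_eq f x l l' : rderive f x l -> l = l' -> rderive f x l'.
Proof. now intros H <-. Qed.

Lemma rconst (c x : R) : is_derive (fun _ : R => c) x 0.
Proof. auto_derive; trivial. Qed.

Lemma rderive_const c x : rderive (fun _ => c) x 0.
Proof. split; apply rconst. Qed.

Lemma rderive_RtoC f x l :
  is_derive f x l -> rderive (fun t => RtoC (f t)) x (RtoC l).
Proof. split; simpl; [assumption | apply rconst]. Qed.

Lemma rderive_plus f g x l m : rderive f x l -> rderive g x m ->
  rderive (fun t => (f t + g t)%C) x (l + m)%C.
Proof.
intros [H1 H2] [H3 H4]; split; simpl.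
- exact (is_derive_plus _ _ _ _ _ H1 H3).
- exact (is_derive_plus _ _ _ _ _ H2 H4).
Qed.

Lemma rmult (f g : R -> R) x a b : is_derive f x a -> is_derive g x b ->
  is_derive (fun t => f t * g t) x (a * g x + f x * b).
Proof. intros H1 H2. exact (is_derive_mult f g x a b H1 H2 Rmult_comm). Qed.

Lemma rderive_mult f g x l m : rderive f x l -> rderive g x m ->
  rderive (fun t => (f t * g t)%C) x (l * g x + f x * m)%C.
Proof.
intros [H1 H2] [H3 H4]; split; simpl.
- replace (_ + _) with
    ((fst l * fst (g x) + fst (f x) * fst m)
     - (snd l * snd (g x) + snd (f x) * snd m)) by ring.
  exact (is_derive_minus _ _ _ _ _ (rmult _ _ _ _ _ H1 H3) (rmult _ _ _ _ _ H2 H4)).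
- replace (_ + _) with
    ((fst l * snd (g x) + fst (f x) * snd m)
     + (snd l * fst (g x) + snd (f x) * fst m)) by ring.
  exact (is_derive_plus _ _ _ _ _ (rmult _ _ _ _ _ H1 H4) (rmult _ _ _ _ _ H2 H3)).
Qed.

Lemma rderive_minus f g x l m : rderive f x l -> rderive g x m ->
  rderive (fun t => (f t - g t)%C) x (l - m)%C.
Proof.
intros [H1 H2] [H3 H4]; split; simpl.
- exact (is_derive_minus _ _ _ _ _ H1 H3).
- exact (is_derive_minus _ _ _ _ _ H2 H4).
Qed.

Lemma rderive_Cexp g x l : rderive g x l ->
  rderive (fun t => Cexp (g t)) x (l * Cexp (g x))%C.
Proof.
intros [H1 H2].
assert (HR : forall u v : R -> R, forall du dv,
  is_derive u x du -> is_derive v x dv ->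
  is_derive (fun t => exp (u t) * cos (v t)) x
    (du * (exp (u x) * cos (v x)) - dv * (exp (u x) * sin (v x))) /\
  is_derive (fun t => exp (u t) * sin (v t)) x
    (du * (exp (u x) * sin (v x)) + dv * (exp (u x) * cos (v x)))).
{ intros u v du dv Hu Hv; split; auto_derive;
    repeat split; try (eexists; eassumption);
    change (Derive (fun y : R => u y) x) with (Derive u x);
    change (Derive (fun y : R => v y) x) with (Derive v x);
    rewrite (is_derive_unique u x du Hu), (is_derive_unique v x dv Hv); ring. }
destruct (HR _ _ _ _ H1 H2) as [H3 H4]; split; assumption.
Qed.

Lemma Cmod_le2 (z : C) (A : R) :
  Rabs (fst z) <= A -> Rabs (snd z) <= A -> Cmod z <= 2 * A.
Proof.
intros H1 H2.
replace z with (RtoC (fst z) + RtoC (snd z) * Ci)%C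
  by (destruct z; unfold RtoC, Ci, Cplus, Cmult; simpl; f_equal; ring).
eapply Rle_trans; [apply Cmod_triangle|].
rewrite Cmod_mult, Cmod_Ci, !Cmod_R; lra.
Qed.

Lemma rderive_bound f df a b D : a <= b ->
  (forall t, a <= t <= b -> rderive f t (df t) /\ Cmod (df t) <= D) ->
  Cmod (f b - f a) <= 2 * (D * (b - a)).
Proof.
intros Hab H.
assert (HR : forall z : C, Rabs (fst z) <= Cmod z /\ Rabs (snd z) <= Cmod z).
{ intros z; pose proof (Rmax_Cmod z).
  split; (eapply Rle_trans; [|eassumption]); [apply Rmax_l | apply Rmax_r]. }
assert (HM : forall (g dg : R -> R),
   (forall t, a <= t <= b -> is_derive g t (dg t) /\ Rabs (dg t) <= D) ->
   Rabs (g b - g a) <= D * (b - a)).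
{ intros g dg Hg.
  destruct (MVT_gen g a b dg) as [t [Ht Et]].
  - intros t Ht; rewrite Rmin_left, Rmax_right in Ht by lra; apply Hg; lra.
  - intros t Ht; rewrite Rmin_left, Rmax_right in Ht by lra.
    apply derivable_continuous_pt; exists (dg t); apply is_derive_Reals, Hg; lra.
  - rewrite Rmin_left, Rmax_right in Ht by lra.
    rewrite Et, Rabs_mult, (Rabs_pos_eq (b - a)) by lra.
    apply Rmult_le_compat_r; [lra | now apply Hg]. }
apply Cmod_le2; simpl.
- apply (HM (fun t => fst (f t)) (fun t => fst (df t))); intros t Ht.
  destruct (H t Ht) as [[H1 _] H2]; split; [exact H1|].
  eapply Rle_trans; [apply HR | exact H2].
- apply (HM (fun t => snd (f t)) (fun t => snd (df t))); intros t Ht.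
  destruct (H t Ht) as [[_ H1] H2]; split; [exact H1|].
  eapply Rle_trans; [apply HR | exact H2].
Qed.

Lemma Cexp_plus z w : Cexp (z + w) = (Cexp z * Cexp w)%C.
Proof.
unfold Cexp, Re, Im; destruct z as [x y], w as [u v]; simpl.
rewrite exp_plus, cos_plus, sin_plus; unfold Cmult; simpl; f_equal; ring.
Qed.

Lemma Cexp_0 : Cexp 0 = 1.
Proof. unfold Cexp, Re, Im, RtoC; simpl; rewrite exp_0, cos_0, sin_0; f_equal; ring. Qed.

Lemma Cmod_Cexp z : Cmod (Cexp z) = exp (Re z).
Proof.
unfold Cmod, Cexp; simpl.
pose proof (sin2_cos2 (Im z)) as H; unfold Rsqr in H.
replace (_ + _) with (exp (Re z) * exp (Re z)) by nra.
apply sqrt_square; left; apply exp_pos.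
Qed.

Lemma Re_le_Cmod z : Re z <= Cmod z.
Proof. eapply Rle_trans; [apply Rle_abs | apply re_le_Cmod]. Qed.

Lemma exp_le x y : x <= y -> exp x <= exp y.
Proof. intros [H| ->]; [left; now apply exp_increasing | right; reflexivity]. Qed.

(* |e^z - 1 - z| <= 4 |z|^2 e^|z| *)
Lemma Cexp_taylor z :
  Cmod (Cexp z - 1 - z) <= 4 * (Cmod z ^ 2 * exp (Cmod z)).
Proof.
set (M := Cmod z ^ 2 * exp (Cmod z)).
pose proof (Cmod_ge_0 z) as H0.
assert (HM : 0 <= M) by (apply Rmult_le_pos; [nra | left; apply exp_pos]).
assert (Hlin : forall t, rderive (fun t => RtoC t * z)%C t z).
{ intros t; eapply rderive_eq.
  - apply rderive_mult; [apply rderive_RtoC, (is_derive_id (K := R_AbsRing))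
                        | apply rderive_const].
  - change (@one R_AbsRing) with 1; cbv beta; ring. }
assert (He : forall t, 0 <= t <= 1 -> Cmod (Cexp (RtoC t * z)) <= exp (Cmod z)).
{ intros t Ht; rewrite Cmod_Cexp; apply exp_le.
  eapply Rle_trans; [apply Re_le_Cmod|].
  rewrite Cmod_mult, Cmod_R, Rabs_pos_eq by lra; nra. }
assert (H1 : forall u, 0 <= u <= 1 ->
  Cmod (z * Cexp (RtoC u * z) - z) <= 2 * M).
{ intros u Hu.
  pose proof (rderive_bound (fun t => z * Cexp (RtoC t * z))%C
     (fun t => z * (z * Cexp (RtoC t * z)))%C 0 u M) as B.
  cbv beta in B; rewrite Cmult_0_l, Cexp_0, Cmult_1_r in B.
  eapply Rle_trans; [apply B|]; [lra | | nra].
  intros t Ht; split.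
  - eapply rderive_eq; [apply (rderive_mult (fun _ => z) (fun t => Cexp (RtoC t * z)%C));
      [apply rderive_const | apply rderive_Cexp, Hlin]|]; simpl; ring.
  - rewrite !Cmod_mult; unfold M.
    pose proof (He t ltac:(lra)); simpl; rewrite Rmult_1_r, <- Rmult_assoc.
    apply Rmult_le_compat_l; nra. }
pose proof (rderive_bound (fun t => Cexp (RtoC t * z) - RtoC t * z)%C
     (fun t => z * Cexp (RtoC t * z) - z)%C 0 1 (2 * M)) as B.
cbv beta in B.
rewrite !Cmult_0_l, !Cmult_1_l, Cexp_0 in B.
replace (Cexp z - 1 - z)%C with (Cexp z - z - (1 - 0))%C by ring.
eapply Rle_trans; [apply B|]; [lra | | nra].
intros t Ht; split; [|apply H1; lra].
apply rderive_minus; [|apply Hlin].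
apply (rderive_Cexp (fun t => RtoC t * z)%C), Hlin.
Qed.

Lemma rderive_rcpow s x : 0 < x ->
  rderive (fun t => rcpow t s) x (s * rcpow x s * RtoC (/ x))%C.
Proof.
intros Hx; unfold rcpow; eapply rderive_eq.
- apply (rderive_Cexp (fun t => s * RtoC (ln t))%C), rderive_mult.
  + apply rderive_const.
  + apply rderive_RtoC. auto_derive; [exact Hx | reflexivity].
- cbv beta. rewrite Rmult_1_l. ring.
Qed.

Lemma Cmod_rcpow x s : Cmod (rcpow x s) = Rpower x (Re s).
Proof.
unfold rcpow, Rpower; rewrite Cmod_Cexp; f_equal; unfold Re; simpl; ring.
Qed.

Lemma rcpow_add x s t : rcpow x (s + t) = (rcpow x s * rcpow x t)%C.
Proof. unfold rcpow; rewrite <- Cexp_plus; f_equal; ring. Qed.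

Lemma rcpow_1 x : 0 < x -> rcpow x 1 = RtoC x.
Proof.
intros Hx; unfold rcpow; rewrite Cmult_1_l; unfold Cexp, RtoC; simpl.
rewrite exp_ln, cos_0, sin_0 by assumption; f_equal; ring.
Qed.

(* psi is the x-derivative of phi, chi its s-derivative, psi1 the mixed one. *)
Definition phi (k : R) (s : C) (x : R) : C :=
  ((1 - s) * RtoC (x - k) * rcpow x (- s) - RtoC x * rcpow x (- s))%C.
Definition psi (k : R) (s : C) (x : R) : C :=
  (s * (s - 1) * RtoC (x - k) * rcpow x (- s) * RtoC (/ x))%C.
Definition chi (k : R) (s : C) (x : R) : C :=
  (RtoC (ln x) * (RtoC x * rcpow x (- s) - (1 - s) * RtoC (x - k) * rcpow x (- s))
   - RtoC (x - k) * rcpow x (- s))%C.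
Definition psi1 (k : R) (s : C) (x : R) : C :=
  ((2 * s - 1 - RtoC (ln x) * (s * (s - 1)))
   * RtoC (x - k) * rcpow x (- s) * RtoC (/ x))%C.

Lemma Cinv_x x : 0 < x -> (RtoC x * RtoC (/ x) = 1)%C.
Proof. intros; rewrite <- RtoC_mult; f_equal; field; lra. Qed.

Lemma rderive_lin k x : rderive (fun t => RtoC (t - k)) x 1.
Proof. apply rderive_RtoC; auto_derive; trivial. Qed.

Lemma rderive_id x : rderive (fun t => RtoC t) x 1.
Proof. apply rderive_RtoC; auto_derive; trivial. Qed.

Lemma rderive_ln x : 0 < x -> rderive (fun t => RtoC (ln t)) x (RtoC (/ x)).
Proof. intros; apply rderive_RtoC; auto_derive; [assumption | apply Rmult_1_l]. Qed.

Lemma Cx_cancel x w : 0 < x -> (RtoC x * (w * RtoC (/ x)) = w)%C.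
Proof. intros; rewrite (Cmult_comm w), Cmult_assoc, Cinv_x by assumption; ring. Qed.

Lemma rderive_phi k s x : 0 < x -> rderive (phi k s) x (psi k s x).
Proof.
intros Hx; unfold phi, psi; eapply rderive_eq.
- apply rderive_minus; apply rderive_mult.
  + apply rderive_mult; [apply rderive_const | apply rderive_lin].
  + now apply rderive_rcpow.
  + apply rderive_id.
  + now apply rderive_rcpow.
- cbv beta.
  pose proof (Cx_cancel x (rcpow x (- s)) Hx) as H.
  set (w := (rcpow x (- s) * RtoC (/ x))%C) in *.
  replace (- s * rcpow x (- s) * RtoC (/ x))%C with (- s * w)%C
    by (unfold w; ring).
  rewrite RtoC_minus, <- H.
  replace (s * (s - 1) * (x - k) * (x * w) * RtoC (/ x))%C
    with (s * (s - 1) * (x - k) * w * (x * RtoC (/ x)))%C by ring.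
  rewrite <- RtoC_mult, Rinv_r by lra; ring.
Qed.

Lemma rderive_chi k s x : 0 < x -> rderive (chi k s) x (psi1 k s x).
Proof.
intros Hx; unfold chi, psi1; eapply rderive_eq.
- apply rderive_minus; [apply rderive_mult;
    [now apply rderive_ln | apply rderive_minus; apply rderive_mult]
  | apply rderive_mult].
  + apply rderive_id.
  + now apply rderive_rcpow.
  + apply rderive_mult; [apply rderive_const | apply rderive_lin].
  + now apply rderive_rcpow.
  + apply rderive_lin.
  + now apply rderive_rcpow.
- cbv beta.
  pose proof (Cx_cancel x (rcpow x (- s)) Hx) as H.
  set (w := (rcpow x (- s) * RtoC (/ x))%C) in *.
  replace (- s * rcpow x (- s) * RtoC (/ x))%C with (- s * w)%C
    by (unfold w; ring).
  replace ((2 * s - 1 - ln x * (s * (s - 1))) * (x - k)%R * rcpow x (- s) * (/ x)%R)%C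
    with ((2 * s - 1 - ln x * (s * (s - 1))) * (x - k)%R * w)%C by (unfold w; ring).
  rewrite RtoC_minus, <- H.
  match goal with |- (RtoC (/ x) * ?A + ?B - ?E)%C = _ =>
    replace (RtoC (/ x) * A)%C
      with ((x * RtoC (/ x)) * (x * w - (1 - s) * (x - k) * w))%C by ring end.
  rewrite <- RtoC_mult, Rinv_r by lra; ring.
Qed.

Definition Dz (s : C) (n : nat) : C :=
  (phi (INR (S n)) s (INR (S n) + 1) - phi (INR (S n)) s (INR (S n)))%C.
Definition Dz1 (s : C) (n : nat) : C :=
  (chi (INR (S n)) s (INR (S n) + 1) - chi (INR (S n)) s (INR (S n)))%C.
Definition bnd (p : R) (n : nat) : R := Rpower (INR (S n)) (- 1 - p).

Lemma INR_S_ge1 n : 1 <= INR (S n).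
Proof. rewrite S_INR; pose proof (pos_INR n); lra. Qed.

Lemma ex_series_bnd p : 0 < p -> ex_series (bnd p).
Proof.
intros Hp.
assert (H : forall n, sum_n (bnd p) n <= 1 + / p * (1 - Rpower (INR (S n)) (- p))).
{ induction n as [|n IH].
  - rewrite sum_O; unfold bnd, Rpower; simpl; rewrite ln_1, !Rmult_0_r, exp_0; lra.
  - rewrite sum_Sn.
    change (sum_n (bnd p) n + Rpower (INR (S (S n))) (- 1 - p)
            <= 1 + / p * (1 - Rpower (INR (S (S n))) (- p))).
    set (k := INR (S n)) in *; replace (INR (S (S n))) with (k + 1)
      by (unfold k; rewrite (S_INR (S n)); reflexivity).
    pose proof (INR_S_ge1 n) as Hk; fold k in Hk.
    destruct (MVT_gen (fun x => Rpower x (- p)) k (k + 1)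
       (fun x => - p * Rpower x (- p - 1))) as [t [Ht Et]].
    + intros x Hx; rewrite Rmin_left, Rmax_right in Hx by lra.
      apply is_derive_Reals, derivable_pt_lim_power; lra.
    + intros x Hx; rewrite Rmin_left, Rmax_right in Hx by lra.
      apply derivable_continuous_pt; eexists; apply derivable_pt_lim_power; lra.
    + rewrite Rmin_left, Rmax_right in Ht by lra.
      assert (Ht' : Rpower (k + 1) (- 1 - p) <= Rpower t (- p - 1)).
      { unfold Rpower; apply exp_le.
        assert (ln t <= ln (k + 1)) by (apply Rcomplements.ln_le; lra). nra. }
      assert (Rpower (k + 1) (- 1 - p)
              <= / p * (Rpower k (- p) - Rpower (k + 1) (- p))).
      { apply Rmult_le_reg_l with p; [lra|].
        rewrite <- Rmult_assoc, Rinv_r by lra. nra. }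
      lra. }
destruct (ex_finite_lim_seq_incr (sum_n (bnd p)) (1 + / p)) as [l Hl].
- intros n; rewrite sum_Sn; unfold plus; simpl.
  assert (0 < bnd p (S n)) by apply exp_pos; lra.
- intros n; eapply Rle_trans; [apply H|].
  assert (0 < / p) by now apply Rinv_0_lt_compat.
  assert (0 < Rpower (INR (S n)) (- p)) by apply exp_pos; nra.
- exists l; exact Hl.
Qed.

Lemma log_bound a L : 0 < a -> 0 <= L -> 1 + L <= (1 + / a) * exp (a * L).
Proof.
intros Ha HL.
assert (0 < / a) by now apply Rinv_0_lt_compat.
assert (1 + a * L <= exp (a * L)).
{ destruct (Req_dec (a * L) 0) as [E|E];
    [rewrite E, exp_0; lra | left; apply exp_ineq1; exact E]. }
apply Rle_trans with ((1 + / a) * (1 + a * L)); [|nra].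
replace ((1 + / a) * (1 + a * L)) with (1 + L + / a + a * L)
  by (field; lra).
nra.
Qed.

Lemma term_bounds s : 0 < Re s ->
  exists K del, 0 < del /\ forall n,
    Cmod (Dz s n) <= K * bnd (Re s / 2) n /\
    Cmod (Dz1 s n) <= K * bnd (Re s / 2) n /\
    forall h, Cmod h < del ->
      Cmod (Dz (s + h) n - Dz s n - h * Dz1 s n)%C <= K * Cmod h ^ 2 * bnd (Re s / 2) n.
Proof.
set (sg := Re s); intros Hs.
set (a := sg / 8); set (c := 1 + / a).
assert (Ha : 0 < a) by (unfold a; lra).
assert (Hc : 1 <= c) by (unfold c; pose proof (Rinv_0_lt_compat a Ha); lra).
set (P := Cmod (s * (s - 1))%C); set (P1 := Cmod (2 * s - 1)%C).
set (Q := (Cmod s + 1) * (Cmod s + 2)).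
assert (HP : 0 <= P) by apply Cmod_ge_0.
assert (HP1 : 0 <= P1) by apply Cmod_ge_0.
assert (HQ : 0 <= Q) by (unfold Q; pose proof (Cmod_ge_0 s); nra).
set (A := P + P1 + 4 * Q + 2).
exists (2 * (A * c ^ 2)), (Rmin 1 a); split; [apply Rmin_glb_lt; lra|].
intros n; set (k := INR (S n)).
assert (Hk : 1 <= k) by apply INR_S_ge1.
(* pointwise bound for z (x-k) x^(-s) / x *)
assert (HB : forall x z m, k <= x <= k + 1 -> 0 <= m ->
   Cmod z <= m * (1 + ln x) ^ 2 * exp (a * ln x) ->
   Cmod (z * RtoC (x - k) * rcpow x (- s) * RtoC (/ x))%C
   <= m * c ^ 2 * bnd (sg / 2) n).
{ intros x z m Hx Hm Hz.
  assert (HL : 0 <= ln x) by (rewrite <- ln_1; apply Rcomplements.ln_le; lra).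
  rewrite !Cmod_mult, Cmod_rcpow, !Cmod_R, (Rabs_pos_eq (x - k)) by lra.
  rewrite Rabs_pos_eq by (left; apply Rinv_0_lt_compat; lra).
  replace (Re (- s)%C) with (- sg) by reflexivity.
  assert (Hi : / x = exp (- ln x)) by (rewrite exp_Ropp, exp_ln; lra).
  assert (Hlog : (1 + ln x) ^ 2 <= c ^ 2 * exp (2 * a * ln x)).
  { pose proof (log_bound a (ln x) Ha HL) as H; fold c in H.
    replace (2 * a * ln x) with (a * ln x + a * ln x) by ring; rewrite exp_plus.
    apply Rle_trans with ((c * exp (a * ln x)) ^ 2); [|right; ring].
    apply pow_incr; lra. }
  assert (Hz2 : Cmod z <= m * c ^ 2 * exp (3 * a * ln x)).
  { eapply Rle_trans; [exact Hz|].
    replace (3 * a * ln x) with (2 * a * ln x + a * ln x) by ring; rewrite exp_plus.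
    rewrite <- Rmult_assoc; apply Rmult_le_compat_r; [left; apply exp_pos|].
    rewrite (Rmult_assoc m); apply Rmult_le_compat_l; assumption. }
  assert (Hfin : exp (3 * a * ln x) * (Rpower x (- sg) * / x) <= bnd (sg / 2) n).
  { unfold bnd, Rpower; fold k; rewrite Hi, <- !exp_plus; apply exp_le.
    assert (ln k <= ln x) by (apply Rcomplements.ln_le; lra).
    unfold a; nra. }
  assert (0 < Rpower x (- sg)) by apply exp_pos.
  assert (0 < / x) by (apply Rinv_0_lt_compat; lra).
  assert (Hmc : 0 <= m * c ^ 2) by (apply Rmult_le_pos; nra).
  apply Rle_trans with (m * c ^ 2 * (exp (3 * a * ln x) * (Rpower x (- sg) * / x))).
  2: now apply Rmult_le_compat_l.
  apply Rle_trans with (Cmod z * (Rpower x (- sg) * / x)).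
  - replace (Cmod z * (x - k) * Rpower x (- sg) * / x)
      with ((x - k) * (Cmod z * (Rpower x (- sg) * / x))) by ring.
    assert (0 <= Cmod z * (Rpower x (- sg) * / x)).
    { apply Rmult_le_pos; [apply Cmod_ge_0 | nra]. }
    nra.
  - rewrite <- (Rmult_assoc (m * c ^ 2)).
    apply Rmult_le_compat_r; [nra | lra]. }
assert (Hone : forall x, k <= x -> 0 <= ln x /\ 1 <= exp (a * ln x)).
{ intros x Hx.
  assert (HL : 0 <= ln x) by (rewrite <- ln_1; apply Rcomplements.ln_le; lra).
  split; [exact HL|]; rewrite <- exp_0; apply exp_le; nra. }
assert (Hfinal : forall f df m, 0 <= m ->
   (forall t, k <= t <= k + 1 -> rderive f t (df t) /\
       Cmod (df t) <= m * c ^ 2 * bnd (sg / 2) n) ->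
   Cmod (f (k + 1) - f k) <= 2 * (m * c ^ 2) * bnd (sg / 2) n).
{ intros f df m Hm Hf.
  pose proof (rderive_bound f df k (k + 1) (m * c ^ 2 * bnd (sg / 2) n)
     ltac:(lra) Hf); lra. }
assert (Hb : 0 < bnd (sg / 2) n) by apply exp_pos.
assert (Hmono : forall m, m <= A ->
   2 * (m * c ^ 2) * bnd (sg / 2) n <= 2 * (A * c ^ 2) * bnd (sg / 2) n).
{ intros m Hm; apply Rmult_le_compat_r; [lra|].
  apply Rmult_le_compat_l; [lra|]; apply Rmult_le_compat_r; nra. }
split; [|split].
- eapply Rle_trans; [apply (Hfinal (phi k s) (psi k s) P HP)|].
  + intros t Ht; split; [apply rderive_phi; lra|].
    apply HB; [assumption.. |].
    destruct (Hone t) as [H1 H2]; [lra|]; fold P.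
    rewrite Rmult_assoc, <- (Rmult_1_r P) at 1.
    apply Rmult_le_compat_l; [lra|]; nra.
  + apply Hmono; unfold A; lra.
- eapply Rle_trans; [apply (Hfinal (chi k s) (psi1 k s) (P + P1)); [lra|]|].
  + intros t Ht; split; [apply rderive_chi; lra|].
    apply HB; [assumption | lra |].
    destruct (Hone t) as [H1 H2]; [lra|].
    unfold Cminus at 1.
    eapply Rle_trans; [apply Cmod_triangle|]; rewrite Cmod_opp, Cmod_mult, Cmod_R.
    rewrite Rabs_pos_eq by lra; fold P P1.
    apply Rle_trans with ((P + P1) * (1 + ln t)); [nra|].
    rewrite Rmult_assoc; apply Rmult_le_compat_l; [lra|]; nra.
  + apply Hmono; unfold A; lra.
- intros h Hh.
  assert (Hh1 : Cmod h < 1) by (eapply Rlt_le_trans; [exact Hh | apply Rmin_l]).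
  assert (Hh2 : Cmod h < a) by (eapply Rlt_le_trans; [exact Hh | apply Rmin_r]).
  pose proof (Cmod_ge_0 h) as Hh0.
  set (m := (P1 + 4 * Q + 2) * Cmod h ^ 2).
  assert (Hm : 0 <= m) by (unfold m; apply Rmult_le_pos; nra).
  replace (Dz (s + h) n - Dz s n - h * Dz1 s n)%C with
    ((phi k (s + h) (k + 1) - phi k s (k + 1) - h * chi k s (k + 1))
     - (phi k (s + h) k - phi k s k - h * chi k s k))%C
    by (unfold Dz, Dz1; fold k; ring).
  eapply Rle_trans;
   [apply (Hfinal (fun t => phi k (s + h) t - phi k s t - h * chi k s t)%C
      (fun t => psi k (s + h) t - psi k s t - h * psi1 k s t)%C m Hm)|].
  + intros t Ht; split.
    { eapply rderive_eq.
      - apply (rderive_minus (fun t => phi k (s + h) t - phi k s t)%C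
                 (fun t => h * chi k s t)%C).
        + apply rderive_minus; apply rderive_phi; lra.
        + apply (rderive_mult (fun _ => h) (chi k s)); [apply rderive_const|].
          apply rderive_chi; lra.
      - simpl; ring. }
    destruct (Hone t) as [H1 H2]; [lra|].
    set (L := ln t) in *.
    set (e := (Cexp (- (h * RtoC L)) - 1 - - (h * RtoC L))%C).
    assert (He : Cmod e <= 4 * (Cmod h ^ 2 * L ^ 2 * exp (a * L))).
    { eapply Rle_trans; [apply Cexp_taylor|].
      rewrite Cmod_opp, Cmod_mult, Cmod_R, (Rabs_pos_eq L) by lra.
      rewrite Rpow_mult_distr; apply Rmult_le_compat_l; [lra|].
      apply Rmult_le_compat_l; [apply Rmult_le_pos; nra|].
      apply exp_le; nra. }
    assert (Hr : rcpow t (- (s + h)) = (rcpow t (- s) * (e + 1 - h * RtoC L))%C).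
    { replace (- (s + h))%C with (- s + - h)%C by ring; rewrite rcpow_add.
      f_equal; unfold e, rcpow; fold L.
      replace (- h * RtoC L)%C with (- (h * RtoC L))%C by ring; ring. }
    replace (psi k (s + h) t - psi k s t - h * psi1 k s t)%C with
      ((h * h - h * h * RtoC L * (2 * s - 1) - h * h * h * RtoC L
        + (s + h) * (s + h - 1) * e)
       * RtoC (t - k) * rcpow t (- s) * RtoC (/ t))%C
      by (unfold psi, psi1; rewrite Hr; fold L; ring).
    apply HB; [assumption | assumption |].
    fold L.
    assert (HPh : Cmod ((s + h) * (s + h - 1))%C <= Q).
    { rewrite Cmod_mult; unfold Q.
      assert (Cmod (s + h) <= Cmod s + 1)
        by (eapply Rle_trans; [apply Cmod_triangle | lra]).
      assert (Cmod (s + h - 1) <= Cmod s + 2).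
      { unfold Cminus; eapply Rle_trans; [apply Cmod_triangle|].
        rewrite Cmod_opp, Cmod_1; lra. }
      apply Rmult_le_compat; try apply Cmod_ge_0; assumption. }
    eapply Rle_trans; [apply Cmod_triangle|].
    assert (Hm1 : Cmod (h * h - h * h * RtoC L * (2 * s - 1) - h * h * h * RtoC L)%C
              <= Cmod h ^ 2 * (1 + L * P1 + L)).
    { unfold Cminus at 1; eapply Rle_trans; [apply Cmod_triangle|].
      rewrite Cmod_opp.
      eapply Rle_trans; [apply Rplus_le_compat_r; unfold Cminus at 1; apply Cmod_triangle|].
      rewrite Cmod_opp, !Cmod_mult, Cmod_R, (Rabs_pos_eq L) by lra; fold P1.
      assert (Cmod h * Cmod h * Cmod h * L <= Cmod h * Cmod h * L).
      { apply Rmult_le_compat_r; [lra|]. nra. }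
      simpl; rewrite Rmult_1_r. nra. }
    assert (Hm2 : Cmod ((s + h) * (s + h - 1) * e)%C
              <= Q * (4 * (Cmod h ^ 2 * L ^ 2 * exp (a * L)))).
    { rewrite Cmod_mult; apply Rmult_le_compat; try apply Cmod_ge_0; assumption. }
    set (X := exp (a * L)) in *; set (H := Cmod h ^ 2) in *.
    assert (HH : 0 <= H) by (unfold H; nra).
    apply Rle_trans with (H * ((1 + L * P1 + L) + 4 * Q * (L ^ 2 * X))); [nra|].
    unfold m.
    replace ((P1 + 4 * Q + 2) * H * (1 + L) ^ 2 * X)
      with (H * ((P1 + 2) * ((1 + L) ^ 2 * X) + 4 * Q * ((1 + L) ^ 2 * X))) by ring.
    apply Rmult_le_compat_l; [exact HH|].
    assert (HX : 1 + L <= (1 + L) ^ 2 * X) by nra.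
    assert (HX2 : L ^ 2 * X <= (1 + L) ^ 2 * X) by (apply Rmult_le_compat_r; nra).
    apply Rplus_le_compat.
    * apply Rle_trans with ((P1 + 2) * (1 + L)); [nra|].
      apply Rmult_le_compat_l; lra.
    * apply Rmult_le_compat_l; lra.
  + replace (2 * (A * c ^ 2) * Cmod h ^ 2) with (2 * (A * Cmod h ^ 2 * c ^ 2)) by ring.
    apply Rmult_le_compat_r; [lra|]; apply Rmult_le_compat_l; [lra|].
    apply Rmult_le_compat_r; [nra|]; unfold m, A.
    apply Rmult_le_compat_r; nra.
Qed.

Lemma rcpow_1m (x : R) (s : C) : 0 < x ->
  rcpow x (1 - s) = (RtoC x * rcpow x (- s))%C.
Proof. intros; unfold Cminus; rewrite rcpow_add, rcpow_1 by assumption; reflexivity. Qed.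

Lemma zeta_approx_telescope (s : C) N : s <> 1 ->
  (zeta_approx s (S N) = (sum_n (G := C_AbelianMonoid) (Dz s) N + - s) * / (1 - s))%C.
Proof.
intros Hs.
assert (H1 : (1 - s <> 0)%C)
  by (intros H; apply Hs; symmetry; now apply Ceq_minus).
assert (HD : forall n, Dz s n = ((1 - s) * rcpow (INR (S (S n))) (- s)
          - rcpow (INR (S (S n))) (1 - s) + rcpow (INR (S n)) (1 - s))%C).
{ intros n; unfold Dz, phi; pose proof (INR_S_ge1 n).
  rewrite (S_INR (S n)); set (k := INR (S n)) in *.
  rewrite !rcpow_1m by lra.
  replace (k + 1 - k) with 1 by ring; replace (k - k) with 0 by ring; ring. }
unfold zeta_approx; induction N as [|N IH].
- rewrite sum_Sn, !sum_O, HD; unfold plus; simpl.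
  rewrite !rcpow_1m by lra.
  replace (rcpow 1 (- s)) with (RtoC 1); [field; exact H1|].
  unfold rcpow; rewrite ln_1, Cmult_0_r, Cexp_0; reflexivity.
- rewrite sum_Sn, (sum_Sn (Dz s)), HD.
  repeat match goal with |- context [@plus ?G ?x ?y] =>
    change (@plus G x y) with (Cplus x y) end.
  set (f := fun n => rcpow (INR (S n)) (- s)) in *.
  replace (sum_n f (S N)) with
    ((sum_n (G := C_AbelianMonoid) (Dz s) N + - s) * / (1 - s)
     + rcpow (INR (S (S N))) (1 - s) / (1 - s))%C
    by (rewrite <- IH; ring).
  change (f (S (S N))) with (rcpow (INR (S (S (S N)))) (- s)).
  field; exact H1.
Qed.

Lemma zeta_lim (s : C) z :
  filterlim (fun N => zeta_approx s (S N)) eventually (locally (z : C)) -> zeta s = z.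
Proof.
intros H; unfold zeta; destruct z as [x y].
assert (Hx : is_lim_seq (fun N => Re (zeta_approx s N)) x).
{ apply is_lim_seq_incr_1.
  exact (filterlim_comp _ _ _ _ fst _ _ _ H
    (continuous_fst (U := R_UniformSpace) (V := R_UniformSpace) x y)). }
assert (Hy : is_lim_seq (fun N => Im (zeta_approx s N)) y).
{ apply is_lim_seq_incr_1.
  exact (filterlim_comp _ _ _ _ snd _ _ _ H
    (continuous_snd (U := R_UniformSpace) (V := R_UniformSpace) x y)). }
rewrite (is_lim_seq_unique _ _ Hx), (is_lim_seq_unique _ _ Hy); reflexivity.
Qed.

Lemma ex_series_D (s : C) : 0 < Re s -> exists l : C, is_series (V := C_NormedModule) (Dz s) l.
Proof.
intros Hs; destruct (term_bounds s Hs) as [K [del [_ H]]].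
apply (ex_series_le (V := C_CompleteNormedModule) _ (fun n => K * bnd (Re s / 2) n)).
- intros n; apply H.
- apply (ex_series_scal (V := R_NormedModule) K (bnd (Re s / 2))), ex_series_bnd; lra.
Qed.

Lemma ex_series_D1 (s : C) : 0 < Re s -> exists l : C, is_series (V := C_NormedModule) (Dz1 s) l.
Proof.
intros Hs; destruct (term_bounds s Hs) as [K [del [_ H]]].
apply (ex_series_le (V := C_CompleteNormedModule) _ (fun n => K * bnd (Re s / 2) n)).
- intros n; apply H.
- apply (ex_series_scal (V := R_NormedModule) K (bnd (Re s / 2))), ex_series_bnd; lra.
Qed.

Lemma zeta_approx_cvg (s l : C) : s <> 1 -> is_series (V := C_NormedModule) (Dz s) l ->
  filterlim (fun N => zeta_approx s (S N)) eventually
    (locally ((l + - s) * / (1 - s) : C)%C).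
Proof.
intros Hs Hl.
apply filterlim_ext with
  (fun N => (/ (1 - s) * (sum_n (G := C_AbelianMonoid) (Dz s) N + - s))%C).
{ intros N; rewrite zeta_approx_telescope by assumption; apply Cmult_comm. }
rewrite Cmult_comm.
eapply filterlim_comp;
  [|exact (filterlim_scal_r (V := C_NormedModule) (/ (1 - s))%C (l + - s)%C)].
apply (filterlim_comp_2 (H := locally (- s)%C)
   (sum_n (G := C_AbelianMonoid) (Dz s)) (fun _ => (- s)%C) Cplus (G := locally l)).
- exact Hl.
- apply filterlim_const.
- exact (filterlim_plus (V := C_NormedModule) l (- s)%C).
Qed.

Lemma zeta_series (s l : C) : s <> 1 -> is_series (V := C_NormedModule) (Dz s) l ->
  zeta s = ((l + - s) * / (1 - s))%C.
Proof. intros; now apply zeta_lim, zeta_approx_cvg. Qed.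

Lemma quad_derive (f : C -> C) s l K del : 0 < del ->
  (forall h, Cmod h < del -> Cmod (f (s + h) - f s - h * l)%C <= K * Cmod h ^ 2) ->
  is_derive (K := C_AbsRing) (V := AbsRing_NormedModule C_AbsRing) f s l.
Proof.
intros Hd H; split; [apply is_linear_scal_l|].
intros x Hx.
apply (is_filter_lim_locally_unique (V := AbsRing_NormedModule C_AbsRing)) in Hx.
subst x.
intros eps.
assert (HK : 0 < Rabs K + 1) by (pose proof (Rabs_pos K); lra).
assert (Hr : 0 < Rmin del (eps / (Rabs K + 1))).
{ apply Rmin_glb_lt; [exact Hd | apply Rdiv_lt_0_compat; [apply cond_pos | exact HK]]. }
exists (mkposreal _ Hr); intros y Hy.
change (Cmod (y - s) < Rmin del (eps / (Rabs K + 1))) in Hy.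
change (Cmod (f y - f s - (y - s) * l)%C <= eps * Cmod (y - s)).
set (h := (y - s)%C) in *.
assert (Hh1 : Cmod h < del) by (eapply Rlt_le_trans; [exact Hy | apply Rmin_l]).
assert (Hh2 : Cmod h < eps / (Rabs K + 1))
  by (eapply Rlt_le_trans; [exact Hy | apply Rmin_r]).
replace y with (s + h)%C by (unfold h; ring).
eapply Rle_trans; [now apply H|].
pose proof (Cmod_ge_0 h); pose proof (Rle_abs K).
assert ((Rabs K + 1) * Cmod h <= eps).
{ apply Rlt_le, Rmult_lt_reg_r with (/ (Rabs K + 1));
    [now apply Rinv_0_lt_compat|].
  replace ((Rabs K + 1) * Cmod h * / (Rabs K + 1)) with (Cmod h) by (field; lra).
  exact Hh2. }
apply Rle_trans with ((Rabs K + 1) * Cmod h * Cmod h); [simpl; nra|].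
apply Rmult_le_compat_r; assumption.
Qed.

Lemma is_series_bound (u : nat -> C) (v : nat -> R) l L :
  is_series (V := C_NormedModule) u l -> is_series v L ->
  (forall n, Cmod (u n) <= v n) -> Cmod l <= L.
Proof.
intros Hu Hv H.
assert (H1 : is_lim_seq (fun n => Cmod (sum_n (G := C_AbelianMonoid) u n)) (Cmod l)).
{ exact (filterlim_comp _ _ _ _ _ _ _ _ Hu (filterlim_norm (V := C_NormedModule) l)). }
assert (H2 : is_lim_seq (sum_n v) L) by exact Hv.
apply (is_lim_seq_le _ _ _ _) with (2 := H1) (3 := H2).
intros n; eapply Rle_trans;
  [exact (norm_sum_n_m (V := C_NormedModule) u 0 n)|].
apply sum_n_m_le; exact H.
Qed.

Lemma ex_derive_zeta (s : C) : 0 < Re s -> s <> 1 ->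
  ex_derive (K := C_AbsRing) (V := C_NormedModule) zeta s.
Proof.
intros Hs Hs1.
assert (H1 : (1 - s <> 0)%C)
  by (intros H; apply Hs1; symmetry; now apply Ceq_minus).
set (r := Rmin (Re s) (Cmod (1 - s) / 2)).
assert (Hr : 0 < r).
{ apply Rmin_glb_lt; [exact Hs|]; apply Cmod_gt_0 in H1; lra. }
assert (Hnear : forall h, Cmod h < r -> 0 < Re (s + h) /\
   Cmod (1 - s) / 2 <= Cmod (1 - (s + h)) /\ (1 - (s + h) <> 0)%C).
{ intros h Hh.
  assert (Hh1 : Cmod h < Re s) by (eapply Rlt_le_trans; [exact Hh | apply Rmin_l]).
  assert (Hh2 : Cmod h < Cmod (1 - s) / 2)
    by (eapply Rlt_le_trans; [exact Hh | apply Rmin_r]).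
  assert (Hlow : Cmod (1 - s) / 2 <= Cmod (1 - (s + h))).
  { pose proof (Cmod_triangle (1 - (s + h)) h) as T.
    replace (1 - (s + h) + h)%C with (1 - s)%C in T by ring; lra. }
  split; [|split; [exact Hlow|]].
  - pose proof (re_le_Cmod h) as T; apply Rcomplements.Rabs_le_between in T.
    rewrite re_plus; lra.
  - intros E; rewrite E, Cmod_0 in Hlow; apply Cmod_gt_0 in H1; lra. }
set (G := fun y : C => ((1 - y) * zeta y + y)%C).
assert (HG : forall y, 0 < Re y -> (1 - y <> 0)%C ->
   is_series (V := C_NormedModule) (Dz y) (G y)).
{ intros y Hy Hy1; destruct (ex_series_D y Hy) as [l Hl].
  replace (G y) with l; [exact Hl|].
  unfold G; rewrite (zeta_series y l); [ | | exact Hl].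
  { match goal with |- ?u = ?v => change (@eq C u v) end; field; exact Hy1. }
  intros E; apply Hy1; rewrite E; ring. }
destruct (ex_series_D1 s Hs) as [g Hg].
assert (dG : is_derive (K := C_AbsRing) (V := AbsRing_NormedModule C_AbsRing) G s g).
{ destruct (term_bounds s Hs) as [K [del [Hd HK]]].
  destruct (ex_series_bnd (Re s / 2) ltac:(lra)) as [B HB].
  apply (quad_derive G s g (K * B) (Rmin del r)); [now apply Rmin_glb_lt|].
  intros h Hh.
  assert (Hh1 : Cmod h < del) by (eapply Rlt_le_trans; [exact Hh | apply Rmin_l]).
  assert (Hh2 : Cmod h < r) by (eapply Rlt_le_trans; [exact Hh | apply Rmin_r]).
  destruct (Hnear h Hh2) as [N1 [_ N2]].
  replace (K * B * Cmod h ^ 2) with (K * Cmod h ^ 2 * B) by ring.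
  apply (is_series_bound (fun n => Dz (s + h) n - Dz s n - h * Dz1 s n)%C
           (fun n => K * Cmod h ^ 2 * bnd (Re s / 2) n)).
  - exact (is_series_minus (V := C_NormedModule) _ _ _ _
      (is_series_minus (V := C_NormedModule) _ _ _ _
         (HG _ N1 N2) (HG _ Hs H1))
      (is_series_scal (V := C_NormedModule) h _ _ Hg)).
  - exact (is_series_scal (K * Cmod h ^ 2) _ _ HB).
  - intros n; now apply HK. }
assert (dI : is_derive (K := C_AbsRing) (V := AbsRing_NormedModule C_AbsRing)
               (fun y : C => / (1 - y))%C s (/ ((1 - s) * (1 - s)))%C).
{ apply (quad_derive _ _ _
    (/ (Cmod (1 - s) * Cmod (1 - s) * (Cmod (1 - s) / 2))) r Hr).
  intros h Hh; destruct (Hnear h Hh) as [_ [N1 N2]].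
  pose proof H1 as H2; apply Cmod_gt_0 in H2.
  replace (/ (1 - (s + h)) - / (1 - s) - h * / ((1 - s) * (1 - s)))%C
    with (h * h * / ((1 - s) * (1 - s) * (1 - (s + h))))%C by (field; tauto).
  rewrite !Cmod_mult, Cmod_inv, !Cmod_mult
    by (repeat apply Cmult_neq_0; assumption).
  rewrite Rmult_comm; simpl; rewrite Rmult_1_r.
  apply Rmult_le_compat_r; [apply Rmult_le_pos; apply Cmod_ge_0|].
  apply Rinv_le_contravar; [repeat apply Rmult_lt_0_compat; lra|].
  apply Rmult_le_compat_l; [nra | exact N1]. }
assert (dGm : is_derive (K := C_AbsRing) (V := AbsRing_NormedModule C_AbsRing)
   (fun y => G y + - y)%C s (g + - (1))%C).
{ apply (is_derive_plus (K := C_AbsRing) (V := AbsRing_NormedModule C_AbsRing)); [exact dG|].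
  exact (is_derive_opp (V := AbsRing_NormedModule C_AbsRing) _ _ _
           (is_derive_id (K := C_AbsRing) s)). }
assert (Hzy : forall y : C, Cmod (y - s) < r -> ((G y + - y) * / (1 - y))%C = zeta y).
{ intros y Hy; destruct (Hnear _ Hy) as [_ [_ N]].
  replace (s + (y - s))%C with y in N by ring.
  unfold G; field; exact N. }
apply ex_derive_ext_loc with (fun y : C => (G y + - y) * / (1 - y))%C.
- exists (mkposreal r Hr); exact Hzy.
- eexists; split; [apply is_linear_scal_l|].
  exact (proj2 (is_derive_mult (K := C_AbsRing) _ _ _ _ _ dGm dI Cmult_comm)).
Qed.

Lemma zeta_Dirichlet (s : C) : 1 < Re s ->
  is_series (V := C_NormedModule) (fun n => rcpow (INR (S n)) (- s)) (zeta s).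
Proof.
intros Hs.
assert (Hs1 : s <> 1) by (intros E; rewrite E in Hs; simpl in Hs; lra).
destruct (ex_series_D s ltac:(lra)) as [l Hl].
pose proof (zeta_approx_cvg s l Hs1 Hl) as Hz.
rewrite <- (zeta_series s l Hs1 Hl) in Hz.
assert (Hz' : filterlim (zeta_approx s) eventually (locally (zeta s : C))).
{ intros P HP; destruct (Hz P HP) as [N HN]; exists (S N); intros [|n] Hn; [lia|].
  apply HN; lia. }
assert (H0 : filterlim (fun N => rcpow (INR (S N)) (1 - s) / (1 - s))%C eventually
               (locally (0 : C))).
{ apply (filterlim_norm_zero (V := C_NormedModule)).
  assert (is_lim_seq (fun N => Rpower (INR (S N)) (1 - Re s) * Cmod (/ (1 - s))) 0).
  { replace (Finite 0) with (Rbar_mult 0 (Cmod (/ (1 - s))))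
      by (simpl; f_equal; ring).
    apply is_lim_seq_scal_r; unfold Rpower.
    apply is_lim_comp_seq with m_infty; [exact is_lim_exp_m | exists 0%nat; easy |].
    replace m_infty with (Rbar_mult (1 - Re s) p_infty).
    2: { simpl; destruct Rle_dec; [exfalso; lra | reflexivity]. }
    apply is_lim_seq_scal_l.
    apply is_lim_comp_seq with p_infty; [exact is_lim_ln_p | exists 0%nat; easy |].
    apply -> (is_lim_seq_incr_1 INR); exact is_lim_seq_INR. }
  eapply filterlim_ext; [|exact H]; intros N.
  change (Rpower (INR (S N)) (1 - Re s) * Cmod (/ (1 - s))
          = Cmod (rcpow (INR (S N)) (1 - s) / (1 - s))%C).
  unfold Cdiv; rewrite Cmod_mult, Cmod_rcpow; reflexivity. }
unfold is_series.
apply filterlim_ext with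
  (fun N => zeta_approx s N + rcpow (INR (S N)) (1 - s) / (1 - s))%C.
{ intros N; unfold zeta_approx, Cminus.
  rewrite <- Cplus_assoc, (Cplus_comm (- _)), Cplus_opp_r; apply Cplus_0_r. }
rewrite <- (Cplus_0_r (zeta s)).
apply (filterlim_comp_2 (G := locally (zeta s)) (H := locally (0 : C)) _ _ Cplus Hz' H0).
exact (filterlim_plus (V := C_NormedModule) (zeta s) (RtoC 0)).
Qed.

Theorem zeta_spec :
  (forall s : C, 1 < Re s ->
     is_series (V := C_NormedModule) (fun n => rcpow (INR (S n)) (- s)) (zeta s))
  /\ (forall s : C, 0 < Re s -> s <> 1 ->
     ex_derive (K := C_AbsRing) (V := C_NormedModule) zeta s).
Proof. split; [exact zeta_Dirichlet | exact ex_derive_zeta]. Qed.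

End ZetaContinuation.

(* Main.v *)
(* Write F(s) = zeta(1/2+as) zeta(1/2-bs) zeta(1/2-cs), so that I(T) is the integral of
   F over s = it, 0 <= t <= T.  Move the line of integration to Re s = -th with
   1/(2c) < th < 1/(2a): there the last two factors are absolutely convergent Dirichlet
   series, while the first one is a Dirichlet polynomial of length about T up to
   O(T^(1/2+a th)/t).  The horizontal sides cost T^(3/4), by the bound
   zeta(sigma+it) << t^((1-sigma)/2) for 0 < sigma <= 3/4 (van der Corput).

   Integrating the product of the three polynomials term by term, the triples with
   n1^a = n2^b n3^c give sigma T, and every other triple contributes at most
   min(T, 3/|a log(x/n1)|), where x = (n2^b n3^c)^(1/a).  The triples with |n1 - x| >= 1
   sum to O(T^(1/2+a th) log T), which is admissible for th close to 1/(2c).  For each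
   (n2,n3) at most two n1 remain; as n1 is then close to x, their weight is about
   (n2 n3 x)^(-1/2).  Here |n1^a - n2^b n3^c| >= 1 gives the first bound and
   Conjecture W the second.

   For computability, the tail of the diagonal sum is bounded by the same near-diagonal
   sum, with an explicit rate. *)

Require Import Defs.
From Stdlib Require Import Reals Lra Lia Psatz Arith List FunctionalExtensionality.
From Coquelicot Require Import Coquelicot.
Import ZetaContinuation.
Open Scope R_scope.

(** * Finite sums over lists *)

(** Moving left by th trades one factor against two: the first keeps the positive abscissa 1/2 - a
    th only while a th < 1/2, the other two pass abscissa 1 once c th > 1/2, and a < c leaves room
    for both. The polynomials replacing the last two factors can then have any length M, at no cost,
    so every later sum is bounded uniformly in M and only the length N of the first one, comparable
    with T, enters the estimates.

    The strip crossed contains the poles -1/(2b) and -1/(2c) of the last two factors, both real;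
    hence the line is moved only above height 1, and the integral over [0,1] is a constant.

    A Dirichlet polynomial of length comparable with |s| is the delicate approximation: first-order
    Euler-Maclaurin loses a factor |s| in the error. Treating the tail as a geometric series with
    slowly varying ratio avoids that loss and stays elementary.

    The sum of (n2 n3 x)^(-1/2) min(T, Y(n2,n3)) over pairs is the single quantity W of the final
    estimates: it bounds the near-diagonal terms and also T times the part of the diagonal sum
    outside the box. The two error bounds differ only in the choice of Y. *)

Definition lsum {A : Type} (f : A -> R) (l : list A) : R :=
  fold_right Rplus 0 (map f l).
Definition csum {A : Type} (f : A -> C) (l : list A) : C :=
  fold_right Cplus 0%C (map f l).

Lemma lsum_app {A} (f : A -> R) l l' : lsum f (l ++ l') = lsum f l + lsum f l'.
Proof.
unfold lsum; induction l as [|x l IH]; simpl; [ring|]. rewrite IH; ring.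
Qed.

Lemma lsum_ext {A} (f g : A -> R) l :
  (forall x, In x l -> f x = g x) -> lsum f l = lsum g l.
Proof.
intros H; unfold lsum; f_equal; apply map_ext_in; exact H.
Qed.

Lemma lsum_le {A} (f g : A -> R) l :
  (forall x, In x l -> f x <= g x) -> lsum f l <= lsum g l.
Proof.
unfold lsum; induction l as [|x l IH]; simpl; intros H; [lra|].
apply Rplus_le_compat; [apply H; auto | apply IH; auto].
Qed.

Lemma lsum_plus {A} (f g : A -> R) l :
  lsum (fun x => f x + g x) l = lsum f l + lsum g l.
Proof.
unfold lsum; induction l as [|x l IH]; simpl; [ring|]. rewrite IH; ring.
Qed.

Lemma lsum_scal {A} k (f : A -> R) l : lsum (fun x => k * f x) l = k * lsum f l.
Proof.
unfold lsum; induction l as [|x l IH]; simpl; [ring|]. rewrite IH; ring.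
Qed.

Lemma lsum_scal_r {A} k (f : A -> R) l : lsum (fun x => f x * k) l = lsum f l * k.
Proof.
rewrite Rmult_comm, <- lsum_scal; apply lsum_ext; intros; ring.
Qed.

Lemma lsum_nonneg {A} (f : A -> R) l : (forall x, In x l -> 0 <= f x) -> 0 <= lsum f l.
Proof.
unfold lsum; induction l as [|x l IH]; simpl; intros H; [lra|].
apply Rplus_le_le_0_compat; [apply H; auto | apply IH; auto].
Qed.

Lemma lsum_map {A B} (h : A -> B) (f : B -> R) l :
  lsum f (map h l) = lsum (fun x => f (h x)) l.
Proof. unfold lsum; now rewrite map_map. Qed.

Lemma lsum_prod {A B} (f : A * B -> R) l l' :
  lsum f (list_prod l l') = lsum (fun x => lsum (fun y => f (x, y)) l') l.
Proof.
induction l as [|x l IH]; [reflexivity|]. simpl list_prod.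
rewrite lsum_app, lsum_map, IH; reflexivity.
Qed.

Lemma lsum_filter {A} (P : A -> bool) (f : A -> R) l :
  lsum f (filter P l) = lsum (fun x => if P x then f x else 0) l.
Proof.
unfold lsum; induction l as [|x l IH]; simpl; [ring|].
destruct (P x); simpl; rewrite IH; ring.
Qed.

(** Each entry of [l] is removed once from [l']; what remains in [l'] is nonnegative. This compares
    arbitrary finite lists of solutions with sums over boxes. *)
Lemma lsum_incl {A} (f : A -> R) l l' : NoDup l -> incl l l' ->
  (forall x, In x l' -> 0 <= f x) -> lsum f l <= lsum f l'.
Proof.
intros Hd; revert l'; induction Hd as [|x l Hx Hd IH]; intros l' Hi Hp.
- apply lsum_nonneg; exact Hp.
- destruct (in_split x l') as [l1 [l2 E]]; [apply Hi; now left|]. subst l'.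
  assert (H : lsum f l <= lsum f (l1 ++ l2)).
  { apply IH.
    - intros y Hy. specialize (Hi y (or_intror Hy)).
      apply in_app_or in Hi; apply in_or_app.
      destruct Hi as [Hi|[Hi|Hi]]; auto. subst y; contradiction.
    - intros y Hy; apply Hp; apply in_app_or in Hy; apply in_or_app.
      destruct Hy; simpl; auto. }
  change (lsum f (x :: l)) with (f x + lsum f l).
  rewrite lsum_app in H |- *.
  change (lsum f (x :: l2)) with (f x + lsum f l2). lra.
Qed.

Lemma lsum_swap {A B} (f : A -> B -> R) l l' :
  lsum (fun x => lsum (f x) l') l = lsum (fun y => lsum (fun x => f x y) l) l'.
Proof.
induction l as [|x l IH].
- unfold lsum at 1; simpl. symmetry; induction l' as [|y l' IH']; [reflexivity|].
  unfold lsum at 1; simpl. fold (lsum (fun y => lsum (fun x => f x y) nil) l').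
  rewrite IH'; unfold lsum; simpl; ring.
- change (lsum (f x) l' + lsum (fun x => lsum (f x) l') l = 
          lsum (fun y => f x y + lsum (fun x => f x y) l) l').
  rewrite IH, lsum_plus; reflexivity.
Qed.

Lemma csum_app {A} (f : A -> C) l l' : (csum f (l ++ l') = csum f l + csum f l')%C.
Proof.
unfold csum; induction l as [|x l IH]; simpl; [ring|]. rewrite IH; ring.
Qed.

Lemma csum_ext {A} (f g : A -> C) l :
  (forall x, In x l -> f x = g x) -> csum f l = csum g l.
Proof.
intros H; unfold csum; f_equal; apply map_ext_in; exact H.
Qed.

Lemma csum_plus {A} (f g : A -> C) l :
  (csum (fun x => f x + g x) l = csum f l + csum g l)%C.
Proof.
unfold csum; induction l as [|x l IH]; simpl; [ring|]. rewrite IH; ring.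
Qed.

Lemma csum_scal {A} k (f : A -> C) l : (csum (fun x => k * f x) l = k * csum f l)%C.
Proof.
unfold csum; induction l as [|x l IH]; simpl; [ring|]. rewrite IH; ring.
Qed.

Lemma csum_map {A B} (h : A -> B) (f : B -> C) l :
  csum f (map h l) = csum (fun x => f (h x)) l.
Proof. unfold csum; now rewrite map_map. Qed.

Lemma csum_mult {A B} (f : A -> C) (g : B -> C) l l' :
  (csum f l * csum g l' = csum (fun p => f (fst p) * g (snd p)) (list_prod l l'))%C.
Proof.
induction l as [|x l IH]; [unfold csum; simpl; ring|]. simpl list_prod.
rewrite csum_app, csum_map, <- IH.
change (csum f (x :: l)) with (f x + csum f l)%C. simpl.
rewrite csum_scal; ring.
Qed.

Lemma Cmod_csum {A} (f : A -> C) l : Cmod (csum f l) <= lsum (fun x => Cmod (f x)) l.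
Proof.
induction l as [|x l IH]; [unfold csum, lsum; simpl; rewrite Cmod_0; lra|].
change (csum f (x :: l)) with (f x + csum f l)%C.
change (lsum (fun x => Cmod (f x)) (x :: l)) with (Cmod (f x) + lsum (fun x => Cmod (f x)) l).
eapply Rle_trans; [apply Cmod_triangle | lra].
Qed.

Lemma Cmod_csum_le {A} (f : A -> C) g l : (forall x, In x l -> Cmod (f x) <= g x) ->
  Cmod (csum f l) <= lsum g l.
Proof. intros H; eapply Rle_trans; [apply Cmod_csum | now apply lsum_le]. Qed.

Lemma Cmod_minus_sym z w : Cmod (z - w) = Cmod (w - z).
Proof. rewrite <- Cmod_opp; f_equal; ring. Qed.

Lemma Cmod_triangle3 x y z : Cmod (x - z) <= Cmod (x - y) + Cmod (y - z).
Proof. replace (x - z)%C with ((x - y) + (y - z))%C by ring. apply Cmod_triangle. Qed.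

Lemma Cmod_minus_le x y : Cmod (x - y) <= Cmod x + Cmod y.
Proof. unfold Cminus; eapply Rle_trans; [apply Cmod_triangle|]; rewrite Cmod_opp; lra. Qed.

Lemma Cmod_minus_ge x y : Cmod x - Cmod y <= Cmod (x - y).
Proof.
pose proof (Cmod_triangle (x - y) y) as H.
replace (x - y + y)%C with x in H by ring. lra.
Qed.

(** * Real powers, power sums and harmonic sums *)

Lemma Rpower_pos x y : 0 < Rpower x y.
Proof. apply exp_pos. Qed.

Lemma Rpower_ge1 x y : 1 <= x -> 0 <= y -> 1 <= Rpower x y.
Proof.
intros; rewrite <- exp_0; unfold Rpower; apply exp_le.
assert (0 <= ln x) by (rewrite <- ln_1; apply Rcomplements.ln_le; lra). nra.
Qed.

Lemma ln_nonneg x : 1 <= x -> 0 <= ln x.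
Proof. intros; rewrite <- ln_1; apply Rcomplements.ln_le; lra. Qed.

Lemma Rpower_le_neg x y p : 0 < x <= y -> p <= 0 -> Rpower y p <= Rpower x p.
Proof.
intros H Hp; unfold Rpower; apply exp_le.
assert (ln x <= ln y) by (apply Rcomplements.ln_le; lra). nra.
Qed.

Lemma Rpower_le_l x y p : 0 < x <= y -> 0 <= p -> Rpower x p <= Rpower y p.
Proof.
intros H Hp; unfold Rpower; apply exp_le.
assert (ln x <= ln y) by (apply Rcomplements.ln_le; lra). nra.
Qed.

Lemma Rpower_le_r x p q : 1 <= x -> p <= q -> Rpower x p <= Rpower x q.
Proof.
intros H Hp; unfold Rpower; apply exp_le.
pose proof (ln_nonneg x H). nra.
Qed.

Lemma Rpower_mult_1 x p : 0 < x -> x * Rpower x p = Rpower x (1 + p).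
Proof. intros; rewrite Rpower_plus, Rpower_1; auto. Qed.

Lemma Rpower_base1 p : Rpower 1 p = 1.
Proof. unfold Rpower; rewrite ln_1, Rmult_0_r; apply exp_0. Qed.

(** The mean value theorem on a unit step, which does the work of comparing a power sum with an
    integral. *)
Lemma Rpower_mvt x p : 0 < x ->
  exists t, x <= t <= x + 1 /\ Rpower (x + 1) p - Rpower x p = p * Rpower t (p - 1).
Proof.
intros Hx.
destruct (MVT_gen (fun x => Rpower x p) x (x + 1) (fun x => p * Rpower x (p - 1)))
  as [t [Ht Et]].
- intros y Hy; rewrite Rmin_left, Rmax_right in Hy by lra.
  apply is_derive_Reals, derivable_pt_lim_power; lra.
- intros y Hy; rewrite Rmin_left, Rmax_right in Hy by lra.
  apply derivable_continuous_pt; eexists; apply derivable_pt_lim_power; lra.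
- rewrite Rmin_left, Rmax_right in Ht by lra. exists t; split; [lra|].
  rewrite Et; ring.
Qed.

Lemma INR_ge1 n : (1 <= n)%nat -> 1 <= INR n.
Proof. intros H; apply (le_INR 1) in H; exact H. Qed.

Lemma lsum_seq_S (f : nat -> R) a k : lsum f (seq a (S k)) = lsum f (seq a k) + f (a + k)%nat.
Proof. rewrite seq_S, lsum_app; unfold lsum; simpl; ring. Qed.

Lemma csum_seq_S (f : nat -> C) a k : (csum f (seq a (S k)) = csum f (seq a k) + f (a + k)%nat)%C.
Proof. rewrite seq_S, csum_app; unfold csum; simpl; ring. Qed.

Lemma lsum_cons {A} (f : A -> R) x l : lsum f (x :: l) = f x + lsum f l.
Proof. reflexivity. Qed.

Lemma csum_cons {A} (f : A -> C) x l : csum f (x :: l) = (f x + csum f l)%C.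
Proof. reflexivity. Qed.

Lemma sum_power_lt1 p N : 0 <= p < 1 ->
  lsum (fun n => Rpower (INR n) (- p)) (seq 1 N) <= Rpower (INR N) (1 - p) / (1 - p).
Proof.
intros Hp.
destruct N as [|N].
{ unfold lsum; simpl. apply Rcomplements.Rdiv_le_0_compat; [left; apply Rpower_pos | lra]. }
induction N as [|N IH].
- unfold lsum; simpl. rewrite !Rpower_base1.
  apply Rmult_le_reg_r with (1 - p); [lra|]. field_simplify; lra.
- rewrite lsum_seq_S. replace (1 + S N)%nat with (S (S N)) by lia.
  rewrite (S_INR (S N)). pose proof (INR_S_ge1 N) as H1.
  set (x := INR (S N)) in *.
  destruct (Rpower_mvt x (1 - p)) as [t [Ht E]]; [lra|].
  assert (H2 : Rpower (x + 1) (- p) <= Rpower t (1 - p - 1))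
    by (replace (1 - p - 1) with (- p) by ring; apply Rpower_le_neg; lra).
  apply Rmult_le_reg_r with (1 - p); [lra|].
  apply Rle_trans with (Rpower x (1 - p) + Rpower (x + 1) (- p) * (1 - p)).
  + rewrite Rmult_plus_distr_r. apply Rplus_le_compat_r.
    apply Rmult_le_compat_r with (r := 1 - p) in IH; [|lra].
    replace (Rpower x (1 - p) / (1 - p) * (1 - p)) with (Rpower x (1 - p)) in IH by (field; lra).
    exact IH.
  + replace (Rpower (x + 1) (1 - p) / (1 - p) * (1 - p)) with (Rpower (x + 1) (1 - p)) by (field; lra).
    nra.
Qed.

(** The subtracted end term makes the induction telescope; [sum_power_tail] discards it. *)
Lemma sum_power_gt1 p a k : 1 < p -> (1 <= a)%nat ->
  lsum (fun n => Rpower (INR n) (- p)) (seq (S a) k)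
   <= (Rpower (INR a) (1 - p) - Rpower (INR (a + k)) (1 - p)) / (p - 1).
Proof.
intros Hp Ha.
induction k as [|k IH].
- rewrite Nat.add_0_r; unfold lsum; simpl. right; field; lra.
- rewrite lsum_seq_S. replace (S a + k)%nat with (S (a + k)) by lia.
  replace (a + S k)%nat with (S (a + k)) by lia.
  rewrite (S_INR (a + k)).
  assert (H1 : 1 <= INR (a + k)) by (apply INR_ge1; lia).
  set (x := INR (a + k)) in *.
  destruct (Rpower_mvt x (1 - p)) as [t [Ht E]]; [lra|].
  assert (H2 : Rpower (x + 1) (- p) <= Rpower t (1 - p - 1))
    by (replace (1 - p - 1) with (- p) by ring; apply Rpower_le_neg; lra).
  apply Rmult_le_reg_r with (p - 1); [lra|].
  apply Rmult_le_compat_r with (r := p - 1) in IH; [|lra].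
  rewrite Rmult_plus_distr_r.
  unfold Rdiv in *. rewrite Rmult_assoc, Rinv_l, Rmult_1_r in IH |- * by lra.
  nra.
Qed.

(** The term n = a is bounded separately by a^(1-p), whence p/(p-1) = 1 + 1/(p-1). *)
Lemma sum_power_tail p a k : 1 < p -> (1 <= a)%nat ->
  lsum (fun n => Rpower (INR n) (- p)) (seq a k) <= p / (p - 1) * Rpower (INR a) (1 - p).
Proof.
intros Hp Ha. assert (Hi : 0 < / (p - 1)) by (apply Rinv_0_lt_compat; lra).
pose proof (INR_ge1 a Ha) as H1.
destruct k as [|k].
{ unfold lsum; simpl. apply Rmult_le_pos; [|left; apply Rpower_pos].
  apply Rmult_le_pos; lra. }
simpl seq. rewrite lsum_cons.
pose proof (sum_power_gt1 p a k Hp Ha) as H.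
assert (H2 : Rpower (INR a) (- p) <= Rpower (INR a) (1 - p)) by (apply Rpower_le_r; lra).
pose proof (Rpower_pos (INR (a + k)) (1 - p)).
replace (p / (p - 1)) with (1 + / (p - 1)) by (field; lra).
unfold Rdiv in H. nra.
Qed.

Lemma ln_diff_ge x : 0 < x -> / (x + 1) <= ln (x + 1) - ln x.
Proof.
intros Hx. 
assert (H : ln (x / (x + 1)) <= x / (x + 1) - 1).
{ assert (Hp : 0 < x / (x + 1)) by (apply Rdiv_lt_0_compat; lra).
  pose proof (exp_ineq1_le (ln (x / (x + 1)))) as E. rewrite exp_ln in E by exact Hp. lra. }
rewrite ln_div in H by lra.
replace (x / (x + 1) - 1) with (- / (x + 1)) in H by (field; lra). lra.
Qed.

Lemma sum_harmonic N : lsum (fun n => / INR n) (seq 1 N) <= 1 + ln (INR N).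
Proof.
destruct N as [|N].
{ unfold lsum; simpl. 
  (* For N = 0 the right-hand side is 1, since [ln] takes the value 0 outside the positive reals. *)
  replace (ln 0) with 0; [lra|]. unfold ln. destruct (Rlt_dec 0 0); [exfalso; lra | reflexivity]. }
induction N as [|N IH].
- unfold lsum; simpl. rewrite ln_1; lra.
- rewrite lsum_seq_S. replace (1 + S N)%nat with (S (S N)) by lia.
  rewrite (S_INR (S N)). pose proof (INR_S_ge1 N).
  pose proof (ln_diff_ge (INR (S N))). lra.
Qed.

(** * Approximating zeta by Dirichlet polynomials *)

Lemma exp_small x : 0 <= x < 1 -> exp x <= / (1 - x).
Proof.
intros H. pose proof (exp_ineq1_le (- x)). rewrite exp_Ropp in H0.
pose proof (exp_pos x).
apply Rmult_le_reg_r with (1 - x); [lra|]. rewrite Rinv_l by lra.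
apply Rmult_le_compat_l with (r := exp x) in H0; [|lra].
rewrite Rinv_r in H0 by lra. lra.
Qed.

(** The constant is 4 exp(1/10) <= 40/9, rounded up. The radius 1/10 is what n >= 10 |s| guarantees
    for z = s [ell n]. *)
Lemma one_minus_Cexp z : Cmod z <= 1 / 10 ->
  Cmod (1 - Cexp (- z) - z) <= 45 / 10 * Cmod z ^ 2.
Proof.
intros H. pose proof (Cexp_taylor (- z)) as T.
replace (Cexp (- z) - 1 - - z)%C with (- (1 - Cexp (- z) - z))%C in T by ring.
rewrite !Cmod_opp in T. eapply Rle_trans; [exact T|].
pose proof (Cmod_ge_0 z).
assert (E : exp (Cmod z) <= 10 / 9).
{ eapply Rle_trans; [apply exp_small; lra|].
  replace (10 / 9) with (/ (1 - 1 / 10)) by lra.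
  apply Rinv_le_contravar; lra. }
assert (0 <= Cmod z ^ 2) by nra. nra.
Qed.

Definition npow (s : C) (n : nat) : C := rcpow (INR n) (- s).
(* The ratio n^(-s) / (n+1)^(-s) is exp (s * ell n). *)
Definition ell (n : nat) : R := ln (1 + / INR n).
(** With q the ratio of the terms n+1 and n, this is 1/(1 - q): times [npow s n] it is the sum of
    the geometric series that starts like the Dirichlet series at n. *)
Definition inv_one_minus_ratio (s : C) (n : nat) : C := (/ (1 - Cexp (- (s * RtoC (ell n)))))%C.

Lemma ell_bounds n : (1 <= n)%nat -> / (INR n + 1) <= ell n <= / INR n.
Proof.
intros Hn; apply INR_ge1 in Hn. unfold ell.
assert (Hp : 0 < / INR n) by (apply Rinv_0_lt_compat; lra). split.
- replace (1 + / INR n) with ((INR n + 1) / INR n) by (field; lra).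
  rewrite ln_div by lra. apply ln_diff_ge; lra.
- pose proof (exp_ineq1_le (ln (1 + / INR n))) as E. rewrite exp_ln in E by lra. lra.
Qed.

Lemma ell_diff n : (1 <= n)%nat ->
  ell n - ell (S n) = ln (1 + / (INR n * (INR n + 2))).
Proof.
intros Hn; apply INR_ge1 in Hn. unfold ell. rewrite S_INR.
assert (Hp : 0 < / INR n) by (apply Rinv_0_lt_compat; lra).
assert (Hp' : 0 < / (INR n + 1)) by (apply Rinv_0_lt_compat; lra).
rewrite <- ln_div by lra. f_equal. field; lra.
Qed.

Lemma ell_diff_bounds n : (1 <= n)%nat ->
  / ((INR n + 1) ^ 2) <= ell n - ell (S n) <= / (INR n * (INR n + 2)).
Proof.
intros Hn; rewrite ell_diff by assumption; apply INR_ge1 in Hn.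
set (x := INR n) in *. assert (Hx : 0 < x * (x + 2)) by nra.
replace (1 + / (x * (x + 2))) with ((x * (x + 2) + 1) / (x * (x + 2))) by (field; lra).
split.
- rewrite ln_div by lra.
  replace ((x + 1) ^ 2) with (x * (x + 2) + 1) by ring. apply ln_diff_ge; lra.
- assert (Hp : 0 < / (x * (x + 2))) by (now apply Rinv_0_lt_compat).
  replace ((x * (x + 2) + 1) / (x * (x + 2))) with (1 + / (x * (x + 2))) by (field; lra).
  pose proof (exp_ineq1_le (ln (1 + / (x * (x + 2))))) as E. rewrite exp_ln in E by lra. lra.
Qed.

(** Divided by [ell n * ell (S n)], this says that 1/[ell] grows by 1 per step with error at most
    1/n, in accordance with 1/[ell n] = n + 1/2 + O(1/n). *)
Lemma ell_ratio n : (1 <= n)%nat ->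
  Rabs ((ell n - ell (S n)) - ell n * ell (S n)) <= ell n * ell (S n) / INR n.
Proof.
intros Hn. pose proof (ell_bounds n Hn) as H1. pose proof (ell_bounds (S n) ltac:(lia)) as H2.
pose proof (ell_diff_bounds n Hn) as H3. rewrite S_INR in H2. apply INR_ge1 in Hn.
set (x := INR n) in *. set (l := ell n) in *. set (l' := ell (S n)) in *. 
assert (P0 : 0 < / x) by (apply Rinv_0_lt_compat; lra).
assert (P1 : 0 < / (x + 1)) by (apply Rinv_0_lt_compat; lra).
assert (P2 : 0 < / (x + 1 + 1)) by (apply Rinv_0_lt_compat; lra).
assert (U : l * l' <= / x * / (x + 1)) by (apply Rmult_le_compat; lra).
assert (L : / (x + 1) * / (x + 1 + 1) <= l * l') by (apply Rmult_le_compat; lra).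
assert (A1 : l * l' * (1 + / x) >= / (x * (x + 2))).
{ apply Rle_ge. replace (/ (x * (x + 2))) with ((/ (x + 1) * / (x + 1 + 1)) * (1 + / x)) by (field; lra).
  apply Rmult_le_compat_r; lra. }
assert (A2 : l * l' * (1 - / x) <= / ((x + 1) ^ 2)).
{ apply Rle_trans with (l * l' * (1 - / (x + 1))).
  - apply Rmult_le_compat_l; [nra|].
    assert (/ (x + 1) <= / x) by (apply Rinv_le_contravar; lra). lra.
  - replace (/ (x + 1) ^ 2) with (/ x * / (x + 1) * (1 - / (x + 1))) by (field; lra).
    apply Rmult_le_compat_r; [|lra].
    assert (/ (x + 1) <= 1) by (rewrite <- Rinv_1; apply Rinv_le_contravar; lra). lra. }
unfold Rdiv. apply Rabs_le; lra.
Qed.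

Lemma npow_S s n : (1 <= n)%nat ->
  npow s (S n) = (npow s n * Cexp (- (s * RtoC (ell n))))%C.
Proof.
intros Hn; apply INR_ge1 in Hn. unfold npow, rcpow, ell. rewrite <- Cexp_plus. f_equal.
rewrite S_INR. replace (INR n + 1) with (INR n * (1 + / INR n)) by (field; lra).
assert (Hp : 0 < / INR n) by (apply Rinv_0_lt_compat; lra).
rewrite ln_mult by lra. rewrite RtoC_plus. ring.
Qed.

Lemma Cmod_npow s n : Cmod (npow s n) = Rpower (INR n) (- Re s).
Proof. unfold npow. rewrite Cmod_rcpow. reflexivity. Qed.

Lemma Cmod_pos_neq0 z : 0 < Cmod z -> z <> 0%C.
Proof. intros H; now apply Cmod_gt_0. Qed.

Lemma Cmod_ell_small s n : (1 <= n)%nat -> 10 * Cmod s <= INR n ->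
  Cmod (s * RtoC (ell n)) <= 1 / 10.
Proof.
intros Hn H. pose proof (ell_bounds n Hn) as H1. apply INR_ge1 in Hn.
rewrite Cmod_mult, Cmod_R.
assert (0 < / (INR n + 1)) by (apply Rinv_0_lt_compat; lra).
rewrite Rabs_pos_eq by lra.
apply Rle_trans with (INR n / 10 * / INR n).
- apply Rmult_le_compat; try lra. apply Cmod_ge_0.
- right; field; lra.
Qed.

Lemma one_minus_Cexp_bounds z : Cmod z <= 1 / 10 ->
  55 / 100 * Cmod z <= Cmod (1 - Cexp (- z)) <= 145 / 100 * Cmod z.
Proof.
intros H. pose proof (one_minus_Cexp z H) as T. pose proof (Cmod_ge_0 z).
assert (45 / 10 * Cmod z ^ 2 <= 45 / 100 * Cmod z) by nra.
pose proof (Cmod_triangle (1 - Cexp (- z) - z) z) as T1.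
replace (1 - Cexp (- z) - z + z)%C with (1 - Cexp (- z))%C in T1 by ring.
pose proof (Cmod_minus_ge z (- (1 - Cexp (- z) - z))) as T2.
replace (z - - (1 - Cexp (- z) - z))%C with (1 - Cexp (- z))%C in T2 by ring.
rewrite Cmod_opp in T2. lra.
Qed.

(** Since 1/(1 - exp(-z)) = 1/z + 1/2 + O(z), a step in n changes it by about (1/s)(1/[ell (S n)] -
    1/[ell n]), which is close to 1/s by [ell_ratio]. The bound has no factor |s|; this is the
    source of the uniformity for n >= 10 |s|. *)
Lemma inv_one_minus_ratio_step s n : 1 <= Cmod s -> (1 <= n)%nat -> 10 * Cmod s <= INR n ->
  Cmod (inv_one_minus_ratio s (S n) - inv_one_minus_ratio s n - / s) <= 100 / INR n.
Proof.
intros Hs Hn H.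
pose proof (ell_bounds n Hn) as L1. pose proof (ell_bounds (S n) ltac:(lia)) as L2.
pose proof (ell_diff_bounds n Hn) as L3. pose proof (ell_ratio n Hn) as L4.
pose proof (Cmod_ell_small s n Hn H) as Z1.
assert (Z2 : Cmod (s * RtoC (ell (S n))) <= 1 / 10)
  by (apply Cmod_ell_small; [lia | rewrite S_INR; lra]).
pose proof (INR_ge1 n Hn) as Hn1.
rewrite S_INR in L2. unfold inv_one_minus_ratio.
set (x := INR n) in *. set (l := ell n) in *. set (l' := ell (S n)) in *.
assert (P0 : 0 < / x) by (apply Rinv_0_lt_compat; lra).
assert (P1 : 0 < / (x + 1)) by (apply Rinv_0_lt_compat; lra).
assert (P2 : 0 < / (x + 1 + 1)) by (apply Rinv_0_lt_compat; lra).
assert (P3 : 0 < / ((x + 1) ^ 2)) by (apply Rinv_0_lt_compat; nra).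
set (z := (s * RtoC l)%C) in *. set (z' := (s * RtoC l')%C) in *.
set (d := (z - z')%C).
assert (Ez : Cmod z = Cmod s * l) by (unfold z; rewrite Cmod_mult, Cmod_R, Rabs_pos_eq; lra).
assert (Ez' : Cmod z' = Cmod s * l') by (unfold z'; rewrite Cmod_mult, Cmod_R, Rabs_pos_eq; lra).
assert (Ed : Cmod d = Cmod s * (l - l')).
{ unfold d, z, z'. replace (s * RtoC l - s * RtoC l')%C with (s * RtoC (l - l'))%C
    by (rewrite RtoC_minus; ring).
  rewrite Cmod_mult, Cmod_R, Rabs_pos_eq; lra. }
assert (Hll : l' <= l) by lra.
assert (Hdl : l - l' <= l').
{ apply Rle_trans with (1 := proj2 L3). apply Rle_trans with (2 := proj1 L2).
  apply Rinv_le_contravar; nra. }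
assert (Hz'z : Cmod z' <= Cmod z) by (rewrite Ez, Ez'; apply Rmult_le_compat_l; lra).
assert (Hdz : Cmod d <= Cmod z') by (rewrite Ed, Ez'; apply Rmult_le_compat_l; lra).
assert (D1 : Cmod d <= 1 / 10) by lra.
pose proof (one_minus_Cexp_bounds z Z1) as X1. pose proof (one_minus_Cexp_bounds z' Z2) as X2.
pose proof (one_minus_Cexp_bounds d D1) as X3.
pose proof (one_minus_Cexp z Z1) as T1. pose proof (one_minus_Cexp z' Z2) as T2.
pose proof (one_minus_Cexp d D1) as T3.
set (X := (1 - Cexp (- z'))%C) in *. set (X' := (1 - Cexp (- z))%C) in *.
set (Xd := (1 - Cexp (- d))%C) in *.
(* Because exp(-z) = exp(-z') exp(-d), the difference is governed by the small number d instead of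
   by two separate expansions. *)
assert (EY : (X' - X = (1 - X) * Xd)%C).
{ unfold X', X, Xd. replace (- z)%C with (- z' + - d)%C by (unfold d; ring).
  rewrite Cexp_plus; ring. }
assert (Hs0 : s <> 0%C) by (apply Cmod_pos_neq0; lra).
assert (Pz : 0 < Cmod z) by (rewrite Ez; apply Rmult_lt_0_compat; lra).
assert (Pz' : 0 < Cmod z') by (rewrite Ez'; apply Rmult_lt_0_compat; lra).
assert (HX : X <> 0%C) by (apply Cmod_pos_neq0; lra).
assert (HX' : X' <> 0%C) by (apply Cmod_pos_neq0; lra).
replace (/ X - / X' - / s)%C with ((s * ((1 - X) * Xd) - X * X') / (s * (X * X')))%C
  by (rewrite <- EY; field; auto).
rewrite Cmod_div by (repeat apply Cmult_neq_0; auto).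
(* [B1] and [B2] replace the two products in the numerator by their leading parts d and z z'; [B3]
   compares s d with z z', which is [ell_ratio] multiplied by s^2. *)
assert (B1 : Cmod ((1 - X) * Xd - d) <= 7 * (Cmod d * Cmod z')).
{ replace ((1 - X) * Xd - d)%C with ((Xd - d) - X * Xd)%C by ring.
  eapply Rle_trans; [apply Cmod_minus_le|]. rewrite Cmod_mult.
  pose proof (Cmod_ge_0 d). 
  assert (Cmod X * Cmod Xd <= (145 / 100 * Cmod z') * (145 / 100 * Cmod d))
    by (apply Rmult_le_compat; try apply Cmod_ge_0; lra).
  assert (Cmod d ^ 2 <= Cmod d * Cmod z') by nra. nra. }
assert (B2 : Cmod (X * X' - z * z') <= 12 * (Cmod z * Cmod z' * Cmod z)).
{ replace (X * X' - z * z')%C with ((X - z') * X' + z' * (X' - z))%C by ring.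
  eapply Rle_trans; [apply Cmod_triangle|]. rewrite !Cmod_mult.
  assert (Cmod (X - z') * Cmod X' <= (45 / 10 * Cmod z' ^ 2) * (145 / 100 * Cmod z))
    by (apply Rmult_le_compat; try apply Cmod_ge_0; lra).
  assert (Cmod z' * Cmod (X' - z) <= Cmod z' * (45 / 10 * Cmod z ^ 2))
    by (apply Rmult_le_compat_l; lra).
  assert (Cmod z' ^ 2 * Cmod z <= Cmod z * Cmod z' * Cmod z).
  { replace (Cmod z' ^ 2 * Cmod z) with (Cmod z * Cmod z' * Cmod z') by ring.
    apply Rmult_le_compat_l; nra. }
  nra. }
assert (B3 : Cmod (s * d - z * z') <= Cmod z * Cmod z' / x).
{ replace (s * d - z * z')%C with (s * s * RtoC ((l - l') - l * l'))%C
    by (unfold d, z, z'; rewrite !RtoC_minus, RtoC_mult; ring).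
  rewrite !Cmod_mult, Cmod_R, Ez, Ez'.
  replace (Cmod s * l * (Cmod s * l') / x) with (Cmod s * Cmod s * (l * l' / x)) by (field; lra).
  apply Rmult_le_compat_l; [nra|]. exact L4. }
assert (Q : 0 < Cmod z * Cmod z') by nra.
assert (B4 : Cmod s * Cmod d <= 2 * (Cmod z * Cmod z')).
{ rewrite Ed, Ez, Ez'. replace (2 * (Cmod s * l * (Cmod s * l'))) with (Cmod s * (Cmod s * (2 * (l * l')))) by ring.
  apply Rmult_le_compat_l; [lra|]. apply Rmult_le_compat_l; [lra|].
  apply Rabs_le_between in L4.
  assert (l * l' / x <= l * l' * 1).
  { unfold Rdiv; apply Rmult_le_compat_l; [nra|]. rewrite <- Rinv_1; apply Rinv_le_contravar; lra. }
  lra. }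
assert (Nm : Cmod (s * ((1 - X) * Xd) - X * X') <= Cmod z * Cmod z' * (26 * Cmod z + / x)).
{ replace (s * ((1 - X) * Xd) - X * X')%C
    with (s * ((1 - X) * Xd - d) + (s * d - z * z') - (X * X' - z * z'))%C by ring.
  eapply Rle_trans; [apply Cmod_minus_le|].
  eapply Rle_trans; [apply Rplus_le_compat_r, Cmod_triangle|].
  rewrite (Cmod_mult s).
  assert (Cmod s * Cmod ((1 - X) * Xd - d) <= 14 * (Cmod z * Cmod z' * Cmod z)).
  { apply Rle_trans with (Cmod s * (7 * (Cmod d * Cmod z'))).
    { apply Rmult_le_compat_l; lra. }
    apply Rle_trans with (7 * (Cmod s * Cmod d) * Cmod z'); [right; ring|].
    apply Rle_trans with (7 * (2 * (Cmod z * Cmod z')) * Cmod z').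
    { apply Rmult_le_compat_r; lra. }
    apply Rle_trans with (14 * (Cmod z * Cmod z') * Cmod z); [|right; ring].
    replace (7 * (2 * (Cmod z * Cmod z'))) with (14 * (Cmod z * Cmod z')) by ring.
    apply Rmult_le_compat_l; lra. }
  unfold Rdiv in B3. nra. }
rewrite !Cmod_mult.
assert (Dn : 30 / 100 * (Cmod z * Cmod z') <= Cmod X * Cmod X').
{ apply Rle_trans with ((55 / 100 * Cmod z') * (55 / 100 * Cmod z)); [nra|].
  apply Rmult_le_compat; nra. }
assert (Hzx : Cmod z <= Cmod s * / x) by (rewrite Ez; apply Rmult_le_compat_l; lra).
set (M := Cmod s * (Cmod X * Cmod X')).
assert (HM : Cmod s * (30 / 100 * (Cmod z * Cmod z')) <= M) by (apply Rmult_le_compat_l; lra).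
assert (HM0 : 0 < Cmod s * (30 / 100 * (Cmod z * Cmod z'))) by (apply Rmult_lt_0_compat; lra).
apply Rmult_le_reg_r with M; [lra|].
unfold Rdiv at 1. rewrite Rmult_assoc, Rinv_l, Rmult_1_r by lra.
apply Rle_trans with (1 := Nm).
(* Here 100 times the lower bound 30/100 of [Dn] leaves 30 |s|/x, which covers 26 |z| + 1/x. *)
apply Rle_trans with (100 / x * (Cmod s * (30 / 100 * (Cmod z * Cmod z')))).
2: { apply Rmult_le_compat_l; [|exact HM]. unfold Rdiv; nra. }
replace (100 / x * (Cmod s * (30 / 100 * (Cmod z * Cmod z'))))
  with (Cmod z * Cmod z' * (30 * (Cmod s * / x))) by (field; lra).
apply Rmult_le_compat_l; [lra|]. 
assert (/ x <= Cmod s * / x) by nra. lra.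
Qed.

(* Summing n^(-s) as if it were geometric with its exact local ratio gives a tail
   whose defect is O(1/n) relative to n^(-s), uniformly for n >= 10 |s|; the
   Euler-Maclaurin main term N^(1-s)/(s-1) needs n much larger than |s|. *)
Definition zeta_tail (s : C) (n : nat) : C := ((s * inv_one_minus_ratio s n - 1) / (s - 1) * npow s n)%C.

(** The normalisation (s w - 1)/(s - 1), with w = 1/(1 - q), is the one for which the defect of
    telescoping is a multiple of w(n+1) - w(n) - 1/s. Only w (1 - q) = 1 is used. *)
Lemma zeta_tail_step s n : 1 <= Cmod s -> s <> 1%C -> (1 <= n)%nat -> 10 * Cmod s <= INR n ->
  (zeta_tail s n - zeta_tail s (S n) = npow s n - s / (s - 1) * (npow s (S n) * (inv_one_minus_ratio s (S n) - inv_one_minus_ratio s n - / s)))%C.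
Proof.
intros Hs Hs1 Hn H. unfold zeta_tail. rewrite npow_S by assumption.
pose proof (Cmod_ell_small s n Hn H) as Z1. pose proof (one_minus_Cexp_bounds _ Z1) as X1.
pose proof (ell_bounds n Hn) as L1. pose proof (INR_ge1 n Hn) as Hn1.
assert (P1 : 0 < / (INR n + 1)) by (apply Rinv_0_lt_compat; lra).
assert (Pz : 0 < Cmod (s * RtoC (ell n))).
{ rewrite Cmod_mult, Cmod_R, Rabs_pos_eq by lra. apply Rmult_lt_0_compat; lra. }
set (q := Cexp (- (s * RtoC (ell n)))) in *.
assert (Hq : (1 - q)%C <> 0%C) by (apply Cmod_pos_neq0; lra).
assert (Hw : (inv_one_minus_ratio s n = / (1 - q))%C) by reflexivity. rewrite Hw.
assert (Hs0 : s <> 0%C) by (apply Cmod_pos_neq0; lra).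
assert ((s - 1)%C <> 0%C) by (intros E; apply Hs1; now apply Ceq_minus).
field. auto.
Qed.

Lemma zeta_tail_sum s N k : 1 <= Cmod s -> s <> 1%C -> (1 <= N)%nat -> 10 * Cmod s <= INR N ->
  (csum (npow s) (seq N k) = zeta_tail s N - zeta_tail s (N + k)
   + s / (s - 1) * csum (fun n => npow s (S n) * (inv_one_minus_ratio s (S n) - inv_one_minus_ratio s n - / s)) (seq N k))%C.
Proof.
intros Hs Hs1 HN H. induction k as [|k IH].
- rewrite Nat.add_0_r. unfold csum; simpl. ring.
- rewrite !csum_seq_S, IH. rewrite Nat.add_succ_r.
  assert (E := zeta_tail_step s (N + k) Hs Hs1 ltac:(lia)).
  rewrite plus_INR in E. pose proof (pos_INR k). specialize (E ltac:(lra)).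
  replace (npow s (N + k)) with (zeta_tail s (N + k) - zeta_tail s (S (N + k)) +
    s / (s - 1) * (npow s (S (N + k)) * (inv_one_minus_ratio s (S (N + k)) - inv_one_minus_ratio s (N + k) - / s)))%C
   by (rewrite E; ring).
  ring.
Qed.

(** Here s w = 1/[ell N] + O(|s|) and 1/[ell N] = N + O(1). Division by s - 1, which is comparable
    with s, leaves an error O(1) times N^(-Re s). *)
Lemma zeta_tail_main s N : 1 <= Cmod s -> 1 <= Cmod (s - 1) -> (1 <= N)%nat -> 10 * Cmod s <= INR N ->
  Cmod (zeta_tail s N - rcpow (INR N) (1 - s) / (s - 1)) <= 22 * Rpower (INR N) (- Re s).
Proof.
intros Hs Hs1 HN H. 
pose proof (Cmod_ell_small s N HN H) as Z1. pose proof (one_minus_Cexp_bounds _ Z1) as X1.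
pose proof (one_minus_Cexp _ Z1) as T1.
pose proof (ell_bounds N HN) as L1. pose proof (INR_ge1 N HN) as Hn1.
assert (P1 : 0 < / (INR N + 1)) by (apply Rinv_0_lt_compat; lra).
unfold zeta_tail, inv_one_minus_ratio. rewrite rcpow_1m by lra. fold (npow s N).
assert (Ez : Cmod (s * RtoC (ell N)) = Cmod s * ell N) by (rewrite Cmod_mult, Cmod_R, Rabs_pos_eq; lra).
set (z := (s * RtoC (ell N))%C) in *. set (X := (1 - Cexp (- z))%C) in *.
assert (Pz : 0 < Cmod z) by (rewrite Ez; apply Rmult_lt_0_compat; lra).
assert (HX : X <> 0%C) by (apply Cmod_pos_neq0; lra).
assert (Hz : z <> 0%C) by (apply Cmod_pos_neq0; lra).
assert (Hs0 : s <> 0%C) by (apply Cmod_pos_neq0; lra).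
assert (Hs1' : (s - 1)%C <> 0%C) by (apply Cmod_pos_neq0; lra).
assert (Hl : RtoC (ell N) <> 0%C) by (intros E; apply Hz; unfold z; rewrite E; ring).
replace ((s * / X - 1) / (s - 1) * npow s N - INR N * npow s N / (s - 1))%C
  with ((s * (z - X) / (X * z) + RtoC (/ ell N - 1 - INR N)) * npow s N / (s - 1))%C.
2: { rewrite !RtoC_minus, RtoC_inv by lra.
     replace (/ RtoC (ell N))%C with (s / z)%C by (unfold z; field; auto).
     field; auto. }
rewrite Cmod_div, Cmod_mult, Cmod_npow by auto.
assert (B1 : Cmod (s * (z - X) / (X * z)) <= 9 * Cmod s).
{ rewrite Cmod_div, !Cmod_mult by (now apply Cmult_neq_0). rewrite (Cmod_minus_sym z).
  apply Rmult_le_reg_r with (Cmod X * Cmod z); [nra|].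
  unfold Rdiv. rewrite Rmult_assoc, Rinv_l, Rmult_1_r by nra.
  rewrite (Rmult_comm 9), Rmult_assoc. apply Rmult_le_compat_l; [lra|].
  apply Rle_trans with (1 := T1). nra. }
assert (B2 : Cmod (RtoC (/ ell N - 1 - INR N)) <= 1).
{ rewrite Cmod_R. apply Rabs_le.
  assert (/ ell N <= INR N + 1).
  { rewrite <- (Rinv_inv (INR N + 1)). apply Rinv_le_contravar; lra. }
  assert (INR N <= / ell N).
  { rewrite <- (Rinv_inv (INR N)). apply Rinv_le_contravar; lra. }
  lra. }
assert (B3 : Cmod s <= 2 * Cmod (s - 1)).
{ pose proof (Cmod_triangle (s - 1) 1). rewrite Cmod_1 in H0.
  replace (s - 1 + 1)%C with s in H0 by ring. lra. }
pose proof (Rpower_pos (INR N) (- Re s)).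
apply Rmult_le_reg_r with (Cmod (s - 1)); [lra|].
unfold Rdiv. rewrite Rmult_assoc, Rinv_l, Rmult_1_r by lra.
rewrite (Rmult_comm (22 * _)), <- Rmult_assoc. apply Rmult_le_compat_r; [lra|].
eapply Rle_trans; [apply Cmod_triangle|]. lra.
Qed.

Definition zeta_corrected (s : C) (N : nat) : C :=
  (csum (npow s) (seq 1 N) - rcpow (INR N) (1 - s) / (1 - s))%C.

(** The 46 is twice the 22 of [zeta_tail_main] plus two boundary terms; 200 (1 + 1/Re s) is the
    bound 2 for |s/(s-1)| times the sum of 100 n^(-1-Re s) from N on. *)
Lemma zeta_corrected_cauchy s N k : 0 < Re s -> 1 <= Cmod s -> 1 <= Cmod (s - 1) ->
  (1 <= N)%nat -> 10 * Cmod s <= INR N ->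
  Cmod (zeta_corrected s (N + k) - zeta_corrected s N) <= (46 + 200 * (1 + / Re s)) * Rpower (INR N) (- Re s).
Proof.
intros Hr Hs Hs1 HN H.
assert (Hs1' : (s - 1)%C <> 0%C) by (apply Cmod_pos_neq0; lra).
assert (Hs1'' : (1 - s)%C <> 0%C) by (apply Cmod_pos_neq0; rewrite Cmod_minus_sym; lra).
assert (Hn1 : s <> 1%C) by (intros E; apply Hs1'; rewrite E; ring).
pose proof (zeta_tail_sum s N k Hs Hn1 HN H) as E.
pose proof (zeta_tail_main s N Hs Hs1 HN H) as M1.
assert (HNk : INR N <= INR (N + k)) by (apply le_INR; lia).
pose proof (zeta_tail_main s (N + k) Hs Hs1 ltac:(lia) ltac:(lra)) as M2.
pose proof (INR_ge1 N HN) as HN1.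
assert (Rm : Rpower (INR (N + k)) (- Re s) <= Rpower (INR N) (- Re s))
  by (apply Rpower_le_neg; lra).
set (p := Rpower (INR N) (- Re s)) in *.
assert (Hp : 0 < p) by apply Rpower_pos.
set (S2 := csum (fun n => npow s (S n) * (inv_one_minus_ratio s (S n) - inv_one_minus_ratio s n - / s))%C (seq N k)) in *.
assert (B : Cmod S2 <= 100 * (1 + / Re s) * p).
{ apply Rle_trans with (lsum (fun n => 100 * Rpower (INR n) (- (1 + Re s))) (seq N k)).
  - apply Cmod_csum_le. intros n Hn. apply in_seq in Hn.
    assert (Hn2 : INR N <= INR n) by (apply le_INR; lia).
    rewrite Cmod_mult, Cmod_npow.
    apply Rle_trans with (Rpower (INR n) (- Re s) * (100 / INR n)).
    + apply Rmult_le_compat; try apply Cmod_ge_0; [left; apply Rpower_pos| |].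
      * apply Rpower_le_neg; [rewrite S_INR; lra | lra].
      * apply inv_one_minus_ratio_step; [lra | lia | lra].
    + right. replace (- (1 + Re s)) with (- Re s + - (1)) by ring.
      rewrite Rpower_plus, (Rpower_Ropp _ 1), Rpower_1 by lra. field. lra.
  - rewrite lsum_scal. rewrite Rmult_assoc. apply Rmult_le_compat_l; [lra|].
    eapply Rle_trans; [apply sum_power_tail; [lra | lia]|].
    right. unfold p. replace (1 - (1 + Re s)) with (- Re s) by ring. field. lra. }
assert (B3 : Cmod (s / (s - 1)) <= 2).
{ rewrite Cmod_div by auto.
  pose proof (Cmod_triangle (s - 1) 1) as T. rewrite Cmod_1 in T.
  replace (s - 1 + 1)%C with s in T by ring.
  apply Rmult_le_reg_r with (Cmod (s - 1)); [lra|].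
  unfold Rdiv. rewrite Rmult_assoc, Rinv_l, Rmult_1_r by lra. lra. }
(* The tail identity sums from N to N+k-1, the difference of partial sums from N+1 to N+k. *)
assert (E2 : (csum (npow s) (seq 1 (N + k)) = csum (npow s) (seq 1 N) + csum (npow s) (seq N k)
              + npow s (N + k) - npow s N)%C).
{ replace (seq 1 (N + k)) with (seq 1 N ++ seq (1 + N) k) by (symmetry; apply seq_app).
  rewrite csum_app. 
  assert (csum (npow s) (seq (1 + N) k) = csum (npow s) (seq N k) + npow s (N + k) - npow s N)%C.
  { clear. induction k as [|k IH]; [rewrite Nat.add_0_r; unfold csum; simpl; ring|].
    rewrite !csum_seq_S, IH. replace (N + S k)%nat with (1 + N + k)%nat by lia. ring. }
  rewrite H0. ring. }
unfold zeta_corrected. rewrite E2, E.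
replace (csum (npow s) (seq 1 N) +
    (zeta_tail s N - zeta_tail s (N + k) + s / (s - 1) * S2) + npow s (N + k) - npow s N -
    rcpow (INR (N + k)) (1 - s) / (1 - s) -
    (csum (npow s) (seq 1 N) - rcpow (INR N) (1 - s) / (1 - s)))%C
 with ((zeta_tail s N - rcpow (INR N) (1 - s) / (s - 1)) -
       (zeta_tail s (N + k) - rcpow (INR (N + k)) (1 - s) / (s - 1))
       + s / (s - 1) * S2 + (npow s (N + k) - npow s N))%C.
2: { field. auto. }
eapply Rle_trans; [apply Cmod_triangle|].
eapply Rle_trans; [apply Rplus_le_compat_r, Cmod_triangle|].
eapply Rle_trans; [apply Rplus_le_compat_r, Rplus_le_compat_r, Cmod_minus_le|].
pose proof (Cmod_minus_le (npow s (N + k)) (npow s N)) as T. rewrite !Cmod_npow in T. fold p in T.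
assert (Cmod (s / (s - 1) * S2) <= 2 * (100 * (1 + / Re s) * p)).
{ rewrite Cmod_mult. apply Rmult_le_compat; try apply Cmod_ge_0; lra. }
lra.
Qed.

Lemma zeta_corrected_approx s N : zeta_corrected s (S N) = zeta_approx s N.
Proof.
unfold zeta_corrected, zeta_approx. f_equal. 
induction N as [|N IH].
- rewrite sum_O. unfold csum; simpl. unfold npow; simpl. ring.
- rewrite sum_Sn. rewrite csum_seq_S, IH. reflexivity.
Qed.

Lemma filterlim_Cmod_le (u : nat -> C) (l v : C) B N0 :
  filterlim u eventually (locally (T := C_UniformSpace) l) ->
  (forall n, (N0 <= n)%nat -> Cmod (u n - v) <= B) -> Cmod (l - v) <= B.
Proof.
intros Hu H.
assert (H1 : is_lim_seq (fun n => Cmod (u n - v)) (Cmod (l - v))).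
{ apply filterlim_comp with (2 := filterlim_norm (V := C_NormedModule) (l - v)%C).
  apply (filterlim_comp_2 (G := locally l) (H := locally (- v)%C) u (fun _ => (- v)%C) Cplus);
   [exact Hu | apply filterlim_const | exact (filterlim_plus (V := C_NormedModule) l (- v)%C)]. }
apply (is_lim_seq_le_loc _ (fun _ => B) _ B) with (2 := H1).
- exists N0; exact H.
- apply is_lim_seq_const.
Qed.

Lemma zeta_limit s : 0 < Re s -> s <> 1%C ->
  filterlim (fun N => zeta_approx s (S N)) eventually (locally (T := C_UniformSpace) (zeta s)).
Proof.
intros Hr Hs. destruct (ex_series_D s Hr) as [l Hl].
rewrite (zeta_series s l Hs Hl). exact (zeta_approx_cvg s l Hs Hl).
Qed.

Lemma zeta_approx_error s N : 0 < Re s -> 1 <= Cmod s -> 1 <= Cmod (s - 1) ->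
  (1 <= N)%nat -> 10 * Cmod s <= INR N ->
  Cmod (zeta s - zeta_corrected s N) <= (46 + 200 * (1 + / Re s)) * Rpower (INR N) (- Re s).
Proof.
intros Hr Hs Hs1 HN H.
assert (Hn1 : s <> 1%C).
{ intros E. rewrite E in Hs1. replace (1 - 1)%C with (RtoC 0) in Hs1 by ring. rewrite Cmod_0 in Hs1; lra. }
apply (filterlim_Cmod_le _ _ _ _ N (zeta_limit s Hr Hn1)).
intros n Hn. rewrite <- zeta_corrected_approx.
replace (S (S n)) with (N + (S (S n) - N))%nat by lia. now apply zeta_corrected_cauchy.
Qed.

Lemma zeta_dirichlet_error s N : 0 < Re s -> 1 <= Rabs (Im s) ->
  (1 <= N)%nat -> 10 * Cmod s <= INR N ->
  Cmod (zeta s - csum (npow s) (seq 1 N)) <=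
   (46 + 200 * (1 + / Re s)) * Rpower (INR N) (- Re s) + Rpower (INR N) (1 - Re s) / Rabs (Im s).
Proof.
intros Hr Hi HN H.
assert (Hs : 1 <= Cmod s) by (eapply Rle_trans; [exact Hi | apply (Rle_trans _ _ _ (Rmax_r _ _) (Rmax_Cmod s))]).
assert (Hs1 : Rabs (Im s) <= Cmod (s - 1)).
{ replace (Im s) with (snd (s - 1)%C) by (destruct s; simpl; ring).
  apply (Rle_trans _ _ _ (Rmax_r _ _) (Rmax_Cmod (s - 1)%C)). }
pose proof (zeta_approx_error s N Hr Hs ltac:(lra) HN H) as E.
eapply Rle_trans; [apply Cmod_triangle3 with (y := zeta_corrected s N)|].
apply Rplus_le_compat; [exact E|].
unfold zeta_corrected.
replace (csum (npow s) (seq 1 N) - rcpow (INR N) (1 - s) / (1 - s) - csum (npow s) (seq 1 N))%C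
  with (- (rcpow (INR N) (1 - s) / (1 - s)))%C by ring.
rewrite Cmod_opp, Cmod_div, Cmod_rcpow.
2: { apply Cmod_pos_neq0. rewrite Cmod_minus_sym. lra. }
rewrite (Cmod_minus_sym 1).
replace (Re (1 - s)) with (1 - Re s) by (destruct s; simpl; unfold Re; simpl; ring).
apply Rmult_le_compat_l; [left; apply Rpower_pos|]. apply Rinv_le_contravar; lra.
Qed.

(** * Growth of zeta on vertical lines *)

(** From sin y >= y - y^3/6, with y^2 <= 4. *)
Lemma sin_ge_third y : 0 <= y <= PI / 2 -> y / 3 <= sin y.
Proof.
intros H. pose proof PI_4.
assert (H1 : 0 <= y) by lra. assert (H2 : y <= 4) by lra.
destruct (pre_sin_bound y 0 H1 H2) as [L _].
assert (E : y - y ^ 3 / 6 <= sin y).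
{ eapply Rle_trans; [|exact L]. right; unfold sin_approx, sin_term; simpl; field. }
assert (y ^ 2 <= 4) by nra.
assert (y * y ^ 2 <= y * 4) by (apply Rmult_le_compat_l; lra).
replace (y ^ 3) with (y * y ^ 2) in E by ring. lra.
Qed.

Lemma sin_ge_away x d : 0 < d -> d / 2 <= x <= PI - d / 2 -> d / 6 <= sin x.
Proof.
intros Hd H. destruct (Rle_dec x (PI / 2)).
- pose proof (sin_ge_third x ltac:(lra)). lra.
- rewrite <- (sin_PI_x x). pose proof (sin_ge_third (PI - x) ltac:(lra)). lra.
Qed.

Definition cot (x : R) : R := cos x / sin x.

Lemma cot_decr x y : 0 < x -> x <= y -> y < PI -> cot y <= cot x.
Proof.
intros H1 H2 H3. unfold cot.
assert (Sx : 0 < sin x) by (apply sin_gt_0; lra).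
assert (Sy : 0 < sin y) by (apply sin_gt_0; lra).
assert (S : 0 <= sin (y - x)) by (apply sin_ge_0; lra).
rewrite sin_minus in S.
apply Rmult_le_reg_r with (sin x * sin y); [nra|].
replace (cos y / sin y * (sin x * sin y)) with (cos y * sin x) by (field; lra).
replace (cos x / sin x * (sin x * sin y)) with (sin y * cos x) by (field; lra).
lra.
Qed.

Lemma cot_bound x d : 0 < d -> d / 2 <= x <= PI - d / 2 -> Rabs (cot x) <= 6 / d.
Proof.
intros Hd H. pose proof (sin_ge_away x d Hd H) as S. unfold cot.
unfold Rdiv. rewrite Rabs_mult, (Rabs_pos_eq (/ sin x)).
2: { left; apply Rinv_0_lt_compat; lra. }
assert (Rabs (cos x) <= 1) by (apply Rabs_le; pose proof (COS_bound x); lra).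
apply Rle_trans with (1 * / sin x).
- apply Rmult_le_compat_r; [left; apply Rinv_0_lt_compat; lra | assumption].
- rewrite Rmult_1_l. replace (6 * / d) with (/ (d / 6)) by (field; lra).
  apply Rinv_le_contravar; lra.
Qed.

(** This is 1/(1 - exp(-ih)). Its real part is constant, so its variation is that of a monotone
    cotangent. *)
Definition cot_weight (h : R) : C := (1 / 2, - cot (h / 2) / 2).

Lemma cot_weight_spec h : sin (h / 2) <> 0 -> ((1 - Cexp (- (Ci * RtoC h))) * cot_weight h = 1)%C.
Proof.
intros H. unfold Cexp, cot_weight, cot, Ci, RtoC, Cmult, Cminus, Cplus, Copp, Re, Im; simpl.
replace (- (0 * h - 1 * 0)) with 0 by ring.
replace (- (0 * 0 + 1 * h)) with (- (2 * (h / 2))) by field.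
rewrite exp_0, cos_neg, sin_neg, cos_2a, sin_2a.
pose proof (sin2_cos2 (h / 2)) as T; unfold Rsqr in T.
set (S := sin (h / 2)) in *; set (Q := cos (h / 2)) in *.
f_equal; field_simplify; try (rewrite <- T; field); auto.
- replace (Q ^ 2) with (1 - S ^ 2) by lra. field; auto.
- replace (S ^ 2) with (1 - Q ^ 2) by lra. field; auto.
Qed.

Lemma Cmod_le_sum (x y : R) : Cmod (x, y) <= Rabs x + Rabs y.
Proof.
replace (x, y) with (RtoC x + Ci * RtoC y)%C
  by (unfold RtoC, Ci, Cplus, Cmult; simpl; f_equal; ring).
eapply Rle_trans; [apply Cmod_triangle|]. rewrite Cmod_mult, Cmod_Ci, !Cmod_R; lra.
Qed.

(* Kusmin-Landau: z(n) = (z(n) - z(n+1)) w(n) with w(n) = 1/2 - (i/2) cot(h(n)/2),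
   and the variation of the cotangents telescopes because h is monotone. *)
Lemma kusmin_landau (z : nat -> C) (h : nat -> R) A k d : 0 < d <= PI ->
  (forall n, (A <= n < A + k)%nat -> Cmod (z n) = 1 /\
     z (S n) = (z n * Cexp (- (Ci * RtoC (h n))))%C /\ d <= h n <= 2 * PI - d) ->
  (forall n, (A <= n)%nat -> (S n < A + k)%nat -> h (S n) <= h n) ->
  Cmod (csum z (seq A k)) <= 18 / d.
Proof.
intros Hd H Hm.
assert (P4 : 0 < 6 / d) by (apply Rdiv_lt_0_compat; lra).
assert (Hmod : forall n, (A <= n < A + k)%nat -> Cmod (cot_weight (h n)) <= 6 / d).
{ intros n Hn. destruct (H n Hn) as [_ [_ Hh]]. unfold cot_weight.
  eapply Rle_trans; [apply Cmod_le_sum|].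
  pose proof (cot_bound (h n / 2) d ltac:(lra) ltac:(lra)) as B.
  replace (- cot (h n / 2) / 2) with (- (1 / 2 * cot (h n / 2))) by field.
  rewrite Rabs_Ropp, Rabs_mult, Rabs_pos_eq by lra.
  assert (1 <= 6 / d).
  { apply Rmult_le_reg_r with d; [lra|]. unfold Rdiv; rewrite Rmult_assoc, Rinv_l by lra.
    pose proof PI_4; lra. }
  lra. }
assert (Hz : forall n, (A <= n < A + k)%nat -> (z n - z (S n))%C = (z n * (1 - Cexp (- (Ci * RtoC (h n)))))%C).
{ intros n Hn; destruct (H n Hn) as [_ [E _]]; rewrite E; ring. }
assert (Hw : forall n, (A <= n < A + k)%nat -> (z n * cot_weight (h n) - z (S n) * cot_weight (h n) = z n)%C).
{ intros n Hn. destruct (H n Hn) as [_ [_ Hh]].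
  replace (z n * cot_weight (h n) - z (S n) * cot_weight (h n))%C with ((z n - z (S n)) * cot_weight (h n))%C by ring.
  rewrite Hz, <- Cmult_assoc, cot_weight_spec by (auto; pose proof (sin_ge_away (h n / 2) d ltac:(lra) ltac:(lra)); lra).
  ring. }
destruct k as [|k].
{ unfold csum; simpl. rewrite Cmod_0. unfold Rdiv in *; lra. }
(* The added boundary term completes the summation by parts: one more step adds z times a difference
   of weights, whose modulus is half the increment of the cotangent. *)
assert (I : forall i, (i <= k)%nat ->
  Cmod (csum z (seq A (S i)) + z (A + S i)%nat * cot_weight (h (A + i)%nat))
   <= Cmod (cot_weight (h A)) + (cot (h (A + i)%nat / 2) - cot (h A / 2)) / 2).
{ induction i as [|i IH]; intros Hi.
  - rewrite Nat.add_0_r. simpl seq. rewrite csum_cons. unfold csum; simpl.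
    replace (A + 1)%nat with (S A) by lia.
    destruct (H A ltac:(lia)) as [E1 _]. rewrite <- (Hw A) at 1 by lia.
    replace (z A * cot_weight (h A) - z (S A) * cot_weight (h A) + 0 + z (S A) * cot_weight (h A))%C
      with (z A * cot_weight (h A))%C by ring.
    rewrite Cmod_mult, E1. lra.
  - specialize (IH ltac:(lia)). rewrite csum_seq_S.
    replace (A + S (S i))%nat with (S (A + S i)) by lia.
    replace (csum z (seq A (S i)) + z (A + S i)%nat + z (S (A + S i)) * cot_weight (h (A + S i)%nat))%C
     with ((csum z (seq A (S i)) + z (A + S i)%nat * cot_weight (h (A + i)%nat)) +
           z (A + S i)%nat * (cot_weight (h (A + S i)%nat) - cot_weight (h (A + i)%nat)))%C
     by (rewrite <- (Hw (A + S i)%nat) at 3 by lia; ring).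
    eapply Rle_trans; [apply Cmod_triangle|].
    rewrite (Cmod_mult (z (A + S i)%nat)), (proj1 (H (A + S i)%nat ltac:(lia))).
    assert (HM := Hm (A + i)%nat ltac:(lia) ltac:(lia)).
    replace (S (A + i)) with (A + S i)%nat in HM by lia.
    destruct (H (A + i)%nat ltac:(lia)) as [_ [_ H1]].
    destruct (H (A + S i)%nat ltac:(lia)) as [_ [_ H2]].
    pose proof (cot_decr (h (A + S i)%nat / 2) (h (A + i)%nat / 2) ltac:(lra) ltac:(lra) ltac:(lra)).
    assert (Cmod (cot_weight (h (A + S i)%nat) - cot_weight (h (A + i)%nat))
      <= (cot (h (A + S i)%nat / 2) - cot (h (A + i)%nat / 2)) / 2).
    { unfold cot_weight, Cminus, Cplus, Copp; simpl. eapply Rle_trans; [apply Cmod_le_sum|].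
      replace (1 / 2 + - (1 / 2)) with 0 by ring. rewrite Rabs_R0.
      rewrite Rabs_left1; lra. }
    lra. }
specialize (I k ltac:(lia)).
pose proof (Cmod_minus_ge (csum z (seq A (S k))) (- (z (A + S k)%nat * cot_weight (h (A + k)%nat)))) as T.
rewrite Cmod_opp, Cmod_mult in T.
replace (csum z (seq A (S k)) - - (z (A + S k)%nat * cot_weight (h (A + k)%nat)))%C with
  (csum z (seq A (S k)) + z (A + S k)%nat * cot_weight (h (A + k)%nat))%C in T by ring.
assert (E : Cmod (z (A + S k)%nat) = 1).
{ destruct (H (A + k)%nat ltac:(lia)) as [E1 [E2 _]].
  replace (A + S k)%nat with (S (A + k)) by lia. rewrite E2, Cmod_mult, E1, Cmod_Cexp.
  unfold Ci, RtoC, Cmult, Copp, Re; simpl.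
  replace (- (0 * h (A + k)%nat - 1 * 0)) with 0 by ring. rewrite exp_0; ring. }
rewrite E in T.
pose proof (Hmod A ltac:(lia)) as W1. pose proof (Hmod (A + k)%nat ltac:(lia)) as W2.
destruct (H A ltac:(lia)) as [_ [_ H1]].
destruct (H (A + k)%nat ltac:(lia)) as [_ [_ H2]].
pose proof (cot_bound (h A / 2) d ltac:(lra) ltac:(lra)) as C1. apply Rabs_le_between in C1.
pose proof (cot_bound (h (A + k)%nat / 2) d ltac:(lra) ltac:(lra)) as C2. apply Rabs_le_between in C2.
(* Each end weight costs 6/d, and so does half the difference of two cotangents bounded by 6/d. *)
replace (18 / d) with (3 * (6 / d)) by (field; lra). lra.
Qed.

(** Replacing the weights by their last value costs the total variation of [u], which for decreasing
    [u] telescopes; together with the last value it gives [u A]. *)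
Lemma abel_inequality (u : nat -> R) (z : nat -> C) A k B :
  (forall n, (A <= n < A + k)%nat -> 0 <= u n) ->
  (forall n, (A <= n)%nat -> (S n < A + k)%nat -> u (S n) <= u n) ->
  (forall i, (i <= k)%nat -> Cmod (csum z (seq A i)) <= B) ->
  (1 <= k)%nat ->
  Cmod (csum (fun n => RtoC (u n) * z n)%C (seq A k)) <= u A * B.
Proof.
intros Hp Hm HB Hk. destruct k as [|k]; [lia|].
assert (I : forall i, (i <= k)%nat ->
  Cmod (csum (fun n => RtoC (u n) * z n)%C (seq A (S i)) - RtoC (u (A + i)%nat) * csum z (seq A (S i)))
   <= (u A - u (A + i)%nat) * B).
{ induction i as [|i IH]; intros Hi.
  - rewrite Nat.add_0_r. unfold csum; simpl.
    replace (_ - _)%C with (RtoC 0) by ring. rewrite Cmod_0. lra.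
  - specialize (IH ltac:(lia)). rewrite csum_seq_S, (csum_seq_S z).
    set (S1 := csum (fun n => RtoC (u n) * z n)%C (seq A (S i))) in *.
    set (S2 := csum z (seq A (S i))) in *.
    replace (S1 + RtoC (u (A + S i)%nat) * z (A + S i)%nat - RtoC (u (A + S i)%nat) * (S2 + z (A + S i)%nat))%C
     with (S1 - RtoC (u (A + i)%nat) * S2 + RtoC (u (A + i)%nat - u (A + S i)%nat) * S2)%C
     by (rewrite RtoC_minus; ring).
    eapply Rle_trans; [apply Cmod_triangle|].
    assert (HM := Hm (A + i)%nat ltac:(lia) ltac:(lia)).
    replace (S (A + i)) with (A + S i)%nat in HM by lia.
    rewrite (Cmod_mult (RtoC _)), Cmod_R, (Rabs_pos_eq (_ - _)) by lra.
    assert ((u (A + i)%nat - u (A + S i)%nat) * Cmod S2 <= (u (A + i)%nat - u (A + S i)%nat) * B)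
      by (apply Rmult_le_compat_l; [lra | apply HB; lia]).
    lra. }
specialize (I k ltac:(lia)).
set (S1 := csum (fun n => RtoC (u n) * z n)%C (seq A (S k))) in *.
set (S2 := csum z (seq A (S k))) in *.
pose proof (Hp (A + k)%nat ltac:(lia)).
assert (Cmod (RtoC (u (A + k)%nat) * S2) <= u (A + k)%nat * B).
{ rewrite Cmod_mult, Cmod_R, Rabs_pos_eq by lra. apply Rmult_le_compat_l; [lra | apply HB; lia]. }
pose proof (Cmod_triangle (S1 - RtoC (u (A + k)%nat) * S2) (RtoC (u (A + k)%nat) * S2)) as T.
replace (S1 - RtoC (u (A + k)%nat) * S2 + RtoC (u (A + k)%nat) * S2)%C with S1 in T by ring.
lra.
Qed.

(** Used with g n = t [ell n]: the frequencies decrease with n, so each frequency band is an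
    interval of indices. *)
Lemma split_threshold (g : nat -> R) tau A k :
  (forall n, (A <= n)%nat -> (S n < A + k)%nat -> g (S n) <= g n) ->
  exists i, (i <= k)%nat /\ (forall n, (A <= n < A + i)%nat -> tau < g n) /\
    (forall n, (A + i <= n < A + k)%nat -> g n <= tau).
Proof.
induction k as [|k IH]; intros Hm.
- exists 0%nat. split; [|split]; intros; lia.
- destruct IH as [i [Hi [H1 H2]]]; [intros; apply Hm; lia|].
  destruct (Nat.eq_dec i k) as [->|Hne].
  + destruct (Rle_dec (g (A + k)%nat) tau) as [Hr|Hr].
    * exists k; split; [lia | split; [exact H1|]]. intros n Hn. replace n with (A + k)%nat by lia; auto.
    * exists (S k); split; [lia | split; [|intros; lia]].
      intros n Hn. destruct (Nat.eq_dec n (A + k)) as [->|]; [lra | apply H1; lia].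
  + exists i; split; [lia | split; [exact H1|]].
    intros n Hn. destruct (Nat.eq_dec n (A + k)) as [->|]; [|apply H2; lia].
    destruct k as [|k]; [lia|].
    apply Rle_trans with (g (A + k)%nat).
    * replace (A + S k)%nat with (S (A + k)) by lia. apply Hm; lia.
    * apply H2; lia.
Qed.

(** * Exponential sums over n^(-it), one frequency band at a time *)

Definition npow_i (t : R) (n : nat) : C := npow (Ci * RtoC t) n.

Lemma Cmod_npow_i t n : Cmod (npow_i t n) = 1.
Proof.
unfold npow_i; rewrite Cmod_npow. unfold Ci, RtoC, Cmult, Re; simpl.
replace (- (0 * t - 1 * 0)) with 0 by ring. unfold Rpower; rewrite Rmult_0_l; apply exp_0.
Qed.

Lemma Cexp_period x j : Cexp (- (Ci * RtoC (x + 2 * PI * INR j))) = Cexp (- (Ci * RtoC x)).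
Proof.
unfold Cexp, Ci, RtoC, Cmult, Copp, Re, Im; simpl.
replace (- (0 * (x + 2 * PI * INR j) - 1 * 0)) with 0 by ring.
replace (- (0 * x - 1 * 0)) with 0 by ring.
replace (- (0 * 0 + 1 * (x + 2 * PI * INR j))) with (- (x + 2 * INR j * PI)) by ring.
replace (- (0 * 0 + 1 * x)) with (- x) by ring.
rewrite !cos_neg, !sin_neg, cos_period, sin_period. reflexivity.
Qed.

Lemma npow_i_step t n x j : (1 <= n)%nat -> t * ell n = x + 2 * PI * INR j ->
  npow_i t (S n) = (npow_i t n * Cexp (- (Ci * RtoC x)))%C.
Proof.
intros Hn E. unfold npow_i. rewrite npow_S by assumption. f_equal.
replace (Ci * RtoC t * RtoC (ell n))%C with (Ci * RtoC (t * ell n))%C by (rewrite RtoC_mult; ring).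
rewrite E. apply Cexp_period.
Qed.

Lemma ell_decr n : (1 <= n)%nat -> ell (S n) <= ell n.
Proof.
intros Hn. pose proof (ell_diff_bounds n Hn). apply INR_ge1 in Hn.
assert (0 < / (INR n + 1) ^ 2) by (apply Rinv_0_lt_compat; nra). lra.
Qed.

Lemma npow_i_sum_away t j d A k : 0 < t -> (1 <= A)%nat -> 0 < d <= PI ->
  (forall n, (A <= n < A + k)%nat ->
     2 * PI * INR j + d <= t * ell n <= 2 * PI * INR j + 2 * PI - d) ->
  Cmod (csum (npow_i t) (seq A k)) <= 18 / d.
Proof.
intros Ht HA Hd H.
apply (kusmin_landau (npow_i t) (fun n => t * ell n - 2 * PI * INR j)); [exact Hd | |].
- intros n Hn. split; [apply Cmod_npow_i|]. split; [|specialize (H n Hn); lra].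
  apply npow_i_step with j; [lia | ring].
- intros n H1 H2. pose proof (ell_decr n ltac:(lia)). nra.
Qed.

Lemma csum_seq_split (f : nat -> C) A i k : (i <= k)%nat ->
  (csum f (seq A k) = csum f (seq A i) + csum f (seq (A + i) (k - i)))%C.
Proof.
intros H. rewrite <- csum_app, <- seq_app. do 2 f_equal. lia.
Qed.

Lemma Cmod_csum_const (f : nat -> C) A k : (forall n, Cmod (f n) <= 1) ->
  Cmod (csum f (seq A k)) <= INR k.
Proof.
intros H. induction k as [|k IH]; [unfold csum; simpl; rewrite Cmod_0; lra|].
rewrite csum_seq_S, S_INR. eapply Rle_trans; [apply Cmod_triangle|].
specialize (H (A + k)%nat). lra.
Qed.

(* Kusmin-Landau outside the frequencies within d = j / sqrt t of 2 pi j; those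
   n are at most 1 + sqrt t / j in number. *)
Lemma npow_i_block t j A k : 1 <= t -> (1 <= j)%nat -> INR j <= sqrt t -> (1 <= A)%nat ->
  (forall n, (A <= n < A + k)%nat ->
     2 * PI * INR j - PI <= t * ell n <= 2 * PI * INR j + PI) ->
  Cmod (csum (npow_i t) (seq A k)) <= 38 * (sqrt t / INR j).
Proof.
intros Ht Hj Hjt HA H.
assert (Hj1 := INR_ge1 j Hj). pose proof PI_4 as Pi4. pose proof PI2_3_2 as Pi3. pose proof PI_RGT_0 as Pi0.
assert (Hst : 1 <= sqrt t) by (rewrite <- sqrt_1; apply sqrt_le_1_alt; lra).
assert (Hs2 : sqrt t * sqrt t = t) by (apply sqrt_sqrt; lra).
set (q := sqrt t) in *. set (d := INR j / q).
assert (Hd0 : 0 < d) by (apply Rdiv_lt_0_compat; lra).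
assert (Hd1 : d <= 1).
{ unfold d. apply Rmult_le_reg_r with q; [lra|]. unfold Rdiv; rewrite Rmult_assoc, Rinv_l by lra; lra. }
assert (Hdi : 18 / d = 18 * (q / INR j)) by (unfold d; field; lra).
assert (Hqj : 1 <= q / INR j).
{ apply Rmult_le_reg_r with (INR j); [lra|]. unfold Rdiv; rewrite Rmult_assoc, Rinv_l by lra; lra. }
assert (Hdec : forall n, (A <= n)%nat -> t * ell (S n) <= t * ell n).
{ intros n Hn. apply Rmult_le_compat_l; [lra|]. apply ell_decr; lia. }
destruct (split_threshold (fun n => t * ell n) (2 * PI * INR j + d) A k) as [i1 [Hi1 [H1 H1']]].
{ intros; apply Hdec; lia. }
destruct (split_threshold (fun n => t * ell n) (2 * PI * INR j - d) (A + i1) (k - i1)) as [i2 [Hi2 [H2 H2']]].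
{ intros; apply Hdec; lia. }
rewrite (csum_seq_split _ A i1) by lia. rewrite (csum_seq_split _ (A + i1) i2) by lia.
assert (B1 : Cmod (csum (npow_i t) (seq A i1)) <= 18 * (q / INR j)).
{ rewrite <- Hdi. apply npow_i_sum_away with j; [lra | lia | lra |].
  intros n Hn. specialize (H n ltac:(lia)). specialize (H1 n ltac:(lia)). simpl in H1. lra. }
assert (B3 : Cmod (csum (npow_i t) (seq (A + i1 + i2) (k - i1 - i2))) <= 18 * (q / INR j)).
{ rewrite <- Hdi. apply npow_i_sum_away with (j - 1)%nat; [lra | lia | lra |].
  intros n Hn. specialize (H n ltac:(lia)). specialize (H2' n ltac:(lia)). simpl in H2'.
  rewrite minus_INR by lia. simpl (INR 1). lra. }
assert (B2 : Cmod (csum (npow_i t) (seq (A + i1) i2)) <= 1 + q / INR j).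
{ eapply Rle_trans; [apply Cmod_csum_const; intros; rewrite Cmod_npow_i; lra|].
  destruct i2 as [|i2]; [simpl; lra|]. rewrite S_INR.
  enough (INR i2 <= q / INR j) by lra.
  (* In this band t/n is at least 3j, so consecutive frequencies differ by at least (3j)^2/t. A
     window of width 2d = 2j/sqrt t therefore contains at most (2/9) sqrt t/j steps. *)
  assert (G : forall i, (i <= i2)%nat ->
    INR i * (INR j * INR j * 9 / t) <= t * ell (A + i1) - t * ell (A + i1 + i)).
  { induction i as [|i IH]; intros Hi; [simpl; rewrite Nat.add_0_r; lra|].
    specialize (IH ltac:(lia)). rewrite S_INR.
    pose proof (H (A + i1 + S i)%nat ltac:(lia)) as [L _].
    pose proof (ell_bounds (A + i1 + S i) ltac:(lia)) as [_ U].
    pose proof (ell_diff_bounds (A + i1 + i) ltac:(lia)) as [D _].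
    replace (A + i1 + S i)%nat with (S (A + i1 + i)) in * by lia.
    rewrite S_INR in U. set (x := INR (A + i1 + i) + 1) in *.
    assert (Hx : 1 <= x) by (unfold x; pose proof (pos_INR (A + i1 + i)); lra).
    set (l := ell (S (A + i1 + i))) in *. set (l0 := ell (A + i1 + i)) in *.
    assert (Hl : PI * INR j <= t * l) by nra.
    assert (Hu : 3 * INR j <= t / x).
    { apply Rle_trans with (t * l); [nra|]. unfold Rdiv. apply Rmult_le_compat_l; lra. }
    assert (INR j * INR j * 9 / t <= t * / x ^ 2).
    { replace (t * / x ^ 2) with (t / x * (t / x) / t) by (field; lra).
      apply Rmult_le_compat_r; [left; apply Rinv_0_lt_compat; lra|]. nra. }
    nra. }
  specialize (G i2 ltac:(lia)).
  specialize (H1' (A + i1)%nat ltac:(lia)). specialize (H2 (A + i1 + i2)%nat ltac:(lia)).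
  simpl in H1', H2.
  assert (G2 : INR i2 * (INR j * INR j * 9 / t) <= 2 * d) by lra.
  replace (INR i2) with ((INR i2 * (INR j * INR j * 9 / t)) * (t / (9 * INR j * INR j))) by (field; lra).
  apply Rle_trans with (2 * d * (t / (9 * INR j * INR j))).
  - apply Rmult_le_compat_r; [|exact G2]. left; apply Rdiv_lt_0_compat; nra.
  - unfold d. rewrite <- Hs2. replace (2 * (INR j / q) * (q * q / (9 * INR j * INR j)))
      with (2 / 9 * (q / INR j)) by (field; lra). lra. }
eapply Rle_trans; [apply Cmod_triangle|].
eapply Rle_trans; [apply Rplus_le_compat_l, Cmod_triangle|]. lra.
Qed.

Lemma npow_split s n : npow s n = (RtoC (Rpower (INR n) (- Re s)) * npow_i (Im s) n)%C.
Proof.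
unfold npow, npow_i. destruct s as [x y]. 
replace (- (x, y))%C with (- RtoC x + - (Ci * RtoC y))%C
  by (unfold RtoC, Ci, Cplus, Cmult, Copp; simpl; f_equal; ring).
rewrite rcpow_add. unfold npow. f_equal.
unfold rcpow, Cexp, RtoC, Copp, Cmult, Re, Im; simpl.
replace (- x * 0 + - 0 * ln (INR n)) with 0 by ring.
rewrite cos_0, sin_0. replace (- x * ln (INR n) - - 0 * 0) with (- x * ln (INR n)) by ring.
unfold Rpower; f_equal; ring.
Qed.

Lemma npow_sum_abel s A k B : 0 <= Re s -> (1 <= A)%nat -> 0 <= B ->
  (forall i, (i <= k)%nat -> Cmod (csum (npow_i (Im s)) (seq A i)) <= B) ->
  Cmod (csum (npow s) (seq A k)) <= Rpower (INR A) (- Re s) * B.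
Proof.
intros Hs HA HB0 HB. destruct k as [|k].
{ unfold csum; simpl; rewrite Cmod_0. apply Rmult_le_pos; [left; apply Rpower_pos | assumption]. }
rewrite (csum_ext _ (fun n => RtoC (Rpower (INR n) (- Re s)) * npow_i (Im s) n)%C)
  by (intros; apply npow_split).
apply (abel_inequality (fun n => Rpower (INR n) (- Re s))).
- intros; left; apply Rpower_pos.
- intros n H1 H2. apply Rpower_le_neg; [|lra]. assert (1 <= INR n) by (apply INR_ge1; lia).
  rewrite S_INR; lra.
- exact HB.
- lia.
Qed.

(** The band starts at some n >= t/(32 j), so partial summation multiplies 38 sqrt t/j by at most
    (t/(32 j))^(-Re s); 1216 is 38 * 32. *)
Lemma npow_block s j A k : 1 <= Im s -> 0 < Re s <= 1 -> (1 <= j)%nat -> INR j <= sqrt (Im s) ->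
  (1 <= A)%nat ->
  (forall n, (A <= n < A + k)%nat ->
     2 * PI * INR j - PI <= Im s * ell n <= 2 * PI * INR j + PI) ->
  Cmod (csum (npow s) (seq A k))
   <= 1216 * Rpower (Im s) (1 / 2 - Re s) * Rpower (INR j) (- (1 - Re s)).
Proof.
intros Ht Hs Hj Hjt HA H. set (t := Im s) in *. set (sg := Re s) in *.
assert (Hj1 := INR_ge1 j Hj). pose proof PI_4 as Pi4. pose proof PI2_3_2 as Pi3. pose proof PI_RGT_0 as Pi0.
assert (Pt : 0 < Rpower t (1 / 2 - sg)) by apply Rpower_pos.
assert (Pj : 0 < Rpower (INR j) (- (1 - sg))) by apply Rpower_pos.
destruct k as [|k].
{ unfold csum; simpl; rewrite Cmod_0. nra. }
assert (Hst : 1 <= sqrt t) by (rewrite <- sqrt_1; apply sqrt_le_1_alt; lra).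
assert (Hqj : 0 < sqrt t / INR j) by (apply Rdiv_lt_0_compat; lra).
eapply Rle_trans; [apply npow_sum_abel with (B := 38 * (sqrt t / INR j)); [fold sg; lra | exact HA | lra |]|].
{ intros i Hi. apply npow_i_block; auto. intros n Hn; apply H; lia. }
fold sg. destruct (H A ltac:(lia)) as [_ U].
pose proof (ell_bounds A HA) as [L _]. assert (HA1 := INR_ge1 A HA).
assert (HA2 : t / (32 * INR j) <= INR A).
{ assert (H3 : t / (INR A + 1) <= 16 * INR j).
  { apply Rle_trans with (t * ell A); [unfold Rdiv; apply Rmult_le_compat_l; lra | nra]. }
  assert (t <= 16 * INR j * (INR A + 1)).
  { apply Rmult_le_reg_r with (/ (INR A + 1)); [apply Rinv_0_lt_compat; lra|].
    rewrite Rmult_assoc, Rinv_r by lra. unfold Rdiv in H3; lra. }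
  apply Rmult_le_reg_r with (32 * INR j); [lra|]. unfold Rdiv.
  rewrite Rmult_assoc, Rinv_l by lra. nra. }
apply Rle_trans with (Rpower (t / (32 * INR j)) (- sg) * (38 * (sqrt t / INR j))).
- apply Rmult_le_compat_r; [lra|]. apply Rpower_le_neg; [|lra]. split; [|exact HA2].
  apply Rdiv_lt_0_compat; lra.
- rewrite <- Rpower_sqrt by lra.
  replace (/ INR j) with (Rpower (INR j) (- (1))) by (rewrite Rpower_Ropp, Rpower_1; lra).
  unfold Rdiv at 1 2. rewrite <- Rpower_mult_distr.
  2: lra. 2: apply Rinv_0_lt_compat; lra.
  replace (/ INR j) with (Rpower (INR j) (- (1))) by (rewrite Rpower_Ropp, Rpower_1; lra).
  assert (E : Rpower (/ (32 * INR j)) (- sg) = Rpower 32 sg * Rpower (INR j) sg).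
  { rewrite Rpower_mult_distr by lra. unfold Rpower. f_equal. rewrite ln_Rinv by lra. ring. }
  rewrite E.
  assert (E2 : Rpower 32 sg <= 32).
  { rewrite <- (Rpower_1 32) at 2 by lra. apply Rpower_le_r; lra. }
  replace (1 / 2 - sg) with (- sg + / 2) by field. rewrite Rpower_plus.
  replace (- (1 - sg)) with (sg + - (1)) by ring. rewrite (Rpower_plus sg).
  assert (0 < Rpower t (- sg) * Rpower t (/ 2) * (Rpower (INR j) sg * Rpower (INR j) (- (1))))
   by (repeat apply Rmult_lt_0_compat; apply Rpower_pos).
  nra.
Qed.

(** Induction on the number of bands. In the lowest one, frequencies at most pi, the bound n <= H t
    keeps them above 1/(2H), and Kusmin-Landau at that distance from 0 gives 36 H. *)
Lemma npow_blocks s H A k J : 1 <= Im s -> 0 < Re s <= 1 -> 1 <= H -> INR J <= sqrt (Im s) ->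
  (1 <= A)%nat ->
  (forall n, (A <= n < A + k)%nat -> Im s * ell n <= 2 * PI * INR J + PI /\ INR n <= H * Im s) ->
  Cmod (csum (npow s) (seq A k)) <= 36 * H + 1216 * Rpower (Im s) (1 / 2 - Re s)
     * lsum (fun j => Rpower (INR j) (- (1 - Re s))) (seq 1 J).
Proof.
intros Ht Hs HH. revert A k.
pose proof PI_4 as Pi4. pose proof PI2_3_2 as Pi3. pose proof PI_RGT_0 as Pi0.
induction J as [|J IH]; intros A k HJ HA Hn.
- unfold lsum; simpl. rewrite Rmult_0_r, Rplus_0_r.
  eapply Rle_trans; [apply npow_sum_abel with (B := 36 * H); [lra | exact HA | lra |]|].
  + intros i Hi. replace (36 * H) with (18 / (/ (2 * H))) by (field; lra).
    assert (Hd : 0 < / (2 * H) <= 1).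
    { split; [apply Rinv_0_lt_compat; lra|]. rewrite <- Rinv_1. apply Rinv_le_contravar; lra. }
    apply npow_i_sum_away with 0%nat; [lra | exact HA | lra |].
    intros n Hn'. destruct (Hn n ltac:(lia)) as [U1 U2]. simpl (INR 0) in *.
    pose proof (ell_bounds n ltac:(lia)) as [L _]. assert (H1 := INR_ge1 n ltac:(lia)).
    split; [|lra]. 
    apply Rle_trans with (Im s * / (INR n + 1)); [|apply Rmult_le_compat_l; lra].
    rewrite Rmult_0_r, Rplus_0_l.
    apply Rmult_le_reg_r with (INR n + 1); [lra|]. rewrite (Rmult_assoc (Im s)), Rinv_l by lra.
    apply Rmult_le_reg_l with (2 * H); [lra|].
    rewrite <- Rmult_assoc, Rinv_r by lra. lra.
  + assert (Rpower (INR A) (- Re s) <= 1).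
    { rewrite <- (Rpower_base1 (- Re s)). apply Rpower_le_neg; [|lra].
      pose proof (INR_ge1 A HA); lra. }
    nra.
- destruct (split_threshold (fun n => Im s * ell n) (2 * PI * INR J + PI) A k) as [i [Hi [H1 H2]]].
  { intros n Hn1 Hn2. apply Rmult_le_compat_l; [lra|]. apply ell_decr; lia. }
  rewrite (csum_seq_split _ A i) by lia.
  rewrite lsum_seq_S. replace (1 + J)%nat with (S J) by lia.
  rewrite S_INR in HJ.
  assert (B2 : Cmod (csum (npow s) (seq (A + i) (k - i))) <= 36 * H + 1216 * Rpower (Im s) (1 / 2 - Re s)
     * lsum (fun j => Rpower (INR j) (- (1 - Re s))) (seq 1 J)).
  { apply IH; [lra | lia |]. intros n Hn'. split; [apply H2; lia | apply Hn; lia]. }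
  assert (B1 : Cmod (csum (npow s) (seq A i)) <=
     1216 * Rpower (Im s) (1 / 2 - Re s) * Rpower (INR (S J)) (- (1 - Re s))).
  { apply npow_block; auto; [lia | rewrite S_INR; lra |].
    intros n Hn'. specialize (H1 n Hn'). destruct (Hn n ltac:(lia)) as [U _].
    rewrite S_INR in *. simpl in H1. lra. }
  eapply Rle_trans; [apply Cmod_triangle|]. lra.
Qed.

Lemma sqrt_ge1 t : 1 <= t -> 1 <= sqrt t.
Proof. intros; rewrite <- sqrt_1; apply sqrt_le_1_alt; lra. Qed.

(** The cut at frequency about 2 pi sqrt t separates n <= sqrt t, estimated trivially, from bands j
    <= sqrt t. Both the initial sum and t^(1/2-sigma) times the sum of j^(sigma-1) have size
    t^((1-sigma)/2). *)
Lemma npow_sum_pos s H m : 1 <= Im s -> 0 < Re s <= 3 / 4 -> 1 <= H -> INR m <= H * Im s ->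
  Cmod (csum (npow s) (seq 1 m)) <= (36 * H + 1216 / Re s + 4) * Rpower (Im s) ((1 - Re s) / 2).
Proof.
intros Ht Hs HH Hm. set (t := Im s) in *. set (sg := Re s) in *.
pose proof PI_4 as Pi4. pose proof PI2_3_2 as Pi3. pose proof PI_RGT_0 as Pi0.
pose proof (sqrt_ge1 t Ht) as Hq. assert (Hq2 : sqrt t * sqrt t = t) by (apply sqrt_sqrt; lra).
destruct (nfloor_ex (sqrt t)) as [J [HJ1 HJ2]]; [lra|].
destruct (split_threshold (fun n => t * ell n) (2 * PI * INR J + PI) 1 m) as [i [Hi [H1 H2]]].
{ intros n Hn1 Hn2. apply Rmult_le_compat_l; [lra|]. apply ell_decr; lia. }
rewrite (csum_seq_split _ 1 i) by lia.
assert (Eq : sqrt t = Rpower t (/ 2)) by (rewrite Rpower_sqrt; lra).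
assert (P1 : 1 <= Rpower t ((1 - sg) / 2)) by (apply Rpower_ge1; lra).
assert (B1 : Cmod (csum (npow s) (seq 1 i)) <= 4 * Rpower t ((1 - sg) / 2)).
{ destruct i as [|i]; [unfold csum; simpl; rewrite Cmod_0; lra|].
  eapply Rle_trans.
  { apply Cmod_csum_le with (g := fun n => Rpower (INR n) (- sg)).
    intros n Hn; rewrite Cmod_npow; fold sg; lra. }
  eapply Rle_trans; [apply sum_power_lt1; lra|].
  assert (Hiq : INR (S i) <= sqrt t).
  { specialize (H1 (S i) ltac:(lia)). simpl in H1.
    pose proof (ell_bounds (S i) ltac:(lia)) as [_ U]. assert (H3 := INR_S_ge1 i).
    assert (sqrt t <= t * ell (S i)) by nra.
    assert (sqrt t <= t * / INR (S i)).
    { eapply Rle_trans; [eassumption|]. apply Rmult_le_compat_l; lra. }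
    apply Rmult_le_reg_l with (sqrt t); [lra|]. rewrite Hq2.
    apply Rmult_le_reg_r with (/ INR (S i)); [apply Rinv_0_lt_compat; lra|].
    rewrite Rmult_assoc, Rinv_r by lra. lra. }
  apply Rle_trans with (Rpower (sqrt t) (1 - sg) / (1 - sg)).
  - apply Rmult_le_compat_r; [left; apply Rinv_0_lt_compat; lra|].
    apply Rpower_le_l; [|lra]. pose proof (INR_S_ge1 i). lra.
  - rewrite Eq, Rpower_mult. replace (/ 2 * (1 - sg)) with ((1 - sg) / 2) by field.
    unfold Rdiv at 1. rewrite Rmult_comm. apply Rmult_le_compat_r; [lra|].
    replace 4 with (/ (1 / 4)) by field. apply Rinv_le_contravar; lra. }
assert (B2 : Cmod (csum (npow s) (seq (1 + i) (m - i))) <=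
   36 * H + 1216 * Rpower t (1 / 2 - sg) * lsum (fun j => Rpower (INR j) (- (1 - sg))) (seq 1 J)).
{ apply npow_blocks; auto; [fold sg; lra | lia |]. intros n Hn. split; [apply H2; lia|].
  apply Rle_trans with (INR m); [apply le_INR; lia | assumption]. }
assert (B3 : lsum (fun j => Rpower (INR j) (- (1 - sg))) (seq 1 J) <= Rpower t (sg / 2) / sg).
{ destruct J as [|J].
  { unfold lsum; simpl. apply Rcomplements.Rdiv_le_0_compat; [left; apply Rpower_pos | lra]. }
  eapply Rle_trans; [apply sum_power_lt1; lra|].
  replace (1 - (1 - sg)) with sg by ring. apply Rmult_le_compat_r; [left; apply Rinv_0_lt_compat; lra|].
  replace (sg / 2) with (/ 2 * sg) by field. rewrite <- Rpower_mult, <- Eq.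
  apply Rpower_le_l; [|lra]. pose proof (INR_S_ge1 J); lra. }
eapply Rle_trans; [apply Cmod_triangle|].
assert (B4 : 1216 * Rpower t (1 / 2 - sg) * lsum (fun j => Rpower (INR j) (- (1 - sg))) (seq 1 J)
   <= 1216 / sg * Rpower t ((1 - sg) / 2)).
{ pose proof (Rpower_pos t (1 / 2 - sg)).
  apply Rle_trans with (1216 * Rpower t (1 / 2 - sg) * (Rpower t (sg / 2) / sg)).
  { apply Rmult_le_compat_l; lra. }
  replace ((1 - sg) / 2) with (1 / 2 - sg + sg / 2) by field. rewrite Rpower_plus.
  right; field; lra. }
nra.
Qed.

Lemma Cexp_conj z : Cexp (Cconj z) = Cconj (Cexp z).
Proof.
destruct z as [x y]; unfold Cexp, Cconj, Re, Im; simpl.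
rewrite cos_neg, sin_neg; f_equal; ring.
Qed.

Lemma npow_conj s n : npow (Cconj s) n = Cconj (npow s n).
Proof.
unfold npow, rcpow. rewrite <- Cexp_conj. f_equal. destruct s as [x y].
unfold Cconj, RtoC, Cmult, Copp; simpl; f_equal; ring.
Qed.

Lemma Cconj_plus z w : Cconj (z + w) = (Cconj z + Cconj w)%C.
Proof. destruct z, w; unfold Cconj, Cplus; simpl; f_equal; ring. Qed.

Lemma csum_conj {T} (f : T -> C) l : csum (fun x => Cconj (f x)) l = Cconj (csum f l).
Proof.
induction l as [|x l IH].
- unfold csum, Cconj; simpl. unfold RtoC. f_equal; ring.
- rewrite !csum_cons, IH, Cconj_plus; reflexivity.
Qed.

Lemma npow_sum_bound s H m : 1 <= Rabs (Im s) -> 0 < Re s <= 3 / 4 -> 1 <= H ->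
  INR m <= H * Rabs (Im s) ->
  Cmod (csum (npow s) (seq 1 m)) <= (36 * H + 1216 / Re s + 4) * Rpower (Rabs (Im s)) ((1 - Re s) / 2).
Proof.
intros Ht Hs HH Hm. destruct (Rle_dec 0 (Im s)).
- rewrite Rabs_pos_eq in * by lra. now apply npow_sum_pos.
- rewrite Rabs_left in * by lra.
  pose proof (npow_sum_pos (Cconj s) H m) as B.
  rewrite (csum_ext _ (fun n => Cconj (npow s n))) in B by (intros; apply npow_conj).
  rewrite csum_conj, Cmod_conj in B.
  replace (Im (Cconj s)) with (- Im s) in B by (destruct s; reflexivity).
  replace (Re (Cconj s)) with (Re s) in B by (destruct s; reflexivity).
  apply B; auto.
Qed.

Lemma npow_sum_bound_right s H m : 1 <= Rabs (Im s) -> 3 / 4 <= Re s -> 1 <= H ->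
  INR m <= H * Rabs (Im s) ->
  Cmod (csum (npow s) (seq 1 m)) <= (36 * H + 1626) * Rpower (Rabs (Im s)) (1 / 8).
Proof.
intros Ht Hs HH Hm. set (t := Rabs (Im s)) in *.
assert (P : 1 <= Rpower t (1 / 8)) by (apply Rpower_ge1; lra).
destruct m as [|m]; [unfold csum; simpl; rewrite Cmod_0; nra|].
set (s' := (3 / 4, Im s) : C).
rewrite (csum_ext _ (fun n => RtoC (Rpower (INR n) (- (Re s - 3 / 4))) * npow s' n)%C).
2: { intros n _. rewrite (npow_split s), (npow_split s'). unfold s'; simpl.
     rewrite Cmult_assoc, <- RtoC_mult, <- Rpower_plus. do 3 f_equal. lra. }
eapply Rle_trans; [apply (abel_inequality (fun n => Rpower (INR n) (- (Re s - 3 / 4)))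
   (npow s') 1 (S m) ((36 * H + 1626) * Rpower t (1 / 8)))|].
- intros; left; apply Rpower_pos.
- intros n H1 H2. apply Rpower_le_neg; [|lra]. assert (1 <= INR n) by (apply INR_ge1; lia).
  rewrite S_INR; lra.
- intros i Hi. pose proof (npow_sum_bound s' H i) as B. unfold s' in B at 1 2 3 4 6 7 8; simpl in B.
  fold t in B. replace ((1 - 3 / 4) / 2) with (1 / 8) in B by field.
  eapply Rle_trans; [apply B; try lra|].
  { apply Rle_trans with (INR (S m)); [apply le_INR; lia | assumption]. }
  apply Rmult_le_compat_r; lra.
- lia.
- simpl (INR 1). rewrite Rpower_base1. lra.
Qed.

Lemma exists_nat_above x : 1 <= x -> exists n, (1 <= n)%nat /\ x <= INR n <= x + 1.
Proof.
intros Hx. destruct (nfloor_ex x) as [n [H1 H2]]; [lra|].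
exists (S n). rewrite S_INR. split; [lia | lra].
Qed.

(* The exponent (1 - sigma)/2 is the convexity exponent; no logarithm is lost. *)
Lemma zeta_growth dl R0 : 0 < dl -> exists K, 0 < K /\ forall s, dl <= Re s <= R0 -> 1 <= Rabs (Im s) ->
  Cmod (zeta s) <= K * Rpower (Rabs (Im s)) (Rmax ((1 - Re s) / 2) (1 / 8)).
Proof.
(* N is taken within 1 above 10 |s|, and |s| <= (|R0| + 1) t; thus N <= H t. *)
intros Hd. set (H := 10 * (Rabs R0 + 1) + 1).
assert (HH : 1 <= H) by (unfold H; pose proof (Rabs_pos R0); lra).
assert (Hdi : 0 < / dl) by now apply Rinv_0_lt_compat.
exists (46 + 200 * (1 + / dl) + H + (36 * H + 1216 / dl + 1626)). split.
{ unfold Rdiv; lra. }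
intros s Hs Ht. set (t := Rabs (Im s)) in *. set (sg := Re s) in *.
set (e := Rmax ((1 - sg) / 2) (1 / 8)).
assert (He1 : (1 - sg) / 2 <= e) by apply Rmax_l.
assert (He2 : 1 / 8 <= e) by apply Rmax_r.
assert (Hmod : t <= Cmod s <= (Rabs R0 + 1) * t).
{ split; [apply (Rle_trans _ _ _ (Rmax_r _ _) (Rmax_Cmod s))|].
  rewrite (surjective_pairing s). eapply Rle_trans; [apply Cmod_le_sum|].
  fold (Re s) (Im s) sg t. pose proof (Rle_abs R0). rewrite (Rabs_pos_eq sg) by lra. nra. }
destruct (exists_nat_above (10 * Cmod s)) as [N [HN1 HN2]]; [lra|].
assert (HNt : INR N <= H * t) by (unfold H; nra).
pose proof (zeta_dirichlet_error s N ltac:(fold sg; lra) Ht HN1 ltac:(lra)) as E.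
fold sg t in E.
assert (Pe : 1 <= Rpower t e) by (apply Rpower_ge1; lra).
assert (B1 : Cmod (csum (npow s) (seq 1 N)) <= (36 * H + 1216 / dl + 1626) * Rpower t e).
{ destruct (Rle_dec sg (3 / 4)).
  - eapply Rle_trans; [apply npow_sum_bound with (H := H); auto; fold sg; lra|]. fold sg t.
    apply Rmult_le_compat; [| left; apply Rpower_pos | | apply Rpower_le_r; lra].
    + assert (0 < / sg) by (apply Rinv_0_lt_compat; lra). unfold Rdiv; lra.
    + assert (/ sg <= / dl) by (apply Rinv_le_contravar; lra). unfold Rdiv; lra.
  - eapply Rle_trans; [apply npow_sum_bound_right with (H := H); auto; fold sg; lra|]. fold t.
    apply Rmult_le_compat; [lra | left; apply Rpower_pos | unfold Rdiv; lra | apply Rpower_le_r; lra]. }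
assert (HN3 : t <= INR N) by lra.
assert (B2 : Rpower (INR N) (- sg) <= 1).
{ rewrite <- (Rpower_base1 (- sg)). apply Rpower_le_neg; lra. }
assert (B3 : Rpower (INR N) (1 - sg) / t <= H).
{ apply Rmult_le_reg_r with t; [lra|]. unfold Rdiv. rewrite Rmult_assoc, Rinv_l, Rmult_1_r by lra.
  apply Rle_trans with (2 := HNt). rewrite <- (Rpower_1 (INR N)) at 2 by lra.
  apply Rpower_le_r; lra. }
assert (B4 : (46 + 200 * (1 + / sg)) * Rpower (INR N) (- sg) <= 46 + 200 * (1 + / dl)).
{ assert (/ sg <= / dl) by (apply Rinv_le_contravar; lra).
  assert (0 < / sg) by (apply Rinv_0_lt_compat; lra).
  pose proof (Rpower_pos (INR N) (- sg)). nra. }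
pose proof (Cmod_triangle (zeta s - csum (npow s) (seq 1 N)) (csum (npow s) (seq 1 N))) as T.
replace (zeta s - csum (npow s) (seq 1 N) + csum (npow s) (seq 1 N))%C with (zeta s) in T by ring.
unfold Rdiv in *. nra.
Qed.

(** * Complex integrals and Cauchy's theorem on rectangles *)

Definition CInt (f : R -> C) (a b : R) : C := RInt (V := C_R_CompleteNormedModule) f a b.
Notation ex_CInt := (ex_RInt (V := C_R_NormedModule)).
Notation Ccont := (continuous (T := R_UniformSpace) (U := C_R_CompleteNormedModule)).

Lemma Ccont_lipschitz (f : R -> C) x K del : 0 < del ->
  (forall y, Rabs (y - x) < del -> Cmod (f y - f x) <= K * Rabs (y - x)) -> Ccont f x.
Proof.
intros Hd H. apply filterlim_locally. intros eps.
assert (HK : 0 < Rabs K + 1) by (pose proof (Rabs_pos K); lra).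
assert (Hr : 0 < Rmin del (eps / (Rabs K + 1))).
{ apply Rmin_glb_lt; [exact Hd | apply Rdiv_lt_0_compat; [apply cond_pos | exact HK]]. }
exists (mkposreal _ Hr). intros y Hy.
change (Rabs (y - x) < Rmin del (eps / (Rabs K + 1))) in Hy.
apply (norm_compat1 (V := C_R_NormedModule)). rewrite <- Cmod_norm.
change (Cmod (f y - f x) < eps).
assert (H1 : Rabs (y - x) < del) by (eapply Rlt_le_trans; [exact Hy | apply Rmin_l]).
assert (H2 : Rabs (y - x) < eps / (Rabs K + 1)) by (eapply Rlt_le_trans; [exact Hy | apply Rmin_r]).
eapply Rle_lt_trans; [now apply H|].
pose proof (Rle_abs K). pose proof (Rabs_pos (y - x)).
apply Rle_lt_trans with ((Rabs K + 1) * Rabs (y - x)); [nra|].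
replace (pos eps) with ((Rabs K + 1) * (eps / (Rabs K + 1))) by (field; lra).
apply Rmult_lt_compat_l; lra.
Qed.

Lemma quad_derive_R (f : R -> C) x l K del : 0 < del ->
  (forall y, Rabs (y - x) < del -> Cmod (f y - f x - RtoC (y - x) * l) <= K * Rabs (y - x) ^ 2) ->
  is_derive (K := R_AbsRing) (V := C_R_NormedModule) f x l.
Proof.
intros Hd H; split; [apply is_linear_scal_l|].
intros x' Hx.
apply (is_filter_lim_locally_unique (V := R_NormedModule)) in Hx. subst x'.
intros eps.
assert (HK : 0 < Rabs K + 1) by (pose proof (Rabs_pos K); lra).
assert (Hr : 0 < Rmin del (eps / (Rabs K + 1))).
{ apply Rmin_glb_lt; [exact Hd | apply Rdiv_lt_0_compat; [apply cond_pos | exact HK]]. }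
exists (mkposreal _ Hr); intros y Hy.
change (Rabs (y - x) < Rmin del (eps / (Rabs K + 1))) in Hy.
rewrite <- Cmod_norm.
change (Cmod (f y - f x - scal (V := C_R_NormedModule) (y - x)%R l)%C <= eps * Rabs (y - x)).
replace (scal (V := C_R_NormedModule) (y - x) l) with (RtoC (y - x) * l)%C.
2: { destruct l as [u v]. unfold scal; simpl. unfold prod_scal, scal; simpl. unfold mult; simpl.
     unfold Cmult, RtoC; simpl. f_equal; ring. }
assert (H1 : Rabs (y - x) < del) by (eapply Rlt_le_trans; [exact Hy | apply Rmin_l]).
assert (H2 : Rabs (y - x) < eps / (Rabs K + 1)) by (eapply Rlt_le_trans; [exact Hy | apply Rmin_r]).
eapply Rle_trans; [now apply H|].
pose proof (Rle_abs K). pose proof (Rabs_pos (y - x)).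
apply Rle_trans with ((Rabs K + 1) * Rabs (y - x) * Rabs (y - x)); [simpl; nra|].
apply Rmult_le_compat_r; [assumption|].
replace (pos eps) with ((Rabs K + 1) * (eps / (Rabs K + 1))) by (field; lra).
apply Rmult_le_compat_l; lra.
Qed.

Lemma Ccont_ex (f : R -> C) a b : a <= b -> (forall x, a <= x <= b -> Ccont f x) -> ex_CInt f a b.
Proof.
intros H Hc. apply (ex_RInt_continuous (V := C_R_CompleteNormedModule)).
intros x Hx. rewrite Rmin_left, Rmax_right in Hx by lra. now apply Hc.
Qed.

Lemma Ccont_plus (f g : R -> C) x : Ccont f x -> Ccont g x -> Ccont (fun t => f t + g t)%C x.
Proof. intros; now apply (continuous_plus (V := C_R_NormedModule)). Qed.

Lemma Ccont_fst (f : R -> C) x : Ccont f x -> continuous (U := R_UniformSpace) (fun t => fst (f t)) x.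
Proof.
intros H. apply (continuous_comp (V := C_R_CompleteNormedModule) f fst x H).
destruct (f x) as [u v]. apply (continuous_fst (U := R_UniformSpace) (V := R_UniformSpace)).
Qed.

Lemma Ccont_snd (f : R -> C) x : Ccont f x -> continuous (U := R_UniformSpace) (fun t => snd (f t)) x.
Proof.
intros H. apply (continuous_comp (V := C_R_CompleteNormedModule) f snd x H).
destruct (f x) as [u v]. apply (continuous_snd (U := R_UniformSpace) (V := R_UniformSpace)).
Qed.

Lemma Ccont_pair (f : R -> C) x : continuous (U := R_UniformSpace) (fun t => fst (f t)) x ->
  continuous (U := R_UniformSpace) (fun t => snd (f t)) x -> Ccont f x.
Proof.
intros H1 H2. 
apply (continuous_ext (fun t => (fst (f t), snd (f t)) : C_R_CompleteNormedModule)).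
{ intros t; symmetry; apply surjective_pairing. }
apply (continuous_comp_2 (V := R_UniformSpace) (W := R_UniformSpace) (X := C_R_CompleteNormedModule)
   _ _ (fun u v => (u, v)) x H1 H2).
apply continuous_ext with (fun z : R * R => z); [intros [u v]; reflexivity | apply continuous_id].
Qed.

Lemma Ccont_mult (f g : R -> C) x : Ccont f x -> Ccont g x -> Ccont (fun t => f t * g t)%C x.
Proof.
intros Hf Hg. apply Ccont_pair; simpl.
- apply (continuous_minus (V := R_NormedModule)); apply (continuous_mult (K := R_AbsRing));
    (apply Ccont_fst || apply Ccont_snd); assumption.
- apply (continuous_plus (V := R_NormedModule)); apply (continuous_mult (K := R_AbsRing));
    (apply Ccont_fst || apply Ccont_snd); assumption.
Qed.

Lemma Ccont_const (z : C) x : Ccont (fun _ => z) x.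
Proof. apply continuous_const. Qed.

Lemma Ccont_csum {T} (f : T -> R -> C) l x :
  (forall y, In y l -> Ccont (f y) x) -> Ccont (fun t => csum (fun y => f y t) l) x.
Proof.
induction l as [|y l IH]; intros H; [apply Ccont_const|].
apply Ccont_plus; [apply H; now left | apply IH; intros; apply H; now right].
Qed.

Lemma CInt_plus (f g : R -> C) a b : ex_CInt f a b -> ex_CInt g a b ->
  CInt (fun t => f t + g t)%C a b = (CInt f a b + CInt g a b)%C.
Proof. intros; now apply (RInt_plus (V := C_R_CompleteNormedModule)). Qed.

Lemma CInt_minus (f g : R -> C) a b : ex_CInt f a b -> ex_CInt g a b ->
  CInt (fun t => f t - g t)%C a b = (CInt f a b - CInt g a b)%C.
Proof. intros; now apply (RInt_minus (V := C_R_CompleteNormedModule)). Qed.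

Lemma ex_CInt_minus (f g : R -> C) a b : ex_CInt f a b -> ex_CInt g a b ->
  ex_CInt (fun t => f t - g t)%C a b.
Proof. intros; now apply (ex_RInt_minus (V := C_R_NormedModule)). Qed.

(** The module structure behind the integral has real scalars, so a complex constant is treated
    through the two components. *)
Lemma is_CInt_scal (f : R -> C) z a b l : is_RInt (V := C_R_NormedModule) f a b l ->
  is_RInt (V := C_R_NormedModule) (fun t => z * f t)%C a b (z * l)%C.
Proof.
intros H.
pose proof (is_RInt_fct_extend_fst (U := R_NormedModule) (V := R_NormedModule) _ _ _ _ H) as H1.
pose proof (is_RInt_fct_extend_snd (U := R_NormedModule) (V := R_NormedModule) _ _ _ _ H) as H2.
destruct z as [u v]. destruct l as [p q]; simpl in H1, H2.
pose proof (is_RInt_scal (V := R_NormedModule) _ _ _ u _ H1) as A1.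
pose proof (is_RInt_scal (V := R_NormedModule) _ _ _ v _ H2) as A2.
pose proof (is_RInt_scal (V := R_NormedModule) _ _ _ u _ H2) as A3.
pose proof (is_RInt_scal (V := R_NormedModule) _ _ _ v _ H1) as A4.
apply (is_RInt_fct_extend_pair (U := R_NormedModule) (V := R_NormedModule)
   (fun t => (u, v) * f t)%C a b (u * p - v * q) (u * q + v * p)).
- exact (is_RInt_minus (V := R_NormedModule) _ _ _ _ _ _ A1 A2).
- exact (is_RInt_plus (V := R_NormedModule) _ _ _ _ _ _ A3 A4).
Qed.

Lemma CInt_scal (f : R -> C) z a b : ex_CInt f a b ->
  CInt (fun t => z * f t)%C a b = (z * CInt f a b)%C.
Proof.
intros H. unfold CInt. apply (is_RInt_unique (V := C_R_CompleteNormedModule)). apply is_CInt_scal.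
apply (RInt_correct (V := C_R_CompleteNormedModule)). exact H.
Qed.

Lemma ex_CInt_scal (f : R -> C) z a b : ex_CInt f a b -> ex_CInt (fun t => z * f t)%C a b.
Proof. intros [l Hl]. eexists. apply is_CInt_scal; exact Hl. Qed.

Lemma Cmod_CInt_const (f : R -> C) a b M : a <= b -> ex_CInt f a b ->
  (forall t, a <= t <= b -> Cmod (f t) <= M) -> Cmod (CInt f a b) <= (b - a) * M.
Proof.
intros Hab He H. rewrite Cmod_norm.
apply (norm_RInt_le_const (V := C_R_NormedModule) f a b); [exact Hab | |].
- intros x Hx. rewrite <- Cmod_norm. now apply H.
- apply (RInt_correct (V := C_R_CompleteNormedModule)). exact He.
Qed.

Lemma Cmod_CInt_le (f : R -> C) (g : R -> R) a b l : a <= b -> ex_CInt f a b ->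
  is_RInt (V := R_NormedModule) g a b l ->
  (forall t, a <= t <= b -> Cmod (f t) <= g t) -> Cmod (CInt f a b) <= l.
Proof.
intros Hab He Hg H. rewrite Cmod_norm.
apply (norm_RInt_le (V := C_R_NormedModule) f g a b); [exact Hab | | | exact Hg].
- intros x Hx. rewrite <- Cmod_norm. now apply H.
- apply (RInt_correct (V := C_R_CompleteNormedModule)). exact He.
Qed.

Lemma CInt_csum {T} (f : T -> R -> C) l a b : (forall y, In y l -> ex_CInt (f y) a b) ->
  ex_CInt (fun t => csum (fun y => f y t) l) a b /\
  CInt (fun t => csum (fun y => f y t) l) a b = csum (fun y => CInt (f y) a b) l.
Proof.
induction l as [|y l IH]; intros H.
- change (ex_CInt (fun _ => RtoC 0) a b /\ CInt (fun _ => RtoC 0) a b = RtoC 0).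
  split; [exact (ex_RInt_const (V := C_R_NormedModule) a b (RtoC 0))|].
  unfold CInt. rewrite (RInt_const (V := C_R_CompleteNormedModule)).
  exact (scal_zero_r (V := C_R_NormedModule) (b - a)).
- destruct IH as [E1 E2]; [intros; apply H; now right|].
  assert (Hy : ex_CInt (f y) a b) by (apply H; now left).
  split.
  + exact (ex_RInt_plus (V := C_R_NormedModule) _ _ _ _ Hy E1).
  + rewrite csum_cons, <- E2. exact (CInt_plus _ _ _ _ Hy E1).
Qed.

(* Quadratic differentiability: uniform on U and closed under finite sums,
   products and uniform limits of the function, so that Cauchy's theorem needs
   neither compactness nor continuity of partial derivatives. *)
Definition Cdiff (U : C -> Prop) (f f' : C -> C) : Prop := exists K, 0 <= K /\
  forall s s', U s -> U s' -> Cmod (f s) <= K /\ Cmod (f' s) <= K /\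
    Cmod (f s' - f s - (s' - s) * f' s) <= K * Cmod (s' - s) ^ 2.

Lemma Cdiff_ext U f g f' g' : (forall s, U s -> f s = g s) -> (forall s, U s -> f' s = g' s) ->
  Cdiff U f f' -> Cdiff U g g'.
Proof.
intros H1 H2 [K [HK H]]. exists K; split; [exact HK|]. intros s s' Hs Hs'.
rewrite <- !H1, <- H2 by assumption. now apply H.
Qed.

(** For points at distance at most 1 this follows from the expansion, beyond that from the bound on
    |f|. *)
Lemma Cdiff_lip U f f' K : 0 <= K -> (forall s s', U s -> U s' -> Cmod (f s) <= K /\ Cmod (f' s) <= K /\
    Cmod (f s' - f s - (s' - s) * f' s) <= K * Cmod (s' - s) ^ 2) ->
  forall s s', U s -> U s' -> Cmod (f s' - f s) <= 2 * K * Cmod (s' - s).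
Proof.
intros HK H s s' Hs Hs'. destruct (H s s' Hs Hs') as [H1 [H2 H3]].
destruct (H s' s Hs' Hs) as [H4 _]. pose proof (Cmod_ge_0 (s' - s)) as Hh.
destruct (Rle_dec (Cmod (s' - s)) 1).
- pose proof (Cmod_triangle (f s' - f s - (s' - s) * f' s) ((s' - s) * f' s)) as T.
  replace (f s' - f s - (s' - s) * f' s + (s' - s) * f' s)%C with (f s' - f s)%C in T by ring.
  rewrite (Cmod_mult (s' - s)) in T.
  assert (Cmod (s' - s) * Cmod (f' s) <= Cmod (s' - s) * K) by (apply Rmult_le_compat_l; lra).
  assert (K * Cmod (s' - s) ^ 2 <= K * Cmod (s' - s)) by (apply Rmult_le_compat_l; [lra | nra]).
  lra.
- pose proof (Cmod_minus_le (f s') (f s)). nra.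
Qed.

(** Adding the expansions at s and at s' eliminates the values of f and leaves (s' - s)(f' s' - f'
    s). *)
Lemma Cdiff_lip' U f f' K : 0 <= K -> (forall s s', U s -> U s' -> Cmod (f s) <= K /\ Cmod (f' s) <= K /\
    Cmod (f s' - f s - (s' - s) * f' s) <= K * Cmod (s' - s) ^ 2) ->
  forall s s', U s -> U s' -> Cmod (f' s' - f' s) <= 2 * K * Cmod (s' - s).
Proof.
intros HK H s s' Hs Hs'. destruct (H s s' Hs Hs') as [_ [_ H1]].
destruct (H s' s Hs' Hs) as [_ [_ H2]]. pose proof (Cmod_ge_0 (s' - s)) as Hh.
destruct (Req_dec (Cmod (s' - s)) 0) as [E|E].
- apply Cmod_eq_0 in E. assert (E2 : s' = s) by (now apply Ceq_minus). subst s'.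
  replace (f' s - f' s)%C with (RtoC 0) by ring. rewrite Cmod_0. nra.
- rewrite (Cmod_minus_sym s s') in H2.
  apply Rmult_le_reg_l with (Cmod (s' - s)); [lra|]. rewrite <- Cmod_mult.
  replace ((s' - s) * (f' s' - f' s))%C with
    ((f s' - f s - (s' - s) * f' s) + (f s - f s' - (s - s') * f' s'))%C by ring.
  eapply Rle_trans; [apply Cmod_triangle|]. nra.
Qed.

Lemma Cdiff_plus U f g f' g' : Cdiff U f f' -> Cdiff U g g' ->
  Cdiff U (fun s => f s + g s)%C (fun s => f' s + g' s)%C.
Proof.
intros [K [HK H]] [L [HL G]]. exists (K + L). split; [lra|]. intros s s' Hs Hs'.
destruct (H s s' Hs Hs') as [H1 [H2 H3]]. destruct (G s s' Hs Hs') as [G1 [G2 G3]].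
split; [|split]; try (eapply Rle_trans; [apply Cmod_triangle | lra]).
replace (f s' + g s' - (f s + g s) - (s' - s) * (f' s + g' s))%C with
  ((f s' - f s - (s' - s) * f' s) + (g s' - g s - (s' - s) * g' s))%C by ring.
eapply Rle_trans; [apply Cmod_triangle | lra].
Qed.

Lemma Cdiff_mult U f g f' g' : Cdiff U f f' -> Cdiff U g g' ->
  Cdiff U (fun s => f s * g s)%C (fun s => f' s * g s + f s * g' s)%C.
Proof.
intros [K [HK H]] [L [HL G]]. exists (4 * (K * L)). split; [nra|]. intros s s' Hs Hs'.
destruct (H s s' Hs Hs') as [H1 [H2 H3]]. destruct (G s s' Hs Hs') as [G1 [G2 G3]].
destruct (G s' s Hs' Hs) as [G4 _].
pose proof (Cdiff_lip U g g' L HL G s s' Hs Hs') as G5.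
assert (M : forall z w p q, Cmod z <= p -> Cmod w <= q -> Cmod (z * w)%C <= p * q).
{ intros. rewrite Cmod_mult. apply Rmult_le_compat; auto; apply Cmod_ge_0. }
assert (HKL : 0 <= K * L) by nra.
split; [|split].
- apply Rle_trans with (K * L); [now apply M | lra].
- eapply Rle_trans; [apply Cmod_triangle|].
  pose proof (M _ _ _ _ H2 G1). pose proof (M _ _ _ _ H1 G2). lra.
- replace (f s' * g s' - f s * g s - (s' - s) * (f' s * g s + f s * g' s))%C with
    ((f s' - f s - (s' - s) * f' s) * g s' + f' s * ((s' - s) * (g s' - g s))
     + f s * (g s' - g s - (s' - s) * g' s))%C by ring.
  eapply Rle_trans; [apply Cmod_triangle|].
  eapply Rle_trans; [apply Rplus_le_compat_r, Cmod_triangle|].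
  pose proof (M _ _ _ _ H3 G4). pose proof (M _ _ _ _ H1 G3).
  pose proof (M _ _ _ _ H2 (M _ _ _ _ (Rle_refl (Cmod (s' - s))) G5)). nra.
Qed.

Lemma Cdiff_const U z : Cdiff U (fun _ => z) (fun _ => RtoC 0).
Proof.
exists (Cmod z). split; [apply Cmod_ge_0|]. intros s s' _ _.
replace (z - z - (s' - s) * 0)%C with (RtoC 0) by ring. rewrite Cmod_0.
pose proof (Cmod_ge_0 z). split; [lra | split; [lra|]]. pose proof (Cmod_ge_0 (s' - s)). nra.
Qed.

Lemma Cdiff_csum {T} U (f f' : T -> C -> C) l : (forall y, In y l -> Cdiff U (f y) (f' y)) ->
  Cdiff U (fun s => csum (fun y => f y s) l) (fun s => csum (fun y => f' y s) l).
Proof.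
induction l as [|y l IH]; intros H; [exact (Cdiff_const U (RtoC 0))|].
apply (Cdiff_plus U (f y) (fun s => csum (fun y => f y s) l) (f' y)).
- apply H; now left.
- apply IH; intros; apply H; now right.
Qed.

Lemma Cdiff_exp U al be R0 : (forall s, U s -> Cmod s <= R0) ->
  Cdiff U (fun s => Cexp (al + be * s)) (fun s => be * Cexp (al + be * s))%C.
Proof.
intros HU. set (b := Cmod be). set (M := exp (Cmod al + b * Rabs R0)).
assert (Hb : 0 <= b) by apply Cmod_ge_0.
assert (HM : 0 < M) by apply exp_pos.
set (D := exp (b * (2 * Rabs R0))).
assert (HD : 1 <= D).
{ unfold D. rewrite <- exp_0. apply exp_le. pose proof (Rabs_pos R0). nra. }
assert (He : forall s, U s -> Cmod (Cexp (al + be * s)) <= M).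
{ intros s Hs. rewrite Cmod_Cexp. apply exp_le. eapply Rle_trans; [apply Re_le_Cmod|].
  eapply Rle_trans; [apply Cmod_triangle|]. rewrite Cmod_mult. fold b.
  specialize (HU s Hs). pose proof (Rle_abs R0). nra. }
assert (HMD : M <= M * D) by nra.
assert (HMD0 : 0 <= M * D) by nra.
exists (M * D * (1 + b + 4 * b ^ 2)). split; [apply Rmult_le_pos; nra|].
intros s s' Hs Hs'. pose proof (He s Hs) as E1.
split; [|split].
- assert (0 <= M * D * (b + 4 * b ^ 2)) by (apply Rmult_le_pos; nra). lra.
- rewrite Cmod_mult. fold b.
  assert (0 <= M * D * (1 + 4 * b ^ 2)) by (apply Rmult_le_pos; nra).
  assert (b * Cmod (Cexp (al + be * s)) <= b * (M * D)) by (apply Rmult_le_compat_l; lra). lra.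
- replace (al + be * s')%C with ((al + be * s) + be * (s' - s))%C by ring.
  rewrite Cexp_plus. set (h := (s' - s)%C).
  replace (Cexp (al + be * s) * Cexp (be * h) - Cexp (al + be * s) - h * (be * Cexp (al + be * s)))%C
   with (Cexp (al + be * s) * (Cexp (be * h) - 1 - be * h))%C by ring.
  rewrite Cmod_mult. pose proof (Cexp_taylor (be * h)) as T. rewrite Cmod_mult in T. fold b in T.
  assert (Hh : Cmod h <= 2 * Rabs R0).
  { unfold h. eapply Rle_trans; [apply Cmod_minus_le|].
    pose proof (HU s Hs). pose proof (HU s' Hs'). pose proof (Rle_abs R0). lra. }
  assert (exp (b * Cmod h) <= D) by (apply exp_le; apply Rmult_le_compat_l; lra).
  pose proof (Cmod_ge_0 h). pose proof (exp_pos (b * Cmod h)).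
  apply Rle_trans with (M * (4 * ((b * Cmod h) ^ 2 * D))).
  + apply Rmult_le_compat; try apply Cmod_ge_0; [assumption|].
    eapply Rle_trans; [exact T|]. apply Rmult_le_compat_l; [lra|].
    apply Rmult_le_compat_l; [nra | assumption].
  + replace (M * (4 * ((b * Cmod h) ^ 2 * D))) with (M * D * (4 * b ^ 2) * Cmod h ^ 2) by ring.
    apply Rmult_le_compat_r; [nra|]. apply Rmult_le_compat_l; nra.
Qed.

Lemma Cdiff_inv U p q : (forall s, U s -> 1 <= Cmod (p + q * s)) ->
  Cdiff U (fun s => / (p + q * s))%C (fun s => - q / ((p + q * s) * (p + q * s)))%C.
Proof.
intros HU. set (b := Cmod q). assert (Hb : 0 <= b) by apply Cmod_ge_0.
assert (Hi : forall s, U s -> (p + q * s <> 0)%C /\ Cmod (/ (p + q * s)) <= 1).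
{ intros s Hs. specialize (HU s Hs). assert (p + q * s <> 0)%C by (apply Cmod_pos_neq0; lra).
  split; [assumption|]. rewrite Cmod_inv by assumption. rewrite <- Rinv_1.
  apply Rinv_le_contravar; lra. }
assert (Mp : forall z w p q, Cmod z <= p -> Cmod w <= q -> Cmod (z * w)%C <= p * q).
{ intros. rewrite Cmod_mult. apply Rmult_le_compat; auto; apply Cmod_ge_0. }
exists (1 + b + b ^ 2). split; [nra|]. intros s s' Hs Hs'.
destruct (Hi s Hs) as [N1 I1]. destruct (Hi s' Hs') as [N2 I2].
split; [nra | split].
- replace (- q / ((p + q * s) * (p + q * s)))%C with (- q * (/ (p + q * s) * / (p + q * s)))%C by (field; auto).
  pose proof (Mp (- q)%C _ b 1 ltac:(rewrite Cmod_opp; apply Rle_refl)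
    ltac:(rewrite <- (Rmult_1_l 1); apply (Mp _ _ _ _ I1 I1))). nra.
- replace (/ (p + q * s') - / (p + q * s) - (s' - s) * (- q / ((p + q * s) * (p + q * s))))%C
   with ((q * (s' - s)) * (q * (s' - s)) * (/ (p + q * s) * / (p + q * s) * / (p + q * s')))%C
   by (field; auto).
  assert (Hq : Cmod (q * (s' - s)) <= b * Cmod (s' - s)) by (rewrite Cmod_mult; apply Rle_refl).
  pose proof (Mp _ _ _ _ (Mp _ _ _ _ Hq Hq) (Mp _ _ _ _ (Mp _ _ _ _ I1 I1) I2)).
  eapply Rle_trans; [eassumption|]. pose proof (Cmod_ge_0 (s' - s)).
  replace (b * Cmod (s' - s) * (b * Cmod (s' - s)) * (1 * 1 * 1)) with (b ^ 2 * Cmod (s' - s) ^ 2) by ring.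
  apply Rmult_le_compat_r; nra.
Qed.

(** The vertical margin 1/2 provides two-sided neighbourhoods at the ends of the segments of
    integration. *)
Definition rect (x0 x1 y0 y1 : R) (s : C) : Prop :=
  x0 <= Re s <= x1 /\ y0 - 1 / 2 <= Im s <= y1 + 1 / 2.

Lemma pair_diff_re (x x' t : R) : ((x', t) - (x, t) = RtoC (x' - x))%C.
Proof. unfold Cminus, Cplus, Copp, RtoC; simpl; f_equal; ring. Qed.

Lemma pair_diff_im (x t t' : R) : ((x, t') - (x, t) = Ci * RtoC (t' - t))%C.
Proof. unfold Cminus, Cplus, Copp, RtoC, Ci, Cmult; simpl; f_equal; ring. Qed.

Lemma Rle_archimed_div A B C : (forall n, A <= B + C / INR (S n)) -> A <= B.
Proof.
intros H. apply Rnot_lt_le. intros Hlt.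
pose proof (H 0%nat) as H0. simpl in H0. assert (HC : 0 < C) by lra.
destruct (nfloor_ex (C / (A - B))) as [n [_ Hn]].
{ apply Rcomplements.Rdiv_le_0_compat; lra. }
specialize (H n). rewrite S_INR in H. pose proof (pos_INR n).
assert (C < (INR n + 1) * (A - B)).
{ apply Rmult_lt_reg_r with (/ (A - B)); [apply Rinv_0_lt_compat; lra|].
  rewrite Rmult_assoc, Rinv_r by lra. unfold Rdiv in Hn; lra. }
assert (C / (INR n + 1) < A - B).
{ apply Rmult_lt_reg_r with (INR n + 1); [lra|]. unfold Rdiv. rewrite Rmult_assoc, Rinv_l by lra. lra. }
lra.
Qed.

Lemma Cdiff_rect_vertical x0 x1 y0 y1 f f' : y0 <= y1 -> Cdiff (rect x0 x1 y0 y1) f f' ->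
  forall x, x0 <= x <= x1 ->
  ex_CInt (fun t => f (x, t)) y0 y1 /\ ex_CInt (fun t => f' (x, t)) y0 y1 /\
  (Ci * CInt (fun t => f' (x, t)) y0 y1 = f (x, y1) - f (x, y0))%C.
Proof.
intros Hy [K [HK H]] x Hx.
assert (HU : forall t, y0 - 1 / 2 <= t <= y1 + 1 / 2 -> rect x0 x1 y0 y1 (x, t))
  by (intros; split; simpl; lra).
assert (near : forall t, y0 <= t <= y1 -> forall t', Rabs (t' - t) < 1 / 2 ->
   rect x0 x1 y0 y1 (x, t) /\ rect x0 x1 y0 y1 (x, t')).
{ intros t Ht t' Ht'. apply Rabs_lt_between in Ht'. split; apply HU; lra. }
assert (C1 : forall t, y0 <= t <= y1 -> Ccont (fun t => f (x, t)) t).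
{ intros t Ht. apply Ccont_lipschitz with (2 * K) (1 / 2); [lra|]. intros t' Ht'.
  destruct (near t Ht t' Ht') as [U1 U2].
  pose proof (Cdiff_lip _ f f' K HK H _ _ U1 U2) as L.
  rewrite pair_diff_im, Cmod_mult, Cmod_Ci, Cmod_R, Rmult_1_l in L. exact L. }
assert (C2 : forall t, y0 <= t <= y1 -> Ccont (fun t => f' (x, t)) t).
{ intros t Ht. apply Ccont_lipschitz with (2 * K) (1 / 2); [lra|]. intros t' Ht'.
  destruct (near t Ht t' Ht') as [U1 U2].
  pose proof (Cdiff_lip' _ f f' K HK H _ _ U1 U2) as L.
  rewrite pair_diff_im, Cmod_mult, Cmod_Ci, Cmod_R, Rmult_1_l in L. exact L. }
split; [now apply Ccont_ex|]. split; [now apply Ccont_ex|].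
rewrite <- CInt_scal by (now apply Ccont_ex).
unfold CInt. apply (is_RInt_unique (V := C_R_CompleteNormedModule)).
apply (is_RInt_derive (V := C_R_CompleteNormedModule) (fun t => f (x, t))).
- intros t Ht. rewrite Rmin_left, Rmax_right in Ht by lra.
  apply quad_derive_R with K (1 / 2); [lra|]. intros t' Ht'.
  destruct (near t Ht t' Ht') as [U1 U2]. destruct (H _ _ U1 U2) as [_ [_ L]].
  rewrite pair_diff_im in L. rewrite (Cmod_mult Ci), Cmod_Ci, Cmod_R, Rmult_1_l in L.
  replace (RtoC (t' - t) * (Ci * f' (x, t)))%C with (Ci * RtoC (t' - t) * f' (x, t))%C by ring.
  exact L.
- intros t Ht. rewrite Rmin_left, Rmax_right in Ht by lra.
  apply (Ccont_mult (fun _ => Ci)); [apply Ccont_const | now apply C2].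
Qed.

(** Along a vertical segment i times the integral of f' is a difference of end values, at most M0 +
    M1. So the integral over Re = x moves by at most h (M0 + M1) + O(h^2) in a step h; n equal steps
    leave an error O(1/n), and n is arbitrary. *)
Lemma rect_shift x0 x1 y0 y1 f f' M0 M1 : x0 <= x1 -> y0 <= y1 -> Cdiff (rect x0 x1 y0 y1) f f' ->
  (forall x, x0 <= x <= x1 -> Cmod (f (x, y0)) <= M0 /\ Cmod (f (x, y1)) <= M1) ->
  Cmod (CInt (fun t => f (x1, t)) y0 y1 - CInt (fun t => f (x0, t)) y0 y1) <= (x1 - x0) * (M0 + M1).
Proof.
intros Hx Hy Hf HM.
pose proof (Cdiff_rect_vertical x0 x1 y0 y1 f f' Hy Hf) as HV.
destruct Hf as [K [HK H]].
set (G := fun x => CInt (fun t => f (x, t)) y0 y1).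
assert (St : forall x x', x0 <= x <= x1 -> x0 <= x' <= x1 -> x <= x' ->
  Cmod (G x' - G x) <= (x' - x) * (M0 + M1) + (y1 - y0) * (K * (x' - x) ^ 2)).
{ intros x x' Hx1 Hx2 Hxx. destruct (HV x Hx1) as [E1 [E2 E3]]. destruct (HV x' Hx2) as [E4 _].
  unfold G. rewrite <- CInt_minus by assumption.
  assert (E5 : ex_CInt (fun t => f (x', t) - f (x, t))%C y0 y1) by (now apply ex_CInt_minus).
  assert (E6 : ex_CInt (fun t => RtoC (x' - x) * f' (x, t))%C y0 y1) by (now apply ex_CInt_scal).
  pose proof (CInt_minus _ _ _ _ E5 E6) as E7. rewrite CInt_scal in E7 by assumption.
  assert (B1 : Cmod (CInt (fun t => f (x', t) - f (x, t) - RtoC (x' - x) * f' (x, t))%C y0 y1)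
     <= (y1 - y0) * (K * (x' - x) ^ 2)).
  { apply Cmod_CInt_const; [exact Hy | now apply ex_CInt_minus |].
    intros t Ht. destruct (H (x, t) (x', t)) as [_ [_ L]]; try (split; simpl; lra).
    rewrite pair_diff_re, Cmod_R, Rabs_pos_eq in L by lra. exact L. }
  rewrite E7 in B1.
  set (I1 := CInt (fun t => f (x', t) - f (x, t))%C y0 y1) in *.
  set (I2 := CInt (fun t => f' (x, t)) y0 y1) in *.
  assert (B2 : Cmod I2 <= M0 + M1).
  { replace (Cmod I2) with (Cmod (Ci * I2)) by (rewrite Cmod_mult, Cmod_Ci; ring).
    rewrite E3. eapply Rle_trans; [apply Cmod_minus_le|]. destruct (HM x Hx1); lra. }
  pose proof (Cmod_triangle (I1 - RtoC (x' - x) * I2) (RtoC (x' - x) * I2)) as T.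
  replace (I1 - RtoC (x' - x) * I2 + RtoC (x' - x) * I2)%C with I1 in T by ring.
  rewrite (Cmod_mult (RtoC _)), Cmod_R, Rabs_pos_eq in T by lra.
  assert ((x' - x) * Cmod I2 <= (x' - x) * (M0 + M1)) by (apply Rmult_le_compat_l; lra).
  lra. }
apply Rle_archimed_div with ((y1 - y0) * K * (x1 - x0) ^ 2).
intros n. pose proof (INR_S_ge1 n) as Hn. set (N := INR (S n)) in *. set (h := (x1 - x0) / N).
assert (Hh : 0 <= h) by (apply Rcomplements.Rdiv_le_0_compat; lra).
assert (HhN : N * h = x1 - x0) by (unfold h; field; lra).
assert (I : forall i, (i <= S n)%nat -> Cmod (G (x0 + INR i * h) - G x0) <=
   INR i * (h * (M0 + M1) + (y1 - y0) * (K * h ^ 2))).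
{ induction i as [|i IH]; intros Hi.
  - simpl INR. rewrite Rmult_0_l, Rplus_0_r.
    replace (G x0 - G x0)%C with (RtoC 0) by ring. rewrite Cmod_0; lra.
  - specialize (IH ltac:(lia)). apply le_INR in Hi. fold N in Hi. rewrite S_INR in *.
    pose proof (pos_INR i).
    assert (INR i * h <= N * h) by (apply Rmult_le_compat_r; lra).
    assert ((INR i + 1) * h <= N * h) by (apply Rmult_le_compat_r; lra).
    assert (0 <= INR i * h) by (apply Rmult_le_pos; lra).
    pose proof (St (x0 + INR i * h) (x0 + (INR i + 1) * h) ltac:(lra) ltac:(lra) ltac:(lra)) as S1.
    replace (x0 + (INR i + 1) * h - (x0 + INR i * h)) with h in S1 by ring.
    eapply Rle_trans; [apply Cmod_triangle3 with (y := G (x0 + INR i * h))|]. lra. }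
specialize (I (S n) (le_n _)). fold N in I.
replace (x0 + N * h) with x1 in I by lra. fold (G x1) (G x0).
eapply Rle_trans; [exact I|]. right. unfold h. field. lra.
Qed.

(** Uniform limits of quadratically differentiable functions. Zeta enters this class through its
    corrected partial sums, without any estimate for its derivative. *)
Definition Cholo (U : C -> Prop) (f : C -> C) : Prop :=
  forall eps, 0 < eps -> exists g g', Cdiff U g g' /\ forall s, U s -> Cmod (f s - g s) <= eps.

Lemma Cholo_bounded U f : Cholo U f -> exists K, 0 <= K /\ forall s, U s -> Cmod (f s) <= K.
Proof.
intros H. destruct (H 1 Rlt_0_1) as [g [g' [[K [HK Hg]] E]]].
exists (K + 1). split; [lra|]. intros s Hs. destruct (Hg s s Hs Hs) as [B _].
pose proof (Cmod_triangle (f s - g s) (g s)) as T.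
replace (f s - g s + g s)%C with (f s) in T by ring. specialize (E s Hs). lra.
Qed.

Lemma Cholo_mult U f g : Cholo U f -> Cholo U g -> Cholo U (fun s => f s * g s)%C.
Proof.
intros Hf Hg eps He.
destruct (Cholo_bounded U f Hf) as [K [HK Bf]]. destruct (Cholo_bounded U g Hg) as [L [HL Bg]].
set (d := Rmin 1 (eps / (K + L + 2))).
assert (Hd : 0 < d) by (apply Rmin_glb_lt; [lra | apply Rdiv_lt_0_compat; lra]).
assert (Hd1 : d <= 1) by apply Rmin_l.
assert (Hd2 : d * (K + L + 2) <= eps).
{ apply Rle_trans with (eps / (K + L + 2) * (K + L + 2)).
  - apply Rmult_le_compat_r; [lra | apply Rmin_r].
  - right; field; lra. }
destruct (Hf d Hd) as [f1 [f1' [D1 E1]]]. destruct (Hg d Hd) as [g1 [g1' [D2 E2]]].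
exists (fun s => f1 s * g1 s)%C, (fun s => f1' s * g1 s + f1 s * g1' s)%C.
split; [now apply Cdiff_mult|]. intros s Hs.
replace (f s * g s - f1 s * g1 s)%C with (f s * (g s - g1 s) + (f s - f1 s) * (g s - (g s - g1 s)))%C by ring.
eapply Rle_trans; [apply Cmod_triangle|]. rewrite !Cmod_mult.
specialize (E1 s Hs). specialize (E2 s Hs). specialize (Bf s Hs). specialize (Bg s Hs).
pose proof (Cmod_minus_le (g s) (g s - g1 s)).
assert (Cmod (f s) * Cmod (g s - g1 s) <= K * d) by (apply Rmult_le_compat; try apply Cmod_ge_0; lra).
assert (Cmod (f s - f1 s) * Cmod (g s - (g s - g1 s)) <= d * (L + 1))
  by (apply Rmult_le_compat; try apply Cmod_ge_0; lra).
nra.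
Qed.

(** An approximant within 1/N satisfies the bounds on the horizontal sides up to 1/N, and its
    vertical integrals differ from those of f by O(1/N). *)
Lemma Cholo_rect_shift x0 x1 y0 y1 f M0 M1 : x0 <= x1 -> y0 <= y1 -> Cholo (rect x0 x1 y0 y1) f ->
  ex_CInt (fun t => f (x0, t)) y0 y1 -> ex_CInt (fun t => f (x1, t)) y0 y1 ->
  (forall x, x0 <= x <= x1 -> Cmod (f (x, y0)) <= M0 /\ Cmod (f (x, y1)) <= M1) ->
  Cmod (CInt (fun t => f (x1, t)) y0 y1 - CInt (fun t => f (x0, t)) y0 y1) <= (x1 - x0) * (M0 + M1).
Proof.
intros Hx Hy Hf Ex0 Ex1 HM.
apply Rle_archimed_div with (2 * ((x1 - x0) + (y1 - y0))).
intros n. pose proof (INR_S_ge1 n) as Hn. set (N := INR (S n)) in *.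
assert (He : 0 < / N) by (apply Rinv_0_lt_compat; lra).
destruct (Hf (/ N) He) as [g [g' [D E]]].
pose proof (Cdiff_rect_vertical x0 x1 y0 y1 g g' Hy D) as HV.
pose proof (rect_shift x0 x1 y0 y1 g g' (M0 + / N) (M1 + / N) Hx Hy D) as S.
destruct (HV x0 ltac:(lra)) as [G0 _]. destruct (HV x1 ltac:(lra)) as [G1 _].
assert (Hd : forall x, x0 <= x <= x1 -> ex_CInt (fun t => f (x, t)) y0 y1 -> ex_CInt (fun t => g (x, t)) y0 y1 ->
  Cmod (CInt (fun t => f (x, t)) y0 y1 - CInt (fun t => g (x, t)) y0 y1) <= (y1 - y0) * / N).
{ intros x Hx1 X1 X2. rewrite <- CInt_minus by assumption.
  apply Cmod_CInt_const; [exact Hy | now apply ex_CInt_minus|].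
  intros t Ht. apply E. split; simpl; lra. }
pose proof (Hd x0 ltac:(lra) Ex0 G0) as B0. pose proof (Hd x1 ltac:(lra) Ex1 G1) as B1.
assert (S' : Cmod (CInt (fun t => g (x1, t)) y0 y1 - CInt (fun t => g (x0, t)) y0 y1)
   <= (x1 - x0) * (M0 + / N + (M1 + / N))).
{ apply S. intros x Hx1. destruct (HM x Hx1) as [H0 H1].
  assert (U0 : rect x0 x1 y0 y1 (x, y0)) by (split; simpl; lra).
  assert (U1 : rect x0 x1 y0 y1 (x, y1)) by (split; simpl; lra).
  pose proof (E _ U0) as E0. pose proof (E _ U1) as E1. rewrite Cmod_minus_sym in E0, E1.
  pose proof (Cmod_triangle (g (x, y0) - f (x, y0)) (f (x, y0))) as T0.
  replace (g (x, y0) - f (x, y0) + f (x, y0))%C with (g (x, y0)) in T0 by ring.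
  pose proof (Cmod_triangle (g (x, y1) - f (x, y1)) (f (x, y1))) as T1.
  replace (g (x, y1) - f (x, y1) + f (x, y1))%C with (g (x, y1)) in T1 by ring. lra. }
eapply Rle_trans; [apply Cmod_triangle3 with (y := CInt (fun t => g (x1, t)) y0 y1)|].
eapply Rle_trans; [apply Rplus_le_compat_l, Cmod_triangle3 with (y := CInt (fun t => g (x0, t)) y0 y1)|].
rewrite (Cmod_minus_sym (CInt (fun t => g (x0, t)) y0 y1)).
unfold Rdiv. nra.
Qed.

Lemma Rpower_neg_small p eps : 0 < p -> 0 < eps -> exists x0, 1 <= x0 /\ forall x, x0 <= x -> Rpower x (- p) <= eps.
Proof.
intros Hp He. exists (Rmax 1 (Rpower (/ eps) (/ p))). split; [apply Rmax_l|].
intros x Hx. assert (H1 : 1 <= x) by (eapply Rle_trans; [apply Rmax_l | exact Hx]).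
assert (H2 : Rpower (/ eps) (/ p) <= x) by (eapply Rle_trans; [apply Rmax_r | exact Hx]).
assert (Hi : 0 < / eps) by now apply Rinv_0_lt_compat.
rewrite Rpower_Ropp. rewrite <- (Rinv_inv eps). apply Rinv_le_contravar; [exact Hi|].
assert (H3 : Rpower (Rpower (/ eps) (/ p)) p <= Rpower x p)
  by (apply Rpower_le_l; [split; [apply Rpower_pos | exact H2] | lra]).
rewrite Rpower_mult, Rinv_l, Rpower_1 in H3; lra.
Qed.

(** A single N serves the whole of U: |s| is bounded there, and the real part of the argument is at
    least [dl], so the error is O(N^(-dl)) uniformly. *)
Lemma Cholo_zeta_affine U (kap : R) dl R0 : 0 < dl ->
  (forall s, U s -> Cmod s <= R0 /\ dl <= 1 / 2 + kap * Re s /\ 1 <= Rabs (kap * Im s)) ->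
  Cholo U (fun s => zeta (RtoC (1 / 2) + RtoC kap * s)%C).
Proof.
intros Hdl HU eps He.
set (wz := fun s => (RtoC (1 / 2) + RtoC kap * s)%C).
assert (Hre : forall s, Re (wz s) = 1 / 2 + kap * Re s) by (intros [x y]; unfold wz; simpl; ring).
assert (Him : forall s, Im (wz s) = kap * Im s) by (intros [x y]; unfold wz; simpl; ring).
assert (Hm1 : forall s, U s -> 1 <= Cmod (wz s)).
{ intros s Hs. destruct (HU s Hs) as [_ [_ H]]. rewrite <- Him in H.
  eapply Rle_trans; [exact H | apply (Rle_trans _ _ _ (Rmax_r _ _) (Rmax_Cmod (wz s)))]. }
assert (Hm2 : forall s, U s -> 1 <= Cmod (wz s - 1)).
{ intros s Hs. destruct (HU s Hs) as [_ [_ H]]. rewrite <- Him in H.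
  replace (Im (wz s)) with (snd (wz s - 1)%C) in H by (destruct (wz s); simpl; ring).
  eapply Rle_trans; [exact H | apply (Rle_trans _ _ _ (Rmax_r _ _) (Rmax_Cmod (wz s - 1)%C))]. }
assert (Hm3 : forall s, U s -> Cmod (wz s) <= 1 + Rabs kap * R0).
{ intros s Hs. destruct (HU s Hs) as [H _]. unfold wz.
  eapply Rle_trans; [apply Cmod_triangle|]. rewrite Cmod_mult, !Cmod_R, (Rabs_pos_eq (1 / 2)) by lra.
  assert (Rabs kap * Cmod s <= Rabs kap * R0) by (apply Rmult_le_compat_l; [apply Rabs_pos | exact H]). lra. }
set (Kc := 46 + 200 * (1 + / dl)).
assert (HKc : 0 < Kc) by (unfold Kc; pose proof (Rinv_0_lt_compat dl Hdl); lra).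
destruct (Rpower_neg_small dl (eps / Kc)) as [X [HX1 HX]]; [exact Hdl | now apply Rdiv_lt_0_compat|].
destruct (exists_nat_above (Rmax X (10 * (1 + Rabs kap * R0)))) as [N [HN1 HN2]].
{ eapply Rle_trans; [exact HX1 | apply Rmax_l]. }
assert (HNX : X <= INR N) by (eapply Rle_trans; [apply Rmax_l | apply HN2]).
assert (HNR : 10 * (1 + Rabs kap * R0) <= INR N) by (eapply Rle_trans; [apply Rmax_r | apply HN2]).
pose proof (INR_ge1 N HN1) as HN.
assert (D : exists g', Cdiff U (fun s => zeta_corrected (wz s) N) g').
{ assert (Ex : forall x z, exists g', Cdiff U (fun s => rcpow x (z - wz s)) g').
  { intros x z. eexists. eapply Cdiff_ext; [| intros; reflexivity |
      apply (Cdiff_exp U ((z - RtoC (1 / 2)) * RtoC (ln x)) (- RtoC kap * RtoC (ln x)) R0)].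
    - intros s _. unfold rcpow, wz. f_equal. ring.
    - intros s Hs; apply HU; exact Hs. }
  assert (D1 : exists g', Cdiff U (fun s => csum (npow (wz s)) (seq 1 N)) g').
  { exists (fun s => csum (fun n => (- RtoC kap * RtoC (ln (INR n)) * Cexp ((0 - RtoC (1 / 2)) * RtoC (ln (INR n))
        + - RtoC kap * RtoC (ln (INR n)) * s))%C) (seq 1 N)).
    apply (Cdiff_csum U (fun n s => npow (wz s) n)).
    intros n _. eapply Cdiff_ext; [| intros; reflexivity |
      apply (Cdiff_exp U ((0 - RtoC (1 / 2)) * RtoC (ln (INR n))) (- RtoC kap * RtoC (ln (INR n))) R0)].
    - intros s _. unfold npow, rcpow, wz. f_equal. ring.
    - intros s Hs; apply HU; exact Hs. }
  destruct D1 as [g1 D1]. destruct (Ex (INR N) 1%C) as [g2 D2].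
  assert (D3 := Cdiff_inv U (RtoC (1 / 2) - 1)%C (RtoC kap)).
  specialize (D3 ltac:(intros s Hs; replace (RtoC (1 / 2) - 1 + RtoC kap * s)%C with (wz s - 1)%C
     by (unfold wz; ring); now apply Hm2)).
  pose proof (Cdiff_plus U _ _ _ _ D1 (Cdiff_mult U _ _ _ _ D2 D3)) as D4.
  eexists. eapply Cdiff_ext; [| intros; reflexivity | exact D4].
  intros s Hs. unfold zeta_corrected. cbv beta.
  replace (RtoC (1 / 2) - 1 + RtoC kap * s)%C with (wz s - 1)%C by (unfold wz; ring).
  assert ((wz s - 1)%C <> 0%C) by (apply Cmod_pos_neq0; pose proof (Hm2 s Hs); lra).
  assert ((1 - wz s)%C <> 0%C) by (apply Cmod_pos_neq0; rewrite Cmod_minus_sym; pose proof (Hm2 s Hs); lra).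
  field. auto. }
destruct D as [g' D]. exists (fun s => zeta_corrected (wz s) N), g'. split; [exact D|].
intros s Hs. destruct (HU s Hs) as [H1 [H2 H3]]. fold (wz s).
eapply Rle_trans; [apply zeta_approx_error|].
- rewrite Hre; lra.
- now apply Hm1.
- now apply Hm2.
- exact HN1.
- pose proof (Hm3 s Hs); lra.
- apply Rle_trans with (Kc * (eps / Kc)); [|right; field; lra].
  apply Rmult_le_compat.
  + rewrite Hre. assert (0 < / (1 / 2 + kap * Re s)) by (apply Rinv_0_lt_compat; lra). lra.
  + left; apply Rpower_pos.
  + unfold Kc. assert (/ Re (wz s) <= / dl) by (rewrite Hre; apply Rinv_le_contravar; lra). lra.
  + apply Rle_trans with (Rpower (INR N) (- dl)).
    * apply Rpower_le_r; [exact HN | rewrite Hre; lra].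
    * apply HX; exact HNX.
Qed.

Lemma Ccont_zeta_line (p q : C) t : 0 < Re (p + q * RtoC t) -> (p + q * RtoC t <> 1)%C ->
  Ccont (fun t => zeta (p + q * RtoC t)%C) t.
Proof.
intros H1 H2.
apply (continuous_comp (U := R_UniformSpace) (V := C_UniformSpace) (W := C_R_CompleteNormedModule)
  (fun t => (p + q * RtoC t)%C) zeta).
- apply (Ccont_plus (fun _ => p)); [apply Ccont_const|].
  apply (Ccont_mult (fun _ => q)); [apply Ccont_const|].
  apply Ccont_lipschitz with 1 1; [lra|]. intros y _. rewrite <- RtoC_minus, Cmod_R. lra.
(* Neighbourhoods for the modulus and for the product structure agree by [locally_C]. *)
- intros P HP. apply locally_C.
  exact (ex_derive_continuous (K := C_AbsRing) (V := C_NormedModule) zeta _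
    (ex_derive_zeta _ H1 H2) P HP).
Qed.

(** * The mean value as a diagonal and an off-diagonal sum *)

Definition zeta_line (kap x t : R) : C := zeta (RtoC (1 / 2) + RtoC kap * (x, t))%C.
Definition zeta_triple (a b c x t : R) : C := (zeta_line a x t * zeta_line (- b) x t * zeta_line (- c) x t)%C.

Lemma zeta_line_arg kap x t : (RtoC (1 / 2) + RtoC kap * (x, t))%C = (1 / 2 + kap * x, kap * t).
Proof. unfold RtoC, Cplus, Cmult; simpl; f_equal; ring. Qed.

Lemma zeta_line_cont kap x t : 0 < 1 / 2 + kap * x -> (1 / 2 + kap * x <> 1 \/ kap * t <> 0) ->
  Ccont (zeta_line kap x) t.
Proof.
intros H1 H2.
apply (continuous_ext (fun t => zeta ((RtoC (1 / 2) + RtoC kap * RtoC x) + RtoC kap * Ci * RtoC t)%C)).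
{ intros u. unfold zeta_line. f_equal. unfold RtoC, Ci, Cplus, Cmult; simpl; f_equal; ring. }
apply Ccont_zeta_line.
- unfold Re, RtoC, Ci, Cplus, Cmult; simpl. lra.
- intros E. apply (f_equal (fun z => (fst z, snd z))) in E.
  unfold RtoC, Ci, Cplus, Cmult in E; simpl in E. injection E as E1 E2.
  destruct H2 as [H2|H2]; [apply H2 | apply H2]; lra.
Qed.

Lemma zeta_triple_cont a b c x t : 0 < a -> 0 < b -> 0 < c -> x <= 0 -> 0 < 1 / 2 + a * x -> (x = 0 \/ t <> 0) ->
  Ccont (zeta_triple a b c x) t.
Proof.
intros Ha Hb Hc Hx Hax H. 
assert (0 <= b * - x) by (apply Rmult_le_pos; lra). assert (0 <= c * - x) by (apply Rmult_le_pos; lra).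
apply (Ccont_mult (fun t => zeta_line a x t * zeta_line (- b) x t)%C (zeta_line (- c) x));
  [apply (Ccont_mult (zeta_line a x) (zeta_line (- b) x))|]; apply zeta_line_cont; try lra.
- destruct H as [->|H]; [left; lra | right; apply Rmult_integral_contrapositive; split; lra].
- destruct H as [->|H]; [left; lra | right; apply Rmult_integral_contrapositive; split; lra].
- destruct H as [->|H]; [left; lra | right; apply Rmult_integral_contrapositive; split; lra].
Qed.

(* The convexity exponents of the three factors add up to at most 3/4 on both
   horizontal sides. *)
Lemma line_shift a b c th : 2 <= a -> a < c -> c <= b -> 0 < th -> a * th < 1 / 2 ->
  exists K, 0 < K /\ forall T, 1 <= T ->
   Cmod (CInt (zeta_triple a b c 0) 1 T - CInt (zeta_triple a b c (- th)) 1 T) <= K * Rpower T (3 / 4).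
Proof.
intros Ha Hac Hcb Hth Hat. set (dl := 1 / 2 - a * th).
destruct (zeta_growth dl (1 / 2)) as [K1 [HK1 G1]]; [unfold dl; lra|].
destruct (zeta_growth (1 / 2) (1 / 2 + b * th)) as [K2 [HK2 G2]]; [lra|].
assert (Hb0 : 0 <= b * th) by (apply Rmult_le_pos; lra).
set (Kt := (K1 * a) * (K2 * b) * (K2 * c)).
assert (HKt : 0 < Kt) by (unfold Kt; repeat apply Rmult_lt_0_compat; lra).
exists (2 * th * Kt). split; [apply Rmult_lt_0_compat; lra|].
intros T HT.
assert (Bd : forall y, 1 <= y <= T -> forall x, - th <= x <= 0 -> Cmod (zeta_triple a b c x y) <= Kt * Rpower T (3 / 4)).
{ intros y Hy x Hx. set (u := - x).
  assert (Hau : 0 <= a * u <= a * th) by (unfold u; split; [apply Rmult_le_pos; lra | apply Rmult_le_compat_l; lra]).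
  assert (Hbu : 0 <= b * u <= b * th) by (unfold u; split; [apply Rmult_le_pos; lra | apply Rmult_le_compat_l; lra]).
  assert (Hcu : a * u <= c * u <= b * u) by (unfold u; split; apply Rmult_le_compat_r; lra).
  assert (Pw : forall k e, 1 <= k -> 0 <= e <= 1 -> Rpower (k * y) e <= k * Rpower y e).
  { intros k e Hk He. rewrite <- Rpower_mult_distr by lra. apply Rmult_le_compat_r; [left; apply Rpower_pos|].
    rewrite <- (Rpower_1 k) at 2 by lra. apply Rpower_le_r; lra. }
  assert (Z1 : Cmod (zeta_line a x y) <= K1 * a * Rpower y (Rmax ((1 - (1 / 2 - a * u)) / 2) (1 / 8))).
  { unfold zeta_line. rewrite zeta_line_arg. specialize (G1 (1 / 2 + a * x, a * y)). simpl in G1.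
    rewrite Rabs_pos_eq in G1 by nra. eapply Rle_trans; [apply G1; unfold dl, u in *; nra|].
    rewrite Rmult_assoc. apply Rmult_le_compat_l; [lra|].
    replace (1 / 2 + a * x) with (1 / 2 - a * u) by (unfold u; ring).
    apply Pw; [lra|]. split; [eapply Rle_trans; [|apply Rmax_r]; lra | apply Rmax_lub; lra]. }
  assert (Z2 : forall k, a * u <= k * u <= b * u -> a <= k -> Cmod (zeta_line (- k) x y) <=
     K2 * k * Rpower y (Rmax ((1 - (1 / 2 + k * u)) / 2) (1 / 8))).
  { intros k Hk Hk2. unfold zeta_line. rewrite zeta_line_arg. specialize (G2 (1 / 2 + - k * x, - k * y)). simpl in G2.
    replace (- k * y) with (- (k * y)) in * by ring.
    rewrite Rabs_Ropp, Rabs_pos_eq in G2 by nra.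
    replace (1 / 2 + - k * x) with (1 / 2 + k * u) in * by (unfold u; ring).
    eapply Rle_trans; [apply G2; [lra | nra]|].
    rewrite Rmult_assoc. apply Rmult_le_compat_l; [lra|].
    apply Pw; [lra|]. split; [eapply Rle_trans; [|apply Rmax_r]; lra | apply Rmax_lub; lra]. }
  pose proof (Z2 b ltac:(lra) ltac:(lra)) as Zb. pose proof (Z2 c ltac:(lra) ltac:(lra)) as Zc.
  set (e1 := Rmax ((1 - (1 / 2 - a * u)) / 2) (1 / 8)) in *.
  set (e2 := Rmax ((1 - (1 / 2 + b * u)) / 2) (1 / 8)) in *.
  set (e3 := Rmax ((1 - (1 / 2 + c * u)) / 2) (1 / 8)) in *.
  (* If neither [e2] nor [e3] is capped at 1/8, the sum is 3/4 + (a - b - c) u/2. If both are, it is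
     below 1/2 + 1/8 + 1/8 because a u < 1/2. If only one is, it is at most 5/8. *)
  assert (He : e1 + e2 + e3 <= 3 / 4).
  { unfold e1, e2, e3, Rmax. repeat destruct (Rle_dec _ _); lra. }
  unfold zeta_triple. rewrite !Cmod_mult.
  apply Rle_trans with ((K1 * a * Rpower y e1) * (K2 * b * Rpower y e2) * (K2 * c * Rpower y e3)).
  - apply Rmult_le_compat; try apply Rmult_le_compat; try apply Rmult_le_pos; try apply Cmod_ge_0; assumption.
  - replace ((K1 * a * Rpower y e1) * (K2 * b * Rpower y e2) * (K2 * c * Rpower y e3))
     with (Kt * (Rpower y e1 * Rpower y e2 * Rpower y e3)) by (unfold Kt; ring).
    rewrite <- !Rpower_plus. apply Rmult_le_compat_l; [lra|].
    apply Rle_trans with (Rpower y (3 / 4)); [apply Rpower_le_r; lra | apply Rpower_le_l; lra]. }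
assert (HU : forall s, rect (- th) 0 1 T s -> Cmod s <= th + (T + 1 / 2) /\ - th <= Re s <= 0 /\ 1 / 2 <= Im s).
{ intros [x y] [H1 H2]; simpl in *. split; [|lra]. eapply Rle_trans; [apply Cmod_le_sum|].
  rewrite (Rabs_left1 x), (Rabs_pos_eq y) by lra. lra. }
assert (Hol : Cholo (rect (- th) 0 1 T) (fun s => (zeta (RtoC (1 / 2) + RtoC a * s) *
    zeta (RtoC (1 / 2) + RtoC (- b) * s) * zeta (RtoC (1 / 2) + RtoC (- c) * s))%C)).
{ repeat apply Cholo_mult.
  - apply (Cholo_zeta_affine _ a dl (th + (T + 1 / 2))); [unfold dl; lra|].
    intros s Hs. destruct (HU s Hs) as [H1 [H2 H3]]. split; [exact H1|]. unfold dl.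
    rewrite Rabs_pos_eq by nra. split; nra.
  - apply (Cholo_zeta_affine _ (- b) (1 / 2) (th + (T + 1 / 2))); [lra|].
    intros s Hs. destruct (HU s Hs) as [H1 [H2 H3]]. split; [exact H1|].
    replace (- b * Im s) with (- (b * Im s)) by ring.
    rewrite Rabs_Ropp, Rabs_pos_eq by nra. split; nra.
  - apply (Cholo_zeta_affine _ (- c) (1 / 2) (th + (T + 1 / 2))); [lra|].
    intros s Hs. destruct (HU s Hs) as [H1 [H2 H3]]. split; [exact H1|].
    replace (- c * Im s) with (- (c * Im s)) by ring.
    rewrite Rabs_Ropp, Rabs_pos_eq by nra. split; nra. }
pose proof (Cholo_rect_shift (- th) 0 1 T _ (Kt * Rpower T (3 / 4)) (Kt * Rpower T (3 / 4))
   ltac:(lra) HT Hol) as S.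
change (ex_CInt (zeta_triple a b c (- th)) 1 T -> ex_CInt (zeta_triple a b c 0) 1 T ->
  (forall x, - th <= x <= 0 -> Cmod (zeta_triple a b c x 1) <= Kt * Rpower T (3 / 4) /\
     Cmod (zeta_triple a b c x T) <= Kt * Rpower T (3 / 4)) ->
  Cmod (CInt (zeta_triple a b c 0) 1 T - CInt (zeta_triple a b c (- th)) 1 T)
   <= (0 - - th) * (Kt * Rpower T (3 / 4) + Kt * Rpower T (3 / 4))) in S.
eapply Rle_trans; [apply S|].
- apply Ccont_ex; [exact HT|]. intros t Ht. apply zeta_triple_cont; lra.
- apply Ccont_ex; [exact HT|]. intros t Ht. apply zeta_triple_cont; lra.
- intros x Hx. split; apply Bd; lra.
- right; ring.
Qed.

(** * Replacing the zeta factors by Dirichlet polynomials *)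

Definition dir_poly (kap x : R) (N : nat) (t : R) : C :=
  csum (npow (1 / 2 + kap * x, kap * t)) (seq 1 N).

Lemma npow_pair sg y n : npow (sg, y) n = (RtoC (Rpower (INR n) (- sg)) * Cexp (Ci * RtoC (- y * ln (INR n))))%C.
Proof.
rewrite npow_split. simpl. f_equal. unfold npow_i, npow, rcpow. f_equal.
rewrite RtoC_mult, RtoC_opp. ring.
Qed.

Lemma Cexp_line_cont lam t : Ccont (fun t => Cexp (Ci * RtoC (lam * t))) t.
Proof.
assert (E : forall u, Cexp (Ci * RtoC (lam * u)) = (cos (lam * u), sin (lam * u))).
{ intros u. unfold Cexp, Ci, RtoC, Cmult, Re, Im; simpl.
  replace (0 * (lam * u) - 1 * 0) with 0 by ring. rewrite exp_0.
  replace (0 * 0 + 1 * (lam * u)) with (lam * u) by ring. f_equal; ring. }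
apply Ccont_pair.
- apply (continuous_ext (fun u => cos (lam * u))); [intros u; rewrite E; reflexivity|].
  apply (ex_derive_continuous (V := R_NormedModule)). auto_derive; trivial.
- apply (continuous_ext (fun u => sin (lam * u))); [intros u; rewrite E; reflexivity|].
  apply (ex_derive_continuous (V := R_NormedModule)). auto_derive; trivial.
Qed.

Lemma dir_poly_cont kap x N t : Ccont (dir_poly kap x N) t.
Proof.
unfold dir_poly. apply (Ccont_csum (fun n t => npow (1 / 2 + kap * x, kap * t) n)).
intros n _. 
apply (continuous_ext (fun t => RtoC (Rpower (INR n) (- (1 / 2 + kap * x))) * Cexp (Ci * RtoC (- kap * ln (INR n) * t)))%C).
{ intros u. rewrite npow_pair. do 4 f_equal. ring. }
apply (Ccont_mult (fun _ => RtoC _)); [apply Ccont_const | apply Cexp_line_cont].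
Qed.

Lemma Cmod_npow_pair sg y n : Cmod (npow (sg, y) n) = Rpower (INR n) (- sg).
Proof. rewrite Cmod_npow; reflexivity. Qed.

Lemma dir_poly_bound_lt1 kap x N t : 0 < 1 / 2 + kap * x < 1 -> 
  Cmod (dir_poly kap x N t) <= Rpower (INR N) (1 - (1 / 2 + kap * x)) / (1 - (1 / 2 + kap * x)).
Proof.
intros H. unfold dir_poly. eapply Rle_trans; [|apply sum_power_lt1; lra].
apply Cmod_csum_le. intros n _. rewrite Cmod_npow_pair. lra.
Qed.

Lemma dir_poly_bound_gt1 kap x N t : 1 < 1 / 2 + kap * x ->
  Cmod (dir_poly kap x N t) <= (1 / 2 + kap * x) / (1 / 2 + kap * x - 1).
Proof.
intros H. unfold dir_poly. 
pose proof (sum_power_tail (1 / 2 + kap * x) 1 N H (le_n 1)) as S.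
simpl (INR 1) in S. rewrite Rpower_base1, Rmult_1_r in S.
eapply Rle_trans; [|exact S]. apply Cmod_csum_le. intros n _. rewrite Cmod_npow_pair. lra.
Qed.

Lemma zeta_line_approx kap x : 0 < 1 / 2 + kap * x -> 1 <= Rabs kap ->
  exists K, 0 < K /\ forall t N, 1 <= t -> (1 <= N)%nat ->
   10 * (1 / 2 + Rabs (kap * x) + Rabs kap * t) <= INR N ->
   Cmod (zeta_line kap x t - dir_poly kap x N t) <= K * (Rpower (INR N) (1 - (1 / 2 + kap * x)) / t).
Proof.
intros H1 H2. set (sg := 1 / 2 + kap * x) in *.
assert (Hi : 0 < / sg) by (apply Rinv_0_lt_compat; lra).
exists (46 + 200 * (1 + / sg) + 1). split; [lra|].
intros t N Ht HN H. unfold zeta_line, dir_poly. rewrite zeta_line_arg. fold sg.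
assert (HN1 := INR_ge1 N HN).
assert (Him : t <= Rabs (kap * t)) by (rewrite Rabs_mult, (Rabs_pos_eq t) by lra; nra).
assert (Hsg : Rabs sg <= 1 / 2 + Rabs (kap * x)).
{ unfold sg. eapply Rle_trans; [apply Rabs_triang|]. rewrite (Rabs_pos_eq (1 / 2)) by lra. lra. }
eapply Rle_trans; [apply zeta_dirichlet_error; simpl|].
- exact H1.
- lra.
- exact HN.
- apply Rle_trans with (2 := H). apply Rmult_le_compat_l; [lra|].
  eapply Rle_trans; [apply Cmod_le_sum|]. rewrite (Rabs_mult kap t), (Rabs_pos_eq t) by lra. lra.
- simpl.
  assert (HtN : t <= INR N).
  { pose proof (Rabs_pos (kap * x)). assert (t <= Rabs kap * t) by nra. lra. }
  pose proof (Rpower_pos (INR N) (1 - sg)) as P.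
  assert (A1 : Rpower (INR N) (- sg) <= Rpower (INR N) (1 - sg) / t).
  { replace (- sg) with (1 - sg + - (1)) by ring. rewrite Rpower_plus, (Rpower_Ropp _ 1), Rpower_1 by lra.
    apply Rmult_le_compat_l; [lra|]. apply Rinv_le_contravar; lra. }
  assert (A2 : Rpower (INR N) (1 - sg) / Rabs (kap * t) <= Rpower (INR N) (1 - sg) / t).
  { apply Rmult_le_compat_l; [lra|]. apply Rinv_le_contravar; lra. }
  nra.
Qed.

Lemma is_RInt_inv_ln T : 1 <= T -> is_RInt (V := R_NormedModule) (fun t => / t) 1 T (ln T).
Proof.
intros HT. replace (ln T) with (minus (G := R_AbelianGroup) (ln T) (ln 1)).
2: { rewrite ln_1. unfold minus, plus, opp; simpl; ring. }
apply (is_RInt_derive (V := R_CompleteNormedModule) ln).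
- intros x Hx. rewrite Rmin_left, Rmax_right in Hx by lra. auto_derive; [lra | field; lra].
- intros x Hx. rewrite Rmin_left, Rmax_right in Hx by lra.
  apply (ex_derive_continuous (V := R_NormedModule)). auto_derive. lra.
Qed.

Definition dir_prod (a b c x : R) (N M : nat) (t : R) : C :=
  (dir_poly a x N t * dir_poly (- b) x M t * dir_poly (- c) x M t)%C.

Lemma dir_prod_cont a b c x N M t : Ccont (dir_prod a b c x N M) t.
Proof. apply (Ccont_mult (fun t => dir_poly a x N t * dir_poly (- b) x M t)%C (dir_poly (- c) x M));
  [apply (Ccont_mult (dir_poly a x N) (dir_poly (- b) x M))|]; apply dir_poly_cont. Qed.

(** The abscissa 1/2 + k th exceeds 1, so the error M^(1/2 - k th) can be made as small as desired
    on [1, T] by taking M large; boundedness of zeta follows from that of its polynomials. *)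
Lemma zeta_line_right_bounds k th : 1 <= k -> 0 < th -> 1 / 2 < k * th ->
  exists Bk, 0 < Bk /\ (forall M t, Cmod (dir_poly (- k) (- th) M t) <= Bk) /\
    (forall t, 1 <= t -> Cmod (zeta_line (- k) (- th) t) <= Bk) /\
    (forall T eps, 1 <= T -> 0 < eps -> exists M0, forall M, (M0 <= M)%nat -> forall t, 1 <= t <= T ->
       Cmod (zeta_line (- k) (- th) t - dir_poly (- k) (- th) M t) <= Bk * eps).
Proof.
intros Hk Hth H. assert (E : - k * - th = k * th) by ring.
destruct (zeta_line_approx (- k) (- th)) as [K [HK HA]]; [rewrite E; lra | rewrite Rabs_Ropp, Rabs_pos_eq; lra |].
rewrite E in HA. rewrite Rabs_Ropp in HA. rewrite (Rabs_pos_eq k), (Rabs_pos_eq (k * th)) in HA by lra.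
set (B := (1 / 2 + k * th) / (1 / 2 + k * th - 1)).
assert (HB : 0 < B) by (apply Rdiv_lt_0_compat; lra).
assert (B1 : forall M t, Cmod (dir_poly (- k) (- th) M t) <= B).
{ intros M t. pose proof (dir_poly_bound_gt1 (- k) (- th) M t) as D. rewrite E in D. apply D; lra. }
assert (Ap : forall T eps, 1 <= T -> 0 < eps -> exists M0, forall M, (M0 <= M)%nat -> forall t, 1 <= t <= T ->
       Cmod (zeta_line (- k) (- th) t - dir_poly (- k) (- th) M t) <= K * eps).
{ intros T eps HT He.
  destruct (Rpower_neg_small (k * th - 1 / 2) eps) as [x0 [Hx1 Hx2]]; [lra | exact He|].
  destruct (exists_nat_above (Rmax x0 (10 * (1 / 2 + k * th + k * T)))) as [M0 [HM1 [HM2 _]]].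
  { eapply Rle_trans; [exact Hx1 | apply Rmax_l]. }
  exists M0. intros M HM t Ht.
  assert (HM3 : INR M0 <= INR M) by (now apply le_INR).
  assert (H3 : x0 <= INR M) by (eapply Rle_trans; [apply Rmax_l|]; eapply Rle_trans; [exact HM2 | exact HM3]).
  assert (H4 : 10 * (1 / 2 + k * th + k * T) <= INR M)
    by (eapply Rle_trans; [apply Rmax_r|]; eapply Rle_trans; [exact HM2 | exact HM3]).
  eapply Rle_trans; [apply HA; [lra | lia | nra]|]. apply Rmult_le_compat_l; [lra|].
  replace (1 - (1 / 2 + k * th)) with (- (k * th - 1 / 2)) by field.
  specialize (Hx2 _ H3). pose proof (Rpower_pos (INR M) (- (k * th - 1 / 2))).
  apply Rle_trans with (Rpower (INR M) (- (k * th - 1 / 2)) / 1).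
  - apply Rmult_le_compat_l; [lra|]. apply Rinv_le_contravar; lra.
  - lra. }
exists (K + B). split; [lra|]. split; [|split].
- intros M t. specialize (B1 M t). lra.
- intros t Ht. destruct (Ap t 1 Ht Rlt_0_1) as [M0 HM0].
  specialize (HM0 M0 (le_n _) t ltac:(lra)). specialize (B1 M0 t).
  pose proof (Cmod_triangle (zeta_line (- k) (- th) t - dir_poly (- k) (- th) M0 t) (dir_poly (- k) (- th) M0 t)) as T.
  replace (zeta_line (- k) (- th) t - dir_poly (- k) (- th) M0 t + dir_poly (- k) (- th) M0 t)%C
    with (zeta_line (- k) (- th) t) in T by ring. lra.
- intros T eps HT He. destruct (Ap T eps HT He) as [M0 HM0]. exists M0. intros M HM t Ht.
  eapply Rle_trans; [now apply HM0|]. apply Rmult_le_compat_r; lra.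
Qed.

(** The error of the first factor, N^(1/2 + a th)/t, integrates to the logarithm. The other two
    factors are replaced within O(1/T), which costs O(N^(1/2 + a th)) over [1, T]. *)
Lemma dirichlet_line a b c th : 2 <= a -> a < c -> c <= b -> 0 < th -> a * th < 1 / 2 -> 1 / 2 < c * th ->
  exists K, 0 < K /\ forall T N, 1 <= T -> (1 <= N)%nat -> 10 * (1 / 2 + a * th + a * T) <= INR N ->
   exists M0, forall M, (M0 <= M)%nat ->
   Cmod (CInt (zeta_triple a b c (- th)) 1 T - CInt (dir_prod a b c (- th) N M) 0 T)
    <= K * (Rpower (INR N) (1 / 2 + a * th) * (1 + ln T)).
Proof.
intros Ha Hac Hcb Hth Hat Hct.
assert (Hbt : 1 / 2 < b * th) by nra.
assert (Hat0 : 0 < a * th) by nra.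
destruct (zeta_line_right_bounds b th) as [Bb [HBb [Bb1 [Bb2 Bb3]]]]; [lra..|].
destruct (zeta_line_right_bounds c th) as [Bc [HBc [Bc1 [Bc2 Bc3]]]]; [lra..|].
destruct (zeta_line_approx a (- th)) as [K1 [HK1 A1]]; [nra | rewrite Rabs_pos_eq; lra|].
replace (1 - (1 / 2 + a * - th)) with (1 / 2 + a * th) in A1 by field.
replace (Rabs (a * - th)) with (a * th) in A1
  by (replace (a * - th) with (- (a * th)) by ring; rewrite Rabs_Ropp, Rabs_pos_eq; lra).
rewrite (Rabs_pos_eq a) in A1 by lra.
assert (HBB : 0 < Bb * Bc) by (now apply Rmult_lt_0_compat).
exists (K1 * (Bb * Bc) + 2 * (2 * (Bb * Bc)) + 2 * (Bb * Bc)). split.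
{ assert (0 < K1 * (Bb * Bc)) by (now apply Rmult_lt_0_compat). lra. }
intros T N HT HN HNT.
destruct (Bb3 T (/ T) HT) as [M1 HM1]; [apply Rinv_0_lt_compat; lra|].
destruct (Bc3 T (/ T) HT) as [M2 HM2]; [apply Rinv_0_lt_compat; lra|].
exists (Nat.max M1 M2). intros M HM.
set (P := Rpower (INR N) (1 / 2 + a * th)). assert (HP : 0 < P) by apply Rpower_pos.
assert (HTi : 0 < / T) by (apply Rinv_0_lt_compat; lra).
assert (D0 : forall t, Cmod (dir_poly a (- th) N t) <= 2 * P).
{ intros t. eapply Rle_trans; [apply dir_poly_bound_lt1; lra|].
  replace (1 - (1 / 2 + a * - th)) with (1 / 2 + a * th) by field. fold P.
  unfold Rdiv. rewrite Rmult_comm. apply Rmult_le_compat_r; [lra|].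
  replace 2 with (/ (1 / 2)) by field. apply Rinv_le_contravar; lra. }
assert (X1 : ex_CInt (zeta_triple a b c (- th)) 1 T).
{ apply Ccont_ex; [exact HT|]. intros t Ht. apply zeta_triple_cont; lra. }
assert (X2 : forall u v, u <= v -> ex_CInt (dir_prod a b c (- th) N M) u v).
{ intros u v Huv. apply Ccont_ex; [exact Huv|]. intros t Ht. apply dir_prod_cont. }
assert (Mp : forall z w p q, Cmod z <= p -> Cmod w <= q -> Cmod (z * w)%C <= p * q).
{ intros. rewrite Cmod_mult. apply Rmult_le_compat; auto; apply Cmod_ge_0. }
assert (B1 : Cmod (CInt (zeta_triple a b c (- th)) 1 T - CInt (dir_prod a b c (- th) N M) 1 T)
   <= K1 * (Bb * Bc) * P * ln T + 2 * (2 * (Bb * Bc)) * P).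
{ rewrite <- CInt_minus by auto.
  assert (IG : is_RInt (V := R_NormedModule) (fun t => K1 * (Bb * Bc) * P * / t + 2 * (2 * (Bb * Bc)) * P * / T) 1 T
     (K1 * (Bb * Bc) * P * ln T + (T - 1) * (2 * (2 * (Bb * Bc)) * P * / T))).
  { apply (is_RInt_plus (V := R_NormedModule)).
    - apply (is_RInt_scal (V := R_NormedModule)). now apply is_RInt_inv_ln.
    - apply (is_RInt_const (V := R_NormedModule)). }
  apply Rle_trans with (K1 * (Bb * Bc) * P * ln T + (T - 1) * (2 * (2 * (Bb * Bc)) * P * / T)).
  - apply (Cmod_CInt_le _ _ 1 T _ HT (ex_CInt_minus _ _ _ _ X1 (X2 1 T HT)) IG).
    intros t Ht. unfold zeta_triple, dir_prod.
    set (za := zeta_line a (- th) t). set (zb := zeta_line (- b) (- th) t). set (zc := zeta_line (- c) (- th) t).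
    set (da := dir_poly a (- th) N t). set (db := dir_poly (- b) (- th) M t). set (dc := dir_poly (- c) (- th) M t).
    replace (za * zb * zc - da * db * dc)%C with
      ((za - da) * (zb * zc) + (da * ((zb - db) * zc) + da * (db * (zc - dc))))%C by ring.
    assert (E1 : Cmod (za - da) <= K1 * (P / t)).
    { apply A1; [lra | exact HN |]. apply Rle_trans with (2 := HNT). nra. }
    assert (E2 : Cmod (zb - db) <= Bb * / T) by (apply HM1; [lia | lra]).
    assert (E3 : Cmod (zc - dc) <= Bc * / T) by (apply HM2; [lia | lra]).
    pose proof (Mp _ _ _ _ E1 (Mp _ _ _ _ (Bb2 t ltac:(lra)) (Bc2 t ltac:(lra)))) as F1.
    pose proof (Mp _ _ _ _ (D0 t) (Mp _ _ _ _ E2 (Bc2 t ltac:(lra)))) as F2.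
    pose proof (Mp _ _ _ _ (D0 t) (Mp _ _ _ _ (Bb1 M t) E3)) as F3.
    eapply Rle_trans; [apply Cmod_triangle|].
    eapply Rle_trans; [apply Rplus_le_compat_l, Cmod_triangle|].
    apply Rle_trans with (K1 * (P / t) * (Bb * Bc) + (2 * P * (Bb * / T * Bc) + 2 * P * (Bb * (Bc * / T)))).
    + apply Rplus_le_compat; [exact F1 | apply Rplus_le_compat; [exact F2 | exact F3]].
    + right. unfold Rdiv. ring.
  - apply Rplus_le_compat_l. replace ((T - 1) * (2 * (2 * (Bb * Bc)) * P * / T))
      with (2 * (2 * (Bb * Bc)) * P * ((T - 1) * / T)) by ring.
    rewrite <- (Rmult_1_r (2 * (2 * (Bb * Bc)) * P)) at 2.
    apply Rmult_le_compat_l; [apply Rmult_le_pos; lra|].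
    apply Rmult_le_reg_r with T; [lra|]. rewrite Rmult_assoc, Rinv_l; lra. }
(* The polynomials are harmless near t = 0, so their integral is extended to [0, T]: the diagonal
   terms then give exactly T. *)
assert (B2 : Cmod (CInt (dir_prod a b c (- th) N M) 0 1) <= 2 * (Bb * Bc) * P).
{ replace (2 * (Bb * Bc) * P) with ((1 - 0) * (2 * P * Bb * Bc)) by ring.
  apply Cmod_CInt_const; [lra | apply X2; lra |]. intros t Ht. unfold dir_prod.
  apply Mp; [apply Mp|]; auto. }
assert (Ch : CInt (dir_prod a b c (- th) N M) 0 T =
   (CInt (dir_prod a b c (- th) N M) 0 1 + CInt (dir_prod a b c (- th) N M) 1 T)%C).
{ symmetry. apply (RInt_Chasles (V := C_R_CompleteNormedModule)); apply X2; lra. }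
rewrite Ch.
set (I0 := CInt (dir_prod a b c (- th) N M) 0 1) in *. set (I1 := CInt (dir_prod a b c (- th) N M) 1 T) in *.
set (IF := CInt (zeta_triple a b c (- th)) 1 T) in *.
replace (IF - (I0 + I1))%C with (IF - I1 - I0)%C by ring.
eapply Rle_trans; [apply Cmod_minus_le|].
pose proof (ln_nonneg T HT) as HL.
assert (0 <= (2 * (2 * (Bb * Bc)) + 2 * (Bb * Bc)) * P * ln T) by (repeat apply Rmult_le_pos; lra).
assert (0 <= K1 * (Bb * Bc) * P) by (repeat apply Rmult_le_pos; lra).
lra.
Qed.

(** * Termwise integration: diagonal and oscillating terms *)

Definition triple_box (N M : nat) : list (nat * nat * nat) :=
  list_prod (list_prod (seq 1 N) (seq 1 M)) (seq 1 M).

(** The logarithm of n2^b n3^c / n1^a, which vanishes exactly on the solutions. *)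
Definition freq (a b c : R) (n : nat * nat * nat) : R :=
  let '(n1, n2, n3) := n in b * ln (INR n2) + c * ln (INR n3) - a * ln (INR n1).

Definition weight (a b c th : R) (n : nat * nat * nat) : R :=
  let '(n1, n2, n3) := n in
  Rpower (INR n1) (- (1 / 2 - a * th)) * Rpower (INR n2) (- (1 / 2 + b * th)) * Rpower (INR n3) (- (1 / 2 + c * th)).

Lemma dir_prod_expand a b c th N M t :
  dir_prod a b c (- th) N M t =
  csum (fun n => RtoC (weight a b c th n) * Cexp (Ci * RtoC (freq a b c n * t)))%C (triple_box N M).
Proof.
unfold dir_prod, dir_poly. rewrite csum_mult, csum_mult.
apply csum_ext. intros [[n1 n2] n3] _. cbn [fst snd]. rewrite !npow_pair. unfold weight, freq.
replace (1 / 2 + a * - th) with (1 / 2 - a * th) by ring.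
replace (1 / 2 + - b * - th) with (1 / 2 + b * th) by ring.
replace (1 / 2 + - c * - th) with (1 / 2 + c * th) by ring.
replace (Ci * RtoC ((b * ln (INR n2) + c * ln (INR n3) - a * ln (INR n1)) * t))%C with
  (Ci * RtoC (- (a * t) * ln (INR n1)) + (Ci * RtoC (- (- b * t) * ln (INR n2)) +
   Ci * RtoC (- (- c * t) * ln (INR n3))))%C.
2: { rewrite <- !Cmult_plus_distr_l, <- !RtoC_plus. do 2 f_equal. ring. }
rewrite !Cexp_plus, !RtoC_mult. ring.
Qed.

Lemma Cexp_i x : Cexp (Ci * RtoC x) = (cos x, sin x).
Proof.
unfold Cexp, Ci, RtoC, Cmult, Re, Im; simpl.
replace (0 * x - 1 * 0) with 0 by ring. rewrite exp_0.
replace (0 * 0 + 1 * x) with x by ring. f_equal; ring.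
Qed.

Lemma ex_osc lam T : 0 <= T -> ex_CInt (fun t => Cexp (Ci * RtoC (lam * t))) 0 T.
Proof. intros HT. apply Ccont_ex; [exact HT|]. intros; apply Cexp_line_cont. Qed.

Lemma osc_zero T : 0 <= T -> CInt (fun t => Cexp (Ci * RtoC (0 * t))) 0 T = RtoC T.
Proof.
intros HT. unfold CInt.
rewrite (RInt_ext (V := C_R_CompleteNormedModule) _ (fun _ => RtoC 1)).
2: { intros t _. rewrite Cexp_i, Rmult_0_l, cos_0, sin_0. reflexivity. }
rewrite (RInt_const (V := C_R_CompleteNormedModule)).
unfold scal; simpl. unfold prod_scal, scal, RtoC; simpl. unfold mult; simpl. f_equal; ring.
Qed.

Lemma osc_trivial lam T : 0 <= T -> Cmod (CInt (fun t => Cexp (Ci * RtoC (lam * t))) 0 T) <= T.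
Proof.
intros HT. replace T with ((T - 0) * 1) at 2 by ring.
apply Cmod_CInt_const; [exact HT | now apply ex_osc|]. intros t _. rewrite Cmod_Cexp.
unfold Ci, RtoC, Cmult, Re; simpl. replace (0 * (lam * t) - 1 * 0) with 0 by ring. rewrite exp_0; lra.
Qed.

Lemma osc_bound lam T : 0 <= T -> lam <> 0 ->
  Cmod (CInt (fun t => Cexp (Ci * RtoC (lam * t))) 0 T) <= 3 / Rabs lam.
Proof.
intros HT Hl.
assert (I1 : is_RInt (V := R_NormedModule) (fun t => cos (lam * t)) 0 T (sin (lam * T) / lam)).
{ replace (sin (lam * T) / lam) with (minus (G := R_AbelianGroup) (sin (lam * T) / lam) (sin (lam * 0) / lam)).
  2: { rewrite Rmult_0_r, sin_0. unfold minus, plus, opp; simpl. field; exact Hl. }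
  apply (is_RInt_derive (V := R_CompleteNormedModule) (fun t => sin (lam * t) / lam)).
  - intros x _. auto_derive; [trivial | field; exact Hl].
  - intros x _. apply (ex_derive_continuous (V := R_NormedModule)). auto_derive; trivial. }
assert (I2 : is_RInt (V := R_NormedModule) (fun t => sin (lam * t)) 0 T ((1 - cos (lam * T)) / lam)).
{ replace ((1 - cos (lam * T)) / lam) with (minus (G := R_AbelianGroup) (- cos (lam * T) / lam) (- cos (lam * 0) / lam)).
  2: { rewrite Rmult_0_r, cos_0. unfold minus, plus, opp; simpl. field; exact Hl. }
  apply (is_RInt_derive (V := R_CompleteNormedModule) (fun t => - cos (lam * t) / lam)).
  - intros x _. auto_derive; [trivial | field; exact Hl].
  - intros x _. apply (ex_derive_continuous (V := R_NormedModule)). auto_derive; trivial. }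
assert (I : CInt (fun t => Cexp (Ci * RtoC (lam * t))) 0 T = (sin (lam * T) / lam, (1 - cos (lam * T)) / lam)).
{ unfold CInt. apply (is_RInt_unique (V := C_R_CompleteNormedModule)).
  apply (is_RInt_ext (V := C_R_NormedModule) (fun t => (cos (lam * t), sin (lam * t)))).
  { intros t _. rewrite Cexp_i. reflexivity. }
  exact (is_RInt_fct_extend_pair (U := R_NormedModule) (V := R_NormedModule)
    (fun t => (cos (lam * t), sin (lam * t))) 0 T _ _ I1 I2). }
rewrite I. eapply Rle_trans; [apply Cmod_le_sum|].
unfold Rdiv. rewrite !Rabs_mult, !Rabs_inv.
assert (P : 0 < / Rabs lam) by (apply Rinv_0_lt_compat, Rabs_pos_lt; exact Hl).
assert (Rabs (sin (lam * T)) <= 1) by (apply Rabs_le; pose proof (SIN_bound (lam * T)); lra).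
assert (Rabs (1 - cos (lam * T)) <= 2) by (apply Rabs_le; pose proof (COS_bound (lam * T)); lra).
nra.
Qed.

Definition sol_b (a b c : nat) (n : nat * nat * nat) : bool :=
  let '(n1, n2, n3) := n in Nat.eqb (n1 ^ a) (n2 ^ b * n3 ^ c).

Lemma in_triple_box N M n1 n2 n3 : In (n1, n2, n3) (triple_box N M) <->
  (1 <= n1 <= N)%nat /\ (1 <= n2 <= M)%nat /\ (1 <= n3 <= M)%nat.
Proof. unfold triple_box. rewrite !in_prod_iff, !in_seq. lia. Qed.

Lemma ln_INR_pow n k : (1 <= n)%nat -> ln (INR (n ^ k)) = INR k * ln (INR n).
Proof.
intros Hn. apply INR_ge1 in Hn. rewrite pow_INR, ln_pow by lra. reflexivity.
Qed.

Lemma freq_ln a b c n1 n2 n3 : (1 <= n1)%nat -> (1 <= n2)%nat -> (1 <= n3)%nat ->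
  freq (INR a) (INR b) (INR c) (n1, n2, n3) = ln (INR (n2 ^ b * n3 ^ c)) - ln (INR (n1 ^ a)).
Proof.
intros H1 H2 H3. unfold freq. rewrite mult_INR, ln_mult, !ln_INR_pow; auto.
- apply Rlt_le_trans with 1; [lra|]. apply INR_ge1, Nat.neq_0_lt_0, Nat.pow_nonzero; lia.
- apply Rlt_le_trans with 1; [lra|]. apply INR_ge1, Nat.neq_0_lt_0, Nat.pow_nonzero; lia.
Qed.

Lemma pow_ge1_nat n k : (1 <= n)%nat -> (1 <= n ^ k)%nat.
Proof. intros; apply Nat.neq_0_lt_0, Nat.pow_nonzero; lia. Qed.

Lemma freq_zero a b c n1 n2 n3 : (1 <= n1)%nat -> (1 <= n2)%nat -> (1 <= n3)%nat ->
  freq (INR a) (INR b) (INR c) (n1, n2, n3) = 0 <-> (n1 ^ a = n2 ^ b * n3 ^ c)%nat.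
Proof.
intros H1 H2 H3. rewrite freq_ln by assumption.
pose proof (pow_ge1_nat n1 a H1) as P1. pose proof (pow_ge1_nat n2 b H2) as P2.
pose proof (pow_ge1_nat n3 c H3) as P3.
assert (P4 : (1 <= n2 ^ b * n3 ^ c)%nat) by nia.
split.
- intros E. apply INR_eq. apply ln_inv; [| | lra];
   (apply Rlt_le_trans with 1; [lra | now apply INR_ge1]).
- intros ->. ring.
Qed.

(* On solutions the factor (n1^a / (n2^b n3^c))^th equals 1. *)
Lemma weight_sol a b c th n1 n2 n3 : (1 <= n1)%nat -> (1 <= n2)%nat -> (1 <= n3)%nat ->
  (n1 ^ a = n2 ^ b * n3 ^ c)%nat ->
  weight (INR a) (INR b) (INR c) th (n1, n2, n3) = sigma_term (n1, n2, n3).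
Proof.
intros H1 H2 H3 E. apply freq_zero in E; auto. unfold freq in E. unfold weight, sigma_term.
apply INR_ge1 in H1. apply INR_ge1 in H2. apply INR_ge1 in H3.
unfold Rpower. rewrite <- !exp_plus, !ln_mult by nra. f_equal.
transitivity (- (1 / 2) * (ln (INR n1) + ln (INR n2) + ln (INR n3)) -
   th * (INR b * ln (INR n2) + INR c * ln (INR n3) - INR a * ln (INR n1))); [ring|].
rewrite E. ring.
Qed.

Definition diag_sum (a b c : nat) (N M : nat) : R :=
  lsum sigma_term (filter (sol_b a b c) (triple_box N M)).

Definition off_sum (a b c : nat) (th : R) (N M : nat) (T : R) : R :=
  lsum (fun n => if sol_b a b c n then 0 else
     weight (INR a) (INR b) (INR c) th n * Rmin T (3 / Rabs (freq (INR a) (INR b) (INR c) n)))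
   (triple_box N M).

Lemma weight_pos a b c th n : 0 < weight a b c th n.
Proof. destruct n as [[n1 n2] n3]. unfold weight. repeat apply Rmult_lt_0_compat; apply Rpower_pos. Qed.

Lemma dir_prod_integral a b c th N M T : 0 <= T ->
  Cmod (CInt (dir_prod (INR a) (INR b) (INR c) (- th) N M) 0 T - RtoC (diag_sum a b c N M * T))
   <= off_sum a b c th N M T.
Proof.
intros HT.
set (w := weight (INR a) (INR b) (INR c) th). set (f := freq (INR a) (INR b) (INR c)).
assert (E : CInt (dir_prod (INR a) (INR b) (INR c) (- th) N M) 0 T =
  csum (fun n => RtoC (w n) * CInt (fun t => Cexp (Ci * RtoC (f n * t))) 0 T)%C (triple_box N M)).
{ unfold CInt at 1. rewrite (RInt_ext (V := C_R_CompleteNormedModule) _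
    (fun t => csum (fun n => RtoC (w n) * Cexp (Ci * RtoC (f n * t)))%C (triple_box N M))).
  2: { intros t _. apply dir_prod_expand. }
  destruct (CInt_csum (fun n t => RtoC (w n) * Cexp (Ci * RtoC (f n * t)))%C (triple_box N M) 0 T) as [_ E].
  { intros n _. apply ex_CInt_scal, ex_osc, HT. }
  unfold CInt in E at 1. rewrite E. apply csum_ext. intros n _. apply CInt_scal, ex_osc, HT. }
rewrite E. unfold diag_sum, off_sum. fold w f. rewrite lsum_filter.
assert (E2 : RtoC (lsum (fun x => if sol_b a b c x then sigma_term x else 0) (triple_box N M) * T)
   = csum (fun n => RtoC ((if sol_b a b c n then sigma_term n else 0) * T)) (triple_box N M)).
{ generalize (triple_box N M). intros l. induction l as [|n l IH].
  - unfold lsum, csum; simpl. f_equal; ring.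
  - rewrite lsum_cons, csum_cons, <- IH, <- RtoC_plus. f_equal. ring. }
rewrite E2.
replace (csum (fun n => RtoC (w n) * CInt (fun t => Cexp (Ci * RtoC (f n * t))) 0 T) (triple_box N M) -
   csum (fun n => RtoC ((if sol_b a b c n then sigma_term n else 0) * T)) (triple_box N M))%C with
  (csum (fun n => RtoC (w n) * CInt (fun t => Cexp (Ci * RtoC (f n * t))) 0 T +
     (- (1)) * RtoC ((if sol_b a b c n then sigma_term n else 0) * T))%C (triple_box N M))
  by (rewrite csum_plus, csum_scal; ring).
apply Cmod_csum_le. intros [[n1 n2] n3] Hn. apply in_triple_box in Hn.
destruct Hn as [H1 [H2 H3]].
pose proof (freq_zero a b c n1 n2 n3 ltac:(lia) ltac:(lia) ltac:(lia)) as Z. fold f in Z.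
destruct (sol_b a b c (n1, n2, n3)) eqn:Es; unfold sol_b in Es.
- apply Nat.eqb_eq in Es. rewrite (proj2 Z Es), osc_zero by exact HT.
  unfold w. rewrite weight_sol by (auto; lia).
  rewrite RtoC_mult. match goal with |- Cmod ?z <= 0 => replace z with (RtoC 0) by ring end.
  rewrite Cmod_0; lra.
- apply Nat.eqb_neq in Es.
  replace (_ + _)%C with (RtoC (w (n1, n2, n3)) * CInt (fun t => Cexp (Ci * RtoC (f (n1, n2, n3) * t))) 0 T)%C
    by (rewrite Rmult_0_l; ring).
  rewrite Cmod_mult, Cmod_R, Rabs_pos_eq by (left; apply weight_pos).
  apply Rmult_le_compat_l; [left; apply weight_pos|].
  apply Rmin_glb; [now apply osc_trivial|]. apply osc_bound; [exact HT|].
  intros E0; apply Es, Z, E0.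
Qed.

Lemma I_abc_zeta_triple a b c T : I_abc a b c T = CInt (zeta_triple a b c 0) 0 T.
Proof.
unfold I_abc, CInt. apply (RInt_ext (V := C_R_CompleteNormedModule)). intros t _.
unfold zeta_triple, zeta_line. f_equal; [f_equal|]; f_equal; unfold RtoC, Ci, Cminus, Cplus, Cmult, Copp; simpl; f_equal; ring.
Qed.

(** Assembles the line shift and the approximation above height 1, away from the real poles; the
    piece over [0,1] is a constant absorbed by T^(3/4) >= 1. *)
Lemma mean_value a b c th : (2 <= a)%nat -> (a < c)%nat -> (c <= b)%nat -> 0 < th ->
  INR a * th < 1 / 2 -> 1 / 2 < INR c * th ->
  exists K H, 0 < K /\ 1 <= H /\ forall T, 1 <= T ->
  exists N, (1 <= N)%nat /\ T <= INR N <= H * T /\ exists M0, forall M, (M0 <= M)%nat ->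
   Cmod (I_abc (INR a) (INR b) (INR c) T - RtoC (diag_sum a b c N M * T)) <=
     K * (Rpower T (3 / 4) + Rpower T (1 / 2 + INR a * th) * (1 + ln T)) + off_sum a b c th N M T.
Proof.
intros Ha Hac Hcb Hth Hat Hct.
apply le_INR in Ha as Ha'. simpl (INR 2) in Ha'. apply lt_INR in Hac as Hac'. apply le_INR in Hcb as Hcb'.
set (ra := INR a) in *. set (rb := INR b) in *. set (rc := INR c) in *.
assert (Hat0 : 0 < ra * th) by (apply Rmult_lt_0_compat; lra).
destruct (line_shift ra rb rc th ltac:(lra) Hac' Hcb' Hth Hat) as [K1 [HK1 L1]].
destruct (dirichlet_line ra rb rc th ltac:(lra) Hac' Hcb' Hth Hat Hct) as [K2 [HK2 L2]].
set (H := 10 * (1 + ra) + 1).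
assert (HH : 1 <= H) by (unfold H; lra).
set (K0 := Cmod (CInt (zeta_triple ra rb rc 0) 0 1)).
assert (HK0 : 0 <= K0) by apply Cmod_ge_0.
exists (K0 + K1 + K2 * H), H.
assert (HK2H : 0 < K2 * H) by (apply Rmult_lt_0_compat; lra).
split; [lra|]. split; [exact HH|].
intros T HT. destruct (exists_nat_above (10 * (1 / 2 + ra * th + ra * T))) as [N [HN1 [HN2 HN3]]]; [nra|].
assert (HNT : INR N <= H * T) by (unfold H; nra).
exists N. split; [exact HN1|]. split; [split; [nra | exact HNT]|].
destruct (L2 T N HT HN1 HN2) as [M0 HM0]. exists M0. intros M HM. specialize (HM0 M HM).
specialize (L1 T HT).
pose proof (dir_prod_integral a b c th N M T ltac:(lra)) as D. fold ra rb rc in D.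
rewrite I_abc_zeta_triple.
assert (X : forall u v, u <= v -> ex_CInt (zeta_triple ra rb rc 0) u v).
{ intros u v Huv. apply Ccont_ex; [exact Huv|]. intros t _. apply zeta_triple_cont; lra. }
assert (Ch : CInt (zeta_triple ra rb rc 0) 0 T = (CInt (zeta_triple ra rb rc 0) 0 1 + CInt (zeta_triple ra rb rc 0) 1 T)%C).
{ symmetry. apply (RInt_Chasles (V := C_R_CompleteNormedModule)); apply X; lra. }
rewrite Ch.
set (I0 := CInt (zeta_triple ra rb rc 0) 0 1) in *. set (I1 := CInt (zeta_triple ra rb rc 0) 1 T) in *.
set (I2 := CInt (zeta_triple ra rb rc (- th)) 1 T) in *. set (I3 := CInt (dir_prod ra rb rc (- th) N M) 0 T) in *.
replace (I0 + I1 - RtoC (diag_sum a b c N M * T))%C with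
  (I0 + ((I1 - I2) + ((I2 - I3) + (I3 - RtoC (diag_sum a b c N M * T)))))%C by ring.
eapply Rle_trans; [apply Cmod_triangle|]. fold K0.
eapply Rle_trans; [apply Rplus_le_compat_l, Cmod_triangle|].
eapply Rle_trans; [apply Rplus_le_compat_l, Rplus_le_compat_l, Cmod_triangle|].
assert (P1 : 1 <= Rpower T (3 / 4)) by (apply Rpower_ge1; lra).
pose proof (ln_nonneg T HT) as HL.
assert (P2 : Rpower (INR N) (1 / 2 + ra * th) <= H * Rpower T (1 / 2 + ra * th)).
{ apply Rle_trans with (Rpower (H * T) (1 / 2 + ra * th)).
  - apply Rpower_le_l; [|lra]. assert (1 <= INR N) by (now apply INR_ge1). lra.
  - rewrite <- Rpower_mult_distr by lra. apply Rmult_le_compat_r; [left; apply Rpower_pos|].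
    rewrite <- (Rpower_1 H) at 2 by lra. apply Rpower_le_r; lra. }
pose proof (Rpower_pos T (1 / 2 + ra * th)) as P3.
set (Q := Rpower T (1 / 2 + ra * th)) in *.
assert (P4 : K2 * (Rpower (INR N) (1 / 2 + ra * th) * (1 + ln T)) <= K2 * H * (Q * (1 + ln T))).
{ rewrite Rmult_assoc. apply Rmult_le_compat_l; [lra|]. rewrite <- Rmult_assoc.
  apply Rmult_le_compat_r; [lra | exact P2]. }
assert (P5 : 0 <= Q * (1 + ln T)) by (apply Rmult_le_pos; lra).
assert (0 <= (K0 + K1) * (Q * (1 + ln T))) by (apply Rmult_le_pos; lra).
assert (0 <= K2 * H * Rpower T (3 / 4)) by (apply Rmult_le_pos; lra).
assert (K0 <= K0 * Rpower T (3 / 4)) by nra.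
lra.
Qed.

(** * The off-diagonal sum *)

Lemma ln_gap u v : 0 < v < u -> (u - v) / u <= ln u - ln v.
Proof.
intros H. pose proof (exp_ineq1_le (ln (v / u))) as E.
assert (0 < v / u) by (apply Rdiv_lt_0_compat; lra).
rewrite exp_ln, ln_div in E by lra.
replace ((u - v) / u) with (1 - v / u) by (field; lra). lra.
Qed.

Lemma ln_gap_abs u v M : 0 < u <= M -> 0 < v <= M -> Rabs (u - v) <= M * Rabs (ln u - ln v).
Proof.
intros Hu Hv. 
assert (G : forall u v, 0 < u <= M -> 0 < v <= M -> v < u -> Rabs (u - v) <= M * Rabs (ln u - ln v)).
{ clear. intros u v Hu Hv H. pose proof (ln_gap u v ltac:(lra)) as G.
  assert (0 < (u - v) / u) by (apply Rdiv_lt_0_compat; lra).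
  rewrite !Rabs_pos_eq by lra.
  replace (u - v) with (u * ((u - v) / u)) by (field; lra).
  apply Rmult_le_compat; lra. }
destruct (Rtotal_order u v) as [H|[H|H]].
- rewrite (Rabs_minus_sym u), (Rabs_minus_sym (ln u)). now apply G.
- subst. rewrite !Rminus_diag, Rabs_R0. lra.
- now apply G.
Qed.

(** The logarithmic gap gives max(n, x)/|n - x|, and for x > n this quotient is 1 + n/|n - x|.
    Having n alone in the numerator makes the sum over n uniform in x. *)
Lemma ln_gap_shift (n x : R) : 0 < n -> 0 < x -> 1 <= Rabs (n - x) ->
  / Rabs (ln x - ln n) <= 1 + n / Rabs (n - x).
Proof.
intros Hn Hx H.
assert (Hd : n <> x) by (intros ->; rewrite Rminus_diag, Rabs_R0 in H; lra).
assert (HL : ln x <> ln n) by (intros E; apply Hd; symmetry; now apply ln_inv).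
assert (P : 0 < Rabs (ln x - ln n)) by (apply Rabs_pos_lt; lra).
destruct (Rle_dec x n).
- pose proof (ln_gap_abs n x n ltac:(lra) ltac:(lra)) as G.
  rewrite (Rabs_minus_sym (ln n)) in G.
  apply Rle_trans with (n / Rabs (n - x)); [|lra].
  apply Rmult_le_reg_r with (Rabs (ln x - ln n)); [exact P|]. rewrite Rinv_l by lra.
  apply Rmult_le_reg_r with (Rabs (n - x)); [lra|]. unfold Rdiv.
  replace (n * / Rabs (n - x) * Rabs (ln x - ln n) * Rabs (n - x)) with
    (n * Rabs (ln x - ln n)) by (field; lra). lra.
- pose proof (ln_gap_abs n x x ltac:(lra) ltac:(lra)) as G.
  rewrite (Rabs_minus_sym (ln n)) in G.
  replace (1 + n / Rabs (n - x)) with (x / Rabs (n - x)).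
  2: { rewrite Rabs_left by lra. field. lra. }
  apply Rmult_le_reg_r with (Rabs (ln x - ln n)); [exact P|]. rewrite Rinv_l by lra.
  apply Rmult_le_reg_r with (Rabs (n - x)); [lra|]. unfold Rdiv.
  replace (x * / Rabs (n - x) * Rabs (ln x - ln n) * Rabs (n - x)) with
    (x * Rabs (ln x - ln n)) by (field; lra). lra.
Qed.

Definition harmonic (N : nat) : R := lsum (fun n => / INR n) (seq 1 N).

Lemma harmonic_S N : harmonic (S N) = harmonic N + / INR (S N).
Proof. unfold harmonic. rewrite lsum_seq_S. reflexivity. Qed.

Lemma harmonic_le n m : (n <= m)%nat -> harmonic n <= harmonic m.
Proof.
intros H. unfold harmonic. apply lsum_incl; [apply seq_NoDup | |].
- intros x Hx. apply in_seq in Hx. apply in_seq. lia.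
- intros x Hx. apply in_seq in Hx. left. apply Rinv_0_lt_compat. 
  apply Rlt_le_trans with 1; [lra | apply INR_ge1; lia].
Qed.

Lemma sum_right_of k N : lsum (fun n => if (k <? n)%nat then / INR (n - k) else 0) (seq 1 N) = harmonic (N - k).
Proof.
induction N as [|N IH]; [reflexivity|].
rewrite lsum_seq_S, IH. simpl (1 + N)%nat. destruct (Nat.ltb_spec k (S N)).
- replace (S N - k)%nat with (S (N - k)) by lia. rewrite harmonic_S. reflexivity.
- replace (S N - k)%nat with 0%nat by lia. replace (N - k)%nat with 0%nat by lia. ring.
Qed.

Lemma sum_left_of k N : (k <= N)%nat ->
  lsum (fun n => if (n <=? k)%nat then / INR (k + 1 - n) else 0) (seq 1 N) = harmonic k.
Proof.
intros HkN.
assert (E : forall i, (i <= k)%nat ->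
   lsum (fun n => if (n <=? k)%nat then / INR (k + 1 - n) else 0) (seq 1 i) + harmonic (k - i) = harmonic k).
{ induction i as [|i IH]; intros Hi.
  - rewrite Nat.sub_0_r. unfold lsum; simpl; ring.
  - rewrite lsum_seq_S. simpl (1 + i)%nat. destruct (Nat.leb_spec (S i) k); [|lia].
    rewrite <- IH by lia. replace (k - i)%nat with (S (k - S i)) at 1 by lia.
    rewrite harmonic_S. replace (k + 1 - S i)%nat with (S (k - S i)) by lia. ring. }
assert (F : forall j, lsum (fun n => if (n <=? k)%nat then / INR (k + 1 - n) else 0) (seq (1 + k) j) = 0).
{ induction j as [|j IH]; [reflexivity|]. rewrite lsum_seq_S, IH.
  destruct (Nat.leb_spec (1 + k + j) k); [lia | ring]. }
replace N with (k + (N - k))%nat by lia. rewrite seq_app, lsum_app, F, <- (E k) by lia.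
rewrite Nat.sub_diag. unfold harmonic, lsum; simpl. ring.
Qed.

(** Distances to x that are at least 1 are at least half of n - k on the right of k = floor x and
    half of k + 1 - n on the left, so two harmonic sums with factor 2 suffice. *)
Lemma sum_inv_dist x N : 0 <= x ->
  lsum (fun n => if Rle_dec 1 (Rabs (INR n - x)) then / Rabs (INR n - x) else 0) (seq 1 N)
   <= 4 * (1 + ln (INR N)).
Proof.
intros Hx. destruct (nfloor_ex x Hx) as [k0 [Hk1 Hk2]].
(* When x lies beyond N, every n is on the left. *)
set (k := Nat.min k0 N).
apply Rle_trans with (lsum (fun n => 2 * (if (k <? n)%nat then / INR (n - k) else 0)
   + 2 * (if (n <=? k)%nat then / INR (k + 1 - n) else 0)) (seq 1 N)).
- apply lsum_le. intros n Hn. apply in_seq in Hn.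
  destruct (Rle_dec 1 (Rabs (INR n - x))) as [H|H].
  + destruct (Nat.leb_spec n k) as [L|L].
    * destruct (Nat.ltb_spec k n); [lia|].
      rewrite Rmult_0_r, Rplus_0_l.
      assert (Hn0 : INR n <= INR k0) by (apply le_INR; lia).
      rewrite Rabs_left1 in H |- * by lra.
      assert (Hkk : INR k <= INR k0) by (apply le_INR; lia).
      rewrite minus_INR, plus_INR by lia. simpl (INR 1).
      assert (INR n <= INR k) by (now apply le_INR).
      apply Rmult_le_reg_r with (INR k + 1 - INR n); [lra|].
      rewrite (Rmult_assoc 2), Rinv_l, Rmult_1_r by lra.
      apply Rmult_le_reg_l with (- (INR n - x)); [lra|].
      rewrite <- Rmult_assoc, Rinv_r by lra. lra.
    * destruct (Nat.ltb_spec k n); [|lia]. rewrite Rmult_0_r, Rplus_0_r.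
      assert (Ek : k = k0) by lia. rewrite <- Ek in Hk1, Hk2.
      assert (Hn0 : INR k + 1 <= INR n) by (rewrite <- S_INR; apply le_INR; lia).
      rewrite Rabs_pos_eq in H |- * by lra. rewrite minus_INR by lia.
      apply Rmult_le_reg_r with (INR n - INR k); [lra|].
      rewrite (Rmult_assoc 2), Rinv_l, Rmult_1_r by lra.
      apply Rmult_le_reg_l with (INR n - x); [lra|].
      rewrite <- Rmult_assoc, Rinv_r by lra. lra.
  + assert (P : forall m, 0 <= / INR m) by (intros [|m]; [simpl; rewrite Rinv_0; lra |
      left; apply Rinv_0_lt_compat; pose proof (INR_S_ge1 m); lra]).
    pose proof (P (n - k)%nat). pose proof (P (k + 1 - n)%nat).
    destruct (k <? n)%nat, (n <=? k)%nat; lra.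
- rewrite lsum_plus, !lsum_scal, sum_right_of, sum_left_of by lia.
  pose proof (harmonic_le (N - k) N ltac:(lia)). pose proof (harmonic_le k N ltac:(lia)).
  pose proof (sum_harmonic N) as S. fold (harmonic N) in S. lra.
Qed.

Lemma sum_near x N V : 0 <= x -> 0 <= V ->
  lsum (fun n => if Rle_dec 1 (Rabs (INR n - x)) then 0 else V) (seq 1 N) <= 2 * V.
Proof.
intros Hx HV. destruct (nfloor_ex x Hx) as [k [Hk1 Hk2]].
set (P := fun n => if Rle_dec 1 (Rabs (INR n - x)) then false else true).
rewrite (lsum_ext _ (fun n => if P n then V else 0)).
2: { intros n _. unfold P. destruct (Rle_dec _ _); reflexivity. }
rewrite <- (lsum_filter P (fun _ => V)).
apply Rle_trans with (lsum (fun _ => V) (k :: S k :: nil)).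
- apply lsum_incl; [apply NoDup_filter, seq_NoDup | | intros; exact HV].
  intros n Hn. apply filter_In in Hn. destruct Hn as [_ Hn]. unfold P in Hn.
  destruct (Rle_dec _ _) as [H|H]; [discriminate|].
  apply Rnot_le_lt in H. apply Rabs_lt_between in H.
  assert (H1 : INR n < INR (S (S k))) by (rewrite !S_INR; lra). apply INR_lt in H1.
  assert (H2 : INR k < INR (S n)) by (rewrite S_INR; lra). apply INR_lt in H2.
  assert (n = k \/ n = S k) by lia. simpl. intuition.
- unfold lsum; simpl. lra.
Qed.

Definition bc_prod (b c n2 n3 : nat) : nat := (n2 ^ b * n3 ^ c)%nat.
Definition bc_root (a b c n2 n3 : nat) : R := Rpower (INR (bc_prod b c n2 n3)) (/ INR a).
(** This is (n2 n3 x)^(-1/2) with x = [bc_root]; on solutions it coincides with [sigma_term]. *)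
Definition pair_weight (a b c : nat) (n : nat * nat) : R :=
  Rpower (INR (fst n)) (- (1 / 2 + INR b / (2 * INR a))) *
  Rpower (INR (snd n)) (- (1 / 2 + INR c / (2 * INR a))).
Definition pair_box (M : nat) : list (nat * nat) := list_prod (seq 1 M) (seq 1 M).

Lemma bc_prod_ge1 b c n2 n3 : (1 <= n2)%nat -> (1 <= n3)%nat -> 1 <= INR (bc_prod b c n2 n3).
Proof.
intros H2 H3. apply INR_ge1. unfold bc_prod. pose proof (pow_ge1_nat n2 b H2). pose proof (pow_ge1_nat n3 c H3). nia.
Qed.

Lemma ln_bc_prod b c n2 n3 : (1 <= n2)%nat -> (1 <= n3)%nat ->
  ln (INR (bc_prod b c n2 n3)) = INR b * ln (INR n2) + INR c * ln (INR n3).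
Proof.
intros H2 H3. unfold bc_prod. rewrite mult_INR, ln_mult, !ln_INR_pow; auto;
  (apply Rlt_le_trans with 1; [lra | apply INR_ge1, pow_ge1_nat; assumption]).
Qed.

Lemma ln_bc_root a b c n2 n3 : (1 <= n2)%nat -> (1 <= n3)%nat ->
  ln (bc_root a b c n2 n3) = (INR b * ln (INR n2) + INR c * ln (INR n3)) / INR a.
Proof.
intros H2 H3. unfold bc_root. unfold Rpower. rewrite ln_exp, ln_bc_prod by assumption. unfold Rdiv; ring.
Qed.

Lemma bc_root_ge1 a b c n2 n3 : (1 <= a)%nat -> (1 <= n2)%nat -> (1 <= n3)%nat -> 1 <= bc_root a b c n2 n3.
Proof.
intros Ha H2 H3. unfold bc_root. apply Rpower_ge1; [now apply bc_prod_ge1|].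
left; apply Rinv_0_lt_compat. apply Rlt_le_trans with 1; [lra | now apply INR_ge1].
Qed.

Lemma bc_root_pow a b c n2 n3 : (1 <= a)%nat -> (1 <= n2)%nat -> (1 <= n3)%nat ->
  bc_root a b c n2 n3 ^ a = INR (bc_prod b c n2 n3).
Proof.
intros Ha H2 H3. pose proof (bc_prod_ge1 b c n2 n3 H2 H3). apply INR_ge1 in Ha.
unfold bc_root. rewrite <- Rpower_pow by apply Rpower_pos. rewrite Rpower_mult, Rinv_l, Rpower_1; lra.
Qed.

(* Cancellation n1^(a th) ~ (n2^b n3^c)^th near the diagonal removes th. *)
Lemma weight_near a b c th n1 n2 n3 : (1 <= a)%nat -> (1 <= n1)%nat -> (1 <= n2)%nat -> (1 <= n3)%nat ->
  0 <= 1 / 2 - INR a * th <= 1 -> bc_root a b c n2 n3 <= 2 * INR n1 ->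
  weight (INR a) (INR b) (INR c) th (n1, n2, n3) <= 2 * pair_weight a b c (n2, n3).
Proof.
intros Ha H1 H2 H3 Hth Hx. pose proof (bc_root_ge1 a b c n2 n3 Ha H2 H3) as Hx1.
pose proof (ln_bc_root a b c n2 n3 H2 H3) as Lx.
apply INR_ge1 in Ha. apply INR_ge1 in H1. apply INR_ge1 in H2. apply INR_ge1 in H3.
set (p := 1 / 2 - INR a * th) in *. unfold weight, pair_weight; cbn [fst snd]. fold p.
assert (B : Rpower (INR n1) (- p) <= 2 * Rpower (bc_root a b c n2 n3) (- p)).
{ apply Rle_trans with (Rpower (bc_root a b c n2 n3 * / 2) (- p)); [apply Rpower_le_neg; lra|].
  rewrite <- Rpower_mult_distr by lra. rewrite Rmult_comm. apply Rmult_le_compat_r; [left; apply Rpower_pos|].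
  unfold Rpower. rewrite ln_Rinv by lra. replace (- p * - ln 2) with (p * ln 2) by ring.
  rewrite <- (exp_ln 2) at 2 by lra. apply exp_le. pose proof (ln_nonneg 2 ltac:(lra)). nra. }
apply Rle_trans with (2 * Rpower (bc_root a b c n2 n3) (- p) * Rpower (INR n2) (- (1 / 2 + INR b * th)) *
   Rpower (INR n3) (- (1 / 2 + INR c * th))).
- repeat (apply Rmult_le_compat_r; [left; apply Rpower_pos|]). exact B.
- right. rewrite !Rmult_assoc. f_equal. unfold Rpower. rewrite Lx, <- !exp_plus. f_equal.
  unfold p. field. lra.
Qed.

Lemma lsum_triple (f : nat * nat * nat -> R) N M :
  lsum f (triple_box N M) = lsum (fun q => lsum (fun n1 => f (n1, fst q, snd q)) (seq 1 N)) (pair_box M).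
Proof.
unfold triple_box, pair_box. rewrite lsum_prod, lsum_prod.
rewrite (lsum_swap (fun q n1 => f (n1, fst q, snd q))). apply lsum_ext. intros n1 _.
rewrite lsum_prod. reflexivity.
Qed.

Lemma in_pair_box M n2 n3 : In (n2, n3) (pair_box M) <-> (1 <= n2 <= M)%nat /\ (1 <= n3 <= M)%nat.
Proof. unfold pair_box. rewrite in_prod_iff, !in_seq. lia. Qed.

Lemma pair_sum_product u v M : 1 < u -> 1 < v ->
  lsum (fun q => Rpower (INR (fst q)) (- u) * Rpower (INR (snd q)) (- v)) (pair_box M)
   <= u / (u - 1) * (v / (v - 1)).
Proof.
intros Hu Hv. unfold pair_box. rewrite lsum_prod. cbn [fst snd].
rewrite (lsum_ext _ (fun n => Rpower (INR n) (- u) * lsum (fun n => Rpower (INR n) (- v)) (seq 1 M)))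
  by (intros; apply lsum_scal).
rewrite lsum_scal_r.
pose proof (sum_power_tail u 1 M Hu (le_n 1)) as S1. pose proof (sum_power_tail v 1 M Hv (le_n 1)) as S2.
simpl (INR 1) in *. rewrite Rpower_base1, Rmult_1_r in *.
apply Rmult_le_compat; auto; apply lsum_nonneg; intros; left; apply Rpower_pos.
Qed.

(* Y is a bound for 1/|freq| on the nonsolutions with |n1 - (n2^b n3^c)^(1/a)| < 1:
   trivially n2^b n3^c, under Conjecture W only (n2^b n3^c)^((1+eps)/a) n2 n3.
   The condition bc_root <= Y serves the tail of the diagonal sum. *)
Definition admissible (a b c : nat) (Y : nat * nat -> R) (CY : R) : Prop :=
  1 <= CY /\
  (forall n2 n3, (1 <= n2)%nat -> (1 <= n3)%nat -> bc_root a b c n2 n3 <= Y (n2, n3)) /\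
  forall n1 n2 n3, (1 <= n1)%nat -> (1 <= n2)%nat -> (1 <= n3)%nat ->
  (n1 ^ a <> bc_prod b c n2 n3)%nat -> Rabs (INR n1 - bc_root a b c n2 n3) < 1 ->
  3 / Rabs (freq (INR a) (INR b) (INR c) (n1, n2, n3)) <= CY * Y (n2, n3).

Lemma Rmin_scal T y k : 0 <= T -> 1 <= k -> Rmin T (k * y) <= k * Rmin T y.
Proof. intros HT Hk. unfold Rmin. repeat destruct (Rle_dec _ _); nra. Qed.

(** Far from x, [ln_gap_shift] is combined with n1^(1/2 + a th) <= N^(1/2 + a th); near x,
    [weight_near] is combined with admissibility. One inequality for both keeps the sum over n1 in a
    single pass. *)
Lemma off_term a b c th Y CY n1 n2 n3 N T : (1 <= a)%nat -> 0 < INR a * th < 1 / 2 -> 0 <= T ->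
  admissible a b c Y CY -> (1 <= n1 <= N)%nat -> (1 <= n2)%nat -> (1 <= n3)%nat ->
  (if sol_b a b c (n1, n2, n3) then 0 else
     weight (INR a) (INR b) (INR c) th (n1, n2, n3) *
       Rmin T (3 / Rabs (freq (INR a) (INR b) (INR c) (n1, n2, n3)))) <=
  Rpower (INR n2) (- (1 / 2 + INR b * th)) * Rpower (INR n3) (- (1 / 2 + INR c * th)) *
   (3 * Rpower (INR n1) (- (1 / 2 - INR a * th)) + 3 * Rpower (INR N) (1 / 2 + INR a * th) *
     (if Rle_dec 1 (Rabs (INR n1 - bc_root a b c n2 n3)) then / Rabs (INR n1 - bc_root a b c n2 n3) else 0))
   + (if Rle_dec 1 (Rabs (INR n1 - bc_root a b c n2 n3)) then 0 else
        2 * CY * (pair_weight a b c (n2, n3) * Rmin T (Y (n2, n3)))).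
Proof.
intros Ha Hth HT [HCY [HxY HY]] [H1 H1N] H2 H3.
pose proof (bc_root_ge1 a b c n2 n3 Ha H2 H3) as Hx.
set (V := Rpower (INR n2) (- (1 / 2 + INR b * th)) * Rpower (INR n3) (- (1 / 2 + INR c * th))).
assert (HV : 0 < V) by (apply Rmult_lt_0_compat; apply Rpower_pos).
pose proof (Rpower_pos (INR n1) (- (1 / 2 - INR a * th))) as P1.
pose proof (Rpower_pos (INR N) (1 / 2 + INR a * th)) as PN.
assert (Hpw : 0 < pair_weight a b c (n2, n3)) by (apply Rmult_lt_0_compat; apply Rpower_pos).
assert (HY0 : 0 <= Rmin T (Y (n2, n3))).
{ apply Rmin_glb; [exact HT|]. specialize (HxY n2 n3 H2 H3). lra. }
assert (HR : 0 <= 2 * CY * (pair_weight a b c (n2, n3) * Rmin T (Y (n2, n3)))).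
{ apply Rmult_le_pos; [lra|]. apply Rmult_le_pos; lra. }
assert (HnN : INR n1 <= INR N) by (now apply le_INR).
assert (Hn1 := INR_ge1 n1 H1).
set (x := bc_root a b c n2 n3) in *.
destruct (sol_b a b c (n1, n2, n3)) eqn:Es.
- destruct (Rle_dec 1 (Rabs (INR n1 - x))) as [H|H].
  + assert (0 < / Rabs (INR n1 - x)) by (apply Rinv_0_lt_compat; lra).
    apply Rplus_le_le_0_compat; [|lra]. apply Rmult_le_pos; [lra|].
    apply Rplus_le_le_0_compat; [lra|]. apply Rmult_le_pos; lra.
  + apply Rplus_le_le_0_compat; [|exact HR]. apply Rmult_le_pos; lra.
- unfold sol_b in Es. apply Nat.eqb_neq in Es.
  destruct (Rle_dec 1 (Rabs (INR n1 - x))) as [H|H].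
  + rewrite Rplus_0_r.
    assert (EF : freq (INR a) (INR b) (INR c) (n1, n2, n3) = INR a * (ln x - ln (INR n1))).
    { unfold x. rewrite ln_bc_root by assumption. unfold freq. apply INR_ge1 in Ha. field. lra. }
    assert (EW : weight (INR a) (INR b) (INR c) th (n1, n2, n3) = V * Rpower (INR n1) (- (1 / 2 - INR a * th))).
    { unfold weight, V. ring. }
    rewrite EW, EF, Rmult_assoc. apply Rmult_le_compat_l; [lra|].
    pose proof (ln_gap_shift (INR n1) x ltac:(lra) ltac:(lra) H) as G.
    assert (HL : 0 < Rabs (ln x - ln (INR n1))).
    { apply Rabs_pos_lt. intros E. assert (E' : ln x = ln (INR n1)) by lra.
      apply ln_inv in E'; [|lra|lra]. rewrite E', Rminus_diag, Rabs_R0 in H. lra. }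
    apply INR_ge1 in Ha.
    assert (B : Rmin T (3 / Rabs (INR a * (ln x - ln (INR n1)))) <= 3 * (1 + INR n1 / Rabs (INR n1 - x))).
    { eapply Rle_trans; [apply Rmin_r|]. apply Rle_trans with (3 * / Rabs (ln x - ln (INR n1))); [|lra].
      apply Rmult_le_compat_l; [lra|]. rewrite Rabs_mult, (Rabs_pos_eq (INR a)) by lra.
      apply Rinv_le_contravar; nra. }
    apply Rle_trans with (Rpower (INR n1) (- (1 / 2 - INR a * th)) * (3 * (1 + INR n1 / Rabs (INR n1 - x)))).
    { apply Rmult_le_compat_l; lra. }
    assert (D : Rpower (INR n1) (- (1 / 2 - INR a * th)) * INR n1 <= Rpower (INR N) (1 / 2 + INR a * th)).
    { rewrite Rmult_comm, Rpower_mult_1 by lra.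
      replace (1 + - (1 / 2 - INR a * th)) with (1 / 2 + INR a * th) by field.
      apply Rpower_le_l; lra. }
    assert (0 < / Rabs (INR n1 - x)) by (apply Rinv_0_lt_compat; lra).
    unfold Rdiv. nra.
  + rewrite Rmult_0_r, Rplus_0_r. apply Rnot_le_lt in H.
    assert (Hx2 : x <= 2 * INR n1) by (apply Rabs_lt_between in H; lra).
    pose proof (weight_near a b c th n1 n2 n3 Ha H1 H2 H3 ltac:(lra) Hx2) as W.
    pose proof (HY n1 n2 n3 H1 H2 H3 Es H) as B.
    assert (B2 : Rmin T (3 / Rabs (freq (INR a) (INR b) (INR c) (n1, n2, n3))) <= CY * Rmin T (Y (n2, n3))).
    { eapply Rle_trans; [apply Rle_min_compat_l; exact B|]. now apply Rmin_scal. }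
    apply Rle_trans with (2 * pair_weight a b c (n2, n3) * (CY * Rmin T (Y (n2, n3)))).
    * apply Rmult_le_compat; [left; apply weight_pos | | exact W | exact B2].
      apply Rmin_glb; [exact HT|]. apply Rmult_le_pos; [lra|].
      (* At frequency 0 the quotient is 0, by the value of [/ 0]. *)
      destruct (Req_dec (Rabs (freq (INR a) (INR b) (INR c) (n1, n2, n3))) 0) as [E|E].
      { rewrite E, Rinv_0; lra. }
      left; apply Rinv_0_lt_compat. pose proof (Rabs_pos (freq (INR a) (INR b) (INR c) (n1, n2, n3))); lra.
    * assert (0 <= V * (3 * Rpower (INR n1) (- (1 / 2 - INR a * th)))) by (apply Rmult_le_pos; lra). lra.
Qed.

(** The bound W of the pair sum stays abstract, so both error estimates share this lemma. The 18
    collects 3 * 2 from the power sum and 3 * 4 from [sum_inv_dist]; 4 [CY] is 2 [CY] for each of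
    the two near values of n1. *)
Lemma off_sum_bound a b c th Y CY : (1 <= a)%nat -> 0 < INR a * th < 1 / 2 ->
  1 / 2 < INR b * th -> 1 / 2 < INR c * th -> admissible a b c Y CY ->
  exists K, 0 < K /\ forall N M T W, (1 <= N)%nat -> 0 <= T ->
   lsum (fun q => pair_weight a b c q * Rmin T (Y q)) (pair_box M) <= W ->
   off_sum a b c th N M T <= K * (Rpower (INR N) (1 / 2 + INR a * th) * (1 + ln (INR N)) + W).
Proof.
intros Ha Hat Hbt Hct Had. set (u := 1 / 2 + INR b * th). set (v := 1 / 2 + INR c * th).
set (Bk := u / (u - 1) * (v / (v - 1))).
assert (HB : 0 < Bk) by (apply Rmult_lt_0_compat; apply Rdiv_lt_0_compat; unfold u, v; lra).
assert (HCY : 1 <= CY) by apply Had.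
exists (18 * Bk + 4 * CY). split; [lra|].
intros N M T W HN HT HW.
set (P := Rpower (INR N) (1 / 2 + INR a * th)).
assert (HP : 0 < P) by apply Rpower_pos.
pose proof (ln_nonneg (INR N) (INR_ge1 N HN)) as HL.
assert (HW0 : 0 <= W).
{ eapply Rle_trans; [|exact HW]. apply lsum_nonneg. intros [n2 n3] Hq. apply in_pair_box in Hq.
  apply Rmult_le_pos; [left; apply Rmult_lt_0_compat; apply Rpower_pos|].
  apply Rmin_glb; [exact HT|]. destruct Had as [_ [Hx _]].
  specialize (Hx n2 n3 ltac:(lia) ltac:(lia)). pose proof (bc_root_ge1 a b c n2 n3 Ha ltac:(lia) ltac:(lia)). lra. }
unfold off_sum. rewrite lsum_triple.
apply Rle_trans with (lsum (fun q => 18 * (P * (1 + ln (INR N))) * (Rpower (INR (fst q)) (- u) * Rpower (INR (snd q)) (- v))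
   + 4 * CY * (pair_weight a b c q * Rmin T (Y q))) (pair_box M)).
- apply lsum_le. intros [n2 n3] Hq. apply in_pair_box in Hq. cbn [fst snd].
  set (x := bc_root a b c n2 n3). set (Vq := Rpower (INR n2) (- u) * Rpower (INR n3) (- v)).
  assert (HV : 0 < Vq) by (apply Rmult_lt_0_compat; apply Rpower_pos).
  set (Rq := pair_weight a b c (n2, n3) * Rmin T (Y (n2, n3))).
  assert (HRq : 0 <= Rq).
  { apply Rmult_le_pos; [left; apply Rmult_lt_0_compat; apply Rpower_pos|].
    apply Rmin_glb; [exact HT|]. destruct Had as [_ [Hx _]].
    specialize (Hx n2 n3 ltac:(lia) ltac:(lia)). pose proof (bc_root_ge1 a b c n2 n3 Ha ltac:(lia) ltac:(lia)). lra. }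
  pose proof (bc_root_ge1 a b c n2 n3 Ha ltac:(lia) ltac:(lia)) as Hx1. fold x in Hx1.
  apply Rle_trans with (lsum (fun n1 =>
     (Vq * 3) * Rpower (INR n1) (- (1 / 2 - INR a * th)) +
     ((Vq * 3 * P) * (if Rle_dec 1 (Rabs (INR n1 - x)) then / Rabs (INR n1 - x) else 0) +
     (if Rle_dec 1 (Rabs (INR n1 - x)) then 0 else 2 * CY * Rq))) (seq 1 N)).
  + apply lsum_le. intros n1 Hn1. apply in_seq in Hn1.
    eapply Rle_trans; [apply (off_term a b c th Y CY n1 n2 n3 N T); auto; lia|].
    right. fold x u v Vq P Rq. ring.
  + rewrite !lsum_plus, !lsum_scal.
    pose proof (sum_power_lt1 (1 / 2 - INR a * th) N ltac:(lra)) as S1.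
    replace (1 - (1 / 2 - INR a * th)) with (1 / 2 + INR a * th) in S1 by field. fold P in S1.
    assert (S1' : P / (1 / 2 + INR a * th) <= 2 * P).
    { unfold Rdiv. rewrite Rmult_comm. apply Rmult_le_compat_r; [lra|].
      replace 2 with (/ (1 / 2)) by field. apply Rinv_le_contravar; lra. }
    pose proof (sum_inv_dist x N ltac:(lra)) as S2.
    pose proof (sum_near x N (2 * CY * Rq) ltac:(lra) ltac:(apply Rmult_le_pos; lra)) as S3.
    assert (T1 : Vq * 3 * lsum (fun n => Rpower (INR n) (- (1 / 2 - INR a * th))) (seq 1 N) <= Vq * 3 * (2 * P))
      by (apply Rmult_le_compat_l; lra).
    assert (HVP : 0 < Vq * P) by (apply Rmult_lt_0_compat; lra).
    assert (T2 : Vq * 3 * P * lsum (fun n => if Rle_dec 1 (Rabs (INR n - x)) then / Rabs (INR n - x) else 0) (seq 1 N)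
       <= Vq * 3 * P * (4 * (1 + ln (INR N)))) by (apply Rmult_le_compat_l; lra).
    assert (0 <= Vq * P * ln (INR N)) by (apply Rmult_le_pos; lra). lra.
- rewrite lsum_plus, !lsum_scal.
  pose proof (pair_sum_product u v M ltac:(unfold u; lra) ltac:(unfold v; lra)) as S. fold Bk in S.
  assert (HQ : 0 <= P * (1 + ln (INR N))) by (apply Rmult_le_pos; lra).
  assert (18 * (P * (1 + ln (INR N))) * lsum (fun x => Rpower (INR (fst x)) (- u) * Rpower (INR (snd x)) (- v)) (pair_box M)
    <= 18 * (P * (1 + ln (INR N))) * Bk) by (apply Rmult_le_compat_l; lra).
  assert (4 * CY * lsum (fun x => pair_weight a b c x * Rmin T (Y x)) (pair_box M) <= 4 * CY * W)
    by (apply Rmult_le_compat_l; lra).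
  assert (0 <= 18 * Bk * W) by (apply Rmult_le_pos; lra).
  assert (0 <= 4 * CY * (P * (1 + ln (INR N)))) by (apply Rmult_le_pos; lra).
  lra.
Qed.

(** * The diagonal sum over solutions *)

Lemma sigma_term_sol a b c n1 n2 n3 : (1 <= a)%nat -> solution a b c (n1, n2, n3) ->
  INR n1 = bc_root a b c n2 n3 /\ sigma_term (n1, n2, n3) = pair_weight a b c (n2, n3).
Proof.
intros Ha [H1 [H2 [H3 E]]]. apply (f_equal INR) in E as E'. fold (bc_prod b c n2 n3) in E'.
rewrite pow_INR in E'.
pose proof (ln_bc_root a b c n2 n3 H2 H3) as Lx.
assert (Ex : INR n1 = bc_root a b c n2 n3).
{ assert (Ha' := INR_ge1 a Ha). assert (H1' := INR_ge1 n1 H1). unfold bc_root. rewrite <- E', <- Rpower_pow by lra.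
  rewrite Rpower_mult, Rinv_r, Rpower_1; lra. }
split; [exact Ex|]. rewrite <- Ex in Lx.
apply INR_ge1 in Ha. apply INR_ge1 in H1. apply INR_ge1 in H2. apply INR_ge1 in H3.
unfold sigma_term, pair_weight; cbn [fst snd]. unfold Rpower. rewrite <- exp_plus, !ln_mult by nra. f_equal.
rewrite Lx. field. lra.
Qed.

Definition is_sol_list (a b c : nat) (l : list (nat * nat * nat)) : Prop :=
  NoDup l /\ List.Forall (solution a b c) l.

(** A solution is determined by (n2, n3), so dropping n1 creates no duplicates and turns sigma terms
    into pair weights. *)
Lemma sigma_list_pairs a b c l : (1 <= a)%nat -> is_sol_list a b c l ->
  exists l', NoDup l' /\ lsum sigma_term l = lsum (pair_weight a b c) l' /\
    (forall q, In q l' -> (1 <= fst q)%nat /\ (1 <= snd q)%nat) /\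
    (forall q, In q l' -> exists n1, In (n1, fst q, snd q) l).
Proof.
intros Ha [Hd Hf]. exists (map (fun n : nat * nat * nat => (snd (fst n), snd n)) l).
rewrite Forall_forall in Hf.
split; [|split; [|split]].
- apply NoDup_map_NoDup_ForallPairs; [|exact Hd].
  intros [[n1 n2] n3] [[m1 m2] m3] Hn Hm E. simpl in E. injection E as -> ->.
  destruct (Hf _ Hn) as [_ [_ [_ E1]]]. destruct (Hf _ Hm) as [_ [_ [_ E2]]].
  rewrite <- E2 in E1. do 2 f_equal. apply Nat.pow_inj_l in E1; [exact E1 | lia].
- rewrite lsum_map. apply lsum_ext. intros [[n1 n2] n3] Hn. simpl.
  now apply (sigma_term_sol a b c n1 n2 n3), Hf.
- intros q Hq. apply in_map_iff in Hq. destruct Hq as [[[n1 n2] n3] [<- Hn]].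
  destruct (Hf _ Hn) as [_ [H2 [H3 _]]]. simpl; auto.
- intros q Hq. apply in_map_iff in Hq. destruct Hq as [[[n1 n2] n3] [<- Hn]]. exists n1; exact Hn.
Qed.

Lemma pairs_in_box (l : list (nat * nat)) : (forall q, In q l -> (1 <= fst q)%nat /\ (1 <= snd q)%nat) ->
  exists M, incl l (pair_box M).
Proof.
induction l as [|[x y] l IH]; intros H.
- exists 0%nat. intros q [].
- destruct IH as [M HM]; [intros; apply H; now right|].
  exists (Nat.max M (Nat.max x y)). intros [n2 n3] Hq. apply in_pair_box.
  destruct (H _ Hq) as [H1 H2]; simpl in H1, H2.
  destruct Hq as [E|Hq]; [injection E as -> ->; lia|].
  apply HM, in_pair_box in Hq. lia.
Qed.

Lemma NoDup_list_prod {S T} (l : list S) (l' : list T) : NoDup l -> NoDup l' -> NoDup (list_prod l l').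
Proof.
intros Hl Hl'. induction Hl as [|x l Hx Hl IH]; [constructor|]. simpl. apply NoDup_app.
- apply NoDup_map_NoDup_ForallPairs; [|exact Hl']. intros y z _ _ E. now injection E.
- exact IH.
- intros [y z] H1 H2. apply in_map_iff in H1. destruct H1 as [w [E _]]. injection E as <- _.
  apply in_prod_iff in H2. now apply Hx.
Qed.

Lemma triple_box_NoDup N M : NoDup (triple_box N M).
Proof. unfold triple_box. repeat apply NoDup_list_prod; apply seq_NoDup. Qed.

Lemma diag_is_sol_list a b c N M : is_sol_list a b c (filter (sol_b a b c) (triple_box N M)).
Proof.
split; [apply NoDup_filter, triple_box_NoDup|]. apply Forall_forall. intros [[n1 n2] n3] H.
apply filter_In in H. destruct H as [H E]. apply in_triple_box in H. apply Nat.eqb_eq in E.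
unfold solution. lia.
Qed.

Lemma in_diag a b c N M n1 n2 n3 : solution a b c (n1, n2, n3) ->
  (n1 <= N)%nat -> (n2 <= M)%nat -> (n3 <= M)%nat ->
  In (n1, n2, n3) (filter (sol_b a b c) (triple_box N M)).
Proof.
intros [H1 [H2 [H3 E]]] HN HM2 HM3. apply filter_In. split.
- apply in_triple_box. lia.
- apply Nat.eqb_eq. exact E.
Qed.

(* Solutions outside the box have n2^b n3^c >= N^a, where T <= N <= Y. *)
Lemma diag_tail a b c Y CY N M T W : (1 <= a)%nat -> (1 <= b)%nat -> (1 <= c)%nat ->
  admissible a b c Y CY -> 0 <= T <= INR N -> (1 <= N)%nat -> (N ^ a <= M)%nat ->
  (forall M', lsum (fun q => pair_weight a b c q * Rmin T (Y q)) (pair_box M') <= W) ->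
  forall l, is_sol_list a b c l -> T * (lsum sigma_term l - diag_sum a b c N M) <= W.
Proof.
intros Ha Hb Hc [_ [HY _]] HT HN HM HW l [Hd Hf].
set (inb := fun n : nat * nat * nat => let '(n1, n2, n3) := n in
   (andb (n1 <=? N) (andb (n2 <=? M) (n3 <=? M)))%nat).
assert (E : lsum sigma_term l = lsum sigma_term (filter inb l) + lsum sigma_term (filter (fun n => negb (inb n)) l)).
{ rewrite !lsum_filter, <- lsum_plus. apply lsum_ext. intros n _. destruct (inb n); simpl; ring. }
rewrite Forall_forall in Hf.
assert (B1 : lsum sigma_term (filter inb l) <= diag_sum a b c N M).
{ unfold diag_sum. apply lsum_incl; [now apply NoDup_filter | |].
  - intros [[n1 n2] n3] Hn. apply filter_In in Hn. destruct Hn as [Hn Eb]. unfold inb in Eb.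
    rewrite !Bool.andb_true_iff, !Nat.leb_le in Eb. apply in_diag; [now apply Hf | lia..].
  - intros [[n1 n2] n3] _. unfold sigma_term. left; apply Rpower_pos. }
set (l2 := filter (fun n => negb (inb n)) l) in *.
assert (S2 : is_sol_list a b c l2).
{ split; [now apply NoDup_filter|]. apply Forall_forall. intros n Hn. apply filter_In in Hn. now apply Hf. }
destruct (sigma_list_pairs a b c l2 Ha S2) as [l' [D' [E' [P' Q']]]].
destruct (pairs_in_box l' P') as [M' HM'].
assert (B2 : T * lsum (pair_weight a b c) l' <= W).
{ rewrite <- lsum_scal. eapply Rle_trans; [|apply (HW M')].
  apply Rle_trans with (lsum (fun q => pair_weight a b c q * Rmin T (Y q)) l').
  - apply lsum_le. intros [n2 n3] Hq. rewrite Rmult_comm.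
    apply Rmult_le_compat_l; [left; apply Rmult_lt_0_compat; apply Rpower_pos|].
    destruct (P' _ Hq) as [H2 H3]. simpl in H2, H3.
    destruct (Q' _ Hq) as [n1 Hn]. simpl in Hn.
    apply Rmin_glb; [lra|]. eapply Rle_trans; [|apply HY; assumption].
    apply filter_In in Hn. destruct Hn as [Hn Eb]. pose proof (Hf _ Hn) as Sn.
    destruct (sigma_term_sol a b c n1 n2 n3 Ha Sn) as [Ex _]. rewrite <- Ex.
    apply Rle_trans with (INR N); [lra|]. apply le_INR.
    destruct Sn as [H1 [_ [_ E1]]].
    unfold inb in Eb. apply Bool.negb_true_iff in Eb. 
    (* If n1 does not leave the box, then n2 or n3 exceeds M >= N^a, hence n1^a = n2^b n3^c >= N^a
       all the same. *)
    destruct (Nat.leb_spec n1 N) as [L1|L1]; [|lia].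
    apply (Nat.pow_le_mono_l_iff N n1 a); [lia|]. rewrite E1.
    pose proof (pow_ge1_nat n2 b H2) as Q2. pose proof (pow_ge1_nat n3 c H3) as Q3.
    assert (G : forall n k, (1 <= n)%nat -> (1 <= k)%nat -> (n <= n ^ k)%nat).
    { intros n k Hn1 Hk1. rewrite <- (Nat.pow_1_r n) at 1. apply Nat.pow_le_mono_r; lia. }
    pose proof (G n2 b H2 Hb). pose proof (G n3 c H3 Hc).
    destruct (Nat.leb_spec n2 M) as [L2|L2]; [|nia].
    destruct (Nat.leb_spec n3 M) as [L3|L3]; [discriminate Eb | nia].
  - apply lsum_incl; [exact D' | exact HM' |].
    intros [n2 n3] Hq. apply in_pair_box in Hq.
    apply Rmult_le_pos; [left; apply Rmult_lt_0_compat; apply Rpower_pos|].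
    apply Rmin_glb; [lra|]. specialize (HY n2 n3 ltac:(lia) ltac:(lia)).
    pose proof (bc_root_ge1 a b c n2 n3 Ha ltac:(lia) ltac:(lia)). lra. }
rewrite E, E'. nra.
Qed.

(** * The near-diagonal pair sums *)

Lemma Rmin_interp T y tau : 0 < T -> 0 < y -> 0 <= tau <= 1 ->
  Rmin T y <= Rpower T (1 - tau) * Rpower y tau.
Proof.
intros HT Hy Ht.
assert (Hm : 0 < Rmin T y) by (now apply Rmin_glb_lt).
rewrite <- (Rpower_1 (Rmin T y)) by exact Hm.
replace 1 with ((1 - tau) + tau) at 1 by ring. rewrite Rpower_plus.
apply Rmult_le_compat; try (left; apply Rpower_pos).
- apply Rpower_le_l; [split; [exact Hm | apply Rmin_l] | lra].
- apply Rpower_le_l; [split; [exact Hm | apply Rmin_r] | lra].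
Qed.

(* min(T, y) <= T^(1-tau) y^tau with tau slightly below (c-a)/(2(a+c)). *)
Lemma pair_sum_cond (a b c : nat) eps : (1 <= a)%nat -> (a < c)%nat -> (c <= b)%nat -> 0 < eps ->
  exists K, 0 < K /\ forall T M, 1 <= T ->
   lsum (fun q => pair_weight a b c q * Rmin T (Rpower (bc_root a b c (fst q) (snd q)) (1 + eps) * INR (fst q) * INR (snd q)))
     (pair_box M) <= K * Rpower T (1 / 2 + INR a / (INR a + INR c) + eps).
Proof.
intros Ha Hac Hcb He. assert (Ha' := INR_ge1 a Ha). apply lt_INR in Hac as Hac'. apply le_INR in Hcb as Hcb'.
set (ra := INR a) in *. set (rb := INR b) in *. set (rc := INR c) in *.
(* As eps tends to 0, [tau] tends to (c-a)/(2(a+c)) and 1 - [tau] to 1/2 + a/(a+c). The 2 eps,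
   against the 1 + eps in the exponent of x, leaves v strictly above 1. *)
set (D := ra + (1 + 2 * eps) * rc). assert (HD : 0 < D) by (unfold D; nra).
set (tau := (rc - ra) / (2 * D)).
assert (Ht0 : 0 < tau) by (apply Rdiv_lt_0_compat; lra).
assert (HtD : tau * (2 * D) = rc - ra) by (unfold tau; field; lra).
assert (HrD : ra + rc <= D) by (unfold D; nra).
assert (Ht1 : tau <= 1) by (apply Rmult_le_reg_r with (2 * D); [lra | rewrite HtD; lra]).
set (u := 1 / 2 + rb / (2 * ra) - tau * (1 + (1 + eps) * rb / ra)).
set (v := 1 / 2 + rc / (2 * ra) - tau * (1 + (1 + eps) * rc / ra)).
assert (Hv : 1 < v).
{ apply Rmult_lt_reg_r with (2 * ra); [lra|].
  replace (v * (2 * ra)) with (ra + rc - 2 * tau * (ra + (1 + eps) * rc)) by (unfold v; field; lra).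
  assert (0 < tau * (eps * rc)) by (apply Rmult_lt_0_compat; [exact Ht0 | apply Rmult_lt_0_compat; lra]).
  enough (2 * tau * (ra + (1 + eps) * rc) < rc - ra) by lra. rewrite <- HtD. unfold D. lra. }
(* This is weaker than the condition on v, because (r - a)/(a + (1 + eps) r) increases with r and b
   >= c. *)
assert (Hu : 1 < u).
{ apply Rmult_lt_reg_r with (2 * ra); [lra|].
  replace (u * (2 * ra)) with (ra + rb - 2 * tau * (ra + (1 + eps) * rb)) by (unfold u; field; lra).
  enough (2 * tau * (ra + (1 + eps) * rb) < rb - ra) by lra.
  apply Rmult_lt_reg_r with D; [exact HD|].
  replace (2 * tau * (ra + (1 + eps) * rb) * D) with ((rc - ra) * (ra + (1 + eps) * rb)) by (rewrite <- HtD; ring).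
  unfold D.
  assert (0 < eps * rb * (rc - ra)) by (repeat apply Rmult_lt_0_compat; lra).
  assert (0 <= ra * (2 + eps) * (rb - rc)) by (repeat apply Rmult_le_pos; lra).
  assert (0 < eps * ra * rb) by (repeat apply Rmult_lt_0_compat; lra).
  assert (E : (rb - ra) * (ra + (1 + 2 * eps) * rc) - (rc - ra) * (ra + (1 + eps) * rb) =
    ra * (2 + eps) * (rb - rc) + eps * rc * (rb - ra)) by ring.
  assert (0 < eps * rc * (rb - ra)) by (repeat apply Rmult_lt_0_compat; lra). lra. }
assert (Hx : 1 - tau <= 1 / 2 + ra / (ra + rc) + eps).
{ assert (E : 1 / 2 + ra / (ra + rc) + eps - (1 - tau) = eps - (rc - ra) * (eps * rc) / ((ra + rc) * D)).
  { unfold tau, D. field. split; [unfold D in HD; lra | lra]. }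
  assert ((rc - ra) * (eps * rc) / ((ra + rc) * D) <= eps).
  { assert (0 < (ra + rc) * D) by (apply Rmult_lt_0_compat; lra).
    apply Rmult_le_reg_r with ((ra + rc) * D); [assumption|].
    unfold Rdiv. rewrite Rmult_assoc, Rinv_l, Rmult_1_r by lra.
    replace ((rc - ra) * (eps * rc)) with (eps * ((rc - ra) * rc)) by ring.
    apply Rmult_le_compat_l; [lra|]. unfold D.
    apply Rmult_le_compat; nra. }
  lra. }
exists (u / (u - 1) * (v / (v - 1))). split.
{ apply Rmult_lt_0_compat; apply Rdiv_lt_0_compat; lra. }
intros T M HT.
apply Rle_trans with (lsum (fun q => Rpower T (1 - tau) *
   (Rpower (INR (fst q)) (- u) * Rpower (INR (snd q)) (- v))) (pair_box M)).
- apply lsum_le. intros [n2 n3] Hq. apply in_pair_box in Hq. cbn [fst snd].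
  destruct Hq as [[H2 _] [H3 _]]. pose proof (bc_root_ge1 a b c n2 n3 Ha H2 H3) as Hxr.
  pose proof (ln_bc_root a b c n2 n3 H2 H3) as Lx. fold ra rb rc in Lx.
  apply INR_ge1 in H2. apply INR_ge1 in H3.
  set (x := bc_root a b c n2 n3) in *.
  set (y := Rpower x (1 + eps) * INR n2 * INR n3).
  assert (Hy : 0 < y) by (unfold y; repeat apply Rmult_lt_0_compat; try lra; apply Rpower_pos).
  apply Rle_trans with (pair_weight a b c (n2, n3) * (Rpower T (1 - tau) * Rpower y tau)).
  { apply Rmult_le_compat_l; [left; apply Rmult_lt_0_compat; apply Rpower_pos|].
    apply Rmin_interp; lra. }
  right. unfold pair_weight; cbn [fst snd]. fold ra rb rc.
  assert (Ey : Rpower y tau = exp (tau * ((1 + eps) * ln x + ln (INR n2) + ln (INR n3)))).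
  { unfold Rpower at 1. f_equal. f_equal. unfold y.
    rewrite !ln_mult; try lra; [|apply Rpower_pos | apply Rmult_lt_0_compat; [apply Rpower_pos | lra]].
    unfold Rpower. rewrite ln_exp. reflexivity. }
  rewrite Ey, Lx.
  assert (Epw : Rpower (INR n2) (- (1 / 2 + rb / (2 * ra))) * Rpower (INR n3) (- (1 / 2 + rc / (2 * ra))) *
    exp (tau * ((1 + eps) * ((rb * ln (INR n2) + rc * ln (INR n3)) / ra) + ln (INR n2) + ln (INR n3)))
    = Rpower (INR n2) (- u) * Rpower (INR n3) (- v)).
  { unfold Rpower. rewrite <- !exp_plus. f_equal. unfold u, v. field. lra. }
  rewrite <- Epw. ring.
- rewrite lsum_scal. rewrite Rmult_comm.
  apply Rmult_le_compat; [apply lsum_nonneg | left; apply Rpower_pos | now apply pair_sum_product |].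
  + intros q _. apply Rmult_le_pos; left; apply Rpower_pos.
  + apply Rpower_le_r; lra.
Qed.

(** The two ranges together overshoot M, which avoids comparing k with M; the extra terms of f are
    nonnegative. *)
Lemma lsum_cut (f g h : nat -> R) k M : (forall n, (1 <= n)%nat -> 0 <= f n) ->
  (forall n, (1 <= n <= k)%nat -> f n <= g n) -> (forall n, (k < n)%nat -> f n <= h n) ->
  lsum f (seq 1 M) <= lsum g (seq 1 k) + lsum h (seq (S k) M).
Proof.
intros H0 Hg Hh. apply Rle_trans with (lsum f (seq 1 k ++ seq (S k) M)).
- apply lsum_incl; [apply seq_NoDup | |].
  + intros n Hn. apply in_seq in Hn. apply in_or_app. rewrite !in_seq. lia.
  + intros n Hn. apply H0. apply in_app_or in Hn. rewrite !in_seq in Hn. lia.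
- rewrite lsum_app. apply Rplus_le_compat; apply lsum_le; intros n Hn; apply in_seq in Hn;
   [apply Hg | apply Hh]; lia.
Qed.

(* The two regimes of the minimum balance at n = (T/q)^(1/c). *)
Lemma inner_sum (a c : nat) : (1 <= a)%nat -> (a < c)%nat -> exists K, 0 < K /\ forall T q M, 0 < T -> 0 < q ->
  lsum (fun n => Rpower (INR n) (- (1 / 2 + INR c / (2 * INR a))) * Rmin T (q * Rpower (INR n) (INR c))) (seq 1 M)
  <= K * (T * Rmin 1 (Rpower (T / q) (- ((INR c - INR a) / (2 * INR a * INR c))))).
Proof.
intros Ha Hac. assert (Ha' := INR_ge1 a Ha). apply lt_INR in Hac as Hac'.
assert (Hac2 : INR (S a) <= INR c) by (apply le_INR; lia). rewrite S_INR in Hac2.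
set (ra := INR a) in *. set (rc := INR c) in *.
set (v := 1 / 2 + rc / (2 * ra)).
assert (Hv : 1 < v).
{ unfold v. apply Rmult_lt_reg_r with (2 * ra); [lra|].
  replace ((1 / 2 + rc / (2 * ra)) * (2 * ra)) with (ra + rc) by (field; lra). lra. }
(* In the first regime the terms are q n^(c-v); with a nonnegative exponent each is at most its
   value at the balance point [y]. *)
assert (Hcv : 0 <= rc - v).
{ unfold v. apply Rmult_le_reg_r with (2 * ra); [lra|].
  replace ((rc - (1 / 2 + rc / (2 * ra))) * (2 * ra)) with (2 * ra * rc - ra - rc) by (field; lra). nra. }
set (Cv := v / (v - 1)). assert (HCv : 1 <= Cv).
{ unfold Cv. apply Rmult_le_reg_r with (v - 1); [lra|]. unfold Rdiv. rewrite Rmult_assoc, Rinv_l; lra. }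
exists (1 + Cv). split; [lra|]. intros T q M HT Hq.
assert (F0 : forall n, 0 <= Rpower (INR n) (- v) * Rmin T (q * Rpower (INR n) rc)).
{ intros n. apply Rmult_le_pos; [left; apply Rpower_pos|]. apply Rmin_glb; [lra|].
  apply Rmult_le_pos; [lra | left; apply Rpower_pos]. }
assert (B1 : lsum (fun n => Rpower (INR n) (- v) * Rmin T (q * Rpower (INR n) rc)) (seq 1 M) <= Cv * T).
{ apply Rle_trans with (lsum (fun n => Rpower (INR n) (- v) * T) (seq 1 M)).
  - apply lsum_le. intros n _. apply Rmult_le_compat_l; [left; apply Rpower_pos | apply Rmin_l].
  - rewrite lsum_scal_r. apply Rmult_le_compat_r; [lra|].
    pose proof (sum_power_tail v 1 M Hv (le_n 1)) as S. simpl (INR 1) in S.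
    rewrite Rpower_base1, Rmult_1_r in S. exact S. }
set (y := Rpower (T / q) (/ rc)). assert (HTq : 0 < T / q) by (apply Rdiv_lt_0_compat; lra).
assert (Hy : 0 < y) by apply Rpower_pos.
assert (Eexp : Rpower (T / q) (- ((rc - ra) / (2 * ra * rc))) = Rpower y (1 - v)).
{ unfold y. rewrite Rpower_mult. f_equal. unfold v. field. lra. }
rewrite Eexp. destruct (Rle_dec 1 y) as [H1|H1].
- assert (Em : Rmin 1 (Rpower y (1 - v)) = Rpower y (1 - v)).
  { apply Rmin_right. apply Rle_trans with (Rpower y 0); [apply Rpower_le_r; lra | rewrite Rpower_O; lra]. }
  rewrite Em. destruct (nfloor_ex y) as [k [Hk1 Hk2]]; [lra|].
  assert (Hqy : q * Rpower y rc = T).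
  { unfold y. rewrite Rpower_mult, Rinv_l, Rpower_1 by lra. field. lra. }
  eapply Rle_trans; [apply (lsum_cut _ (fun n => q * Rpower y (rc - v)) (fun n => Rpower (INR n) (- v) * T) k)|].
  + intros; apply F0.
  + intros n Hn. assert (1 <= INR n) by (apply INR_ge1; lia). assert (INR n <= INR k) by (apply le_INR; lia).
    apply Rle_trans with (Rpower (INR n) (- v) * (q * Rpower (INR n) rc)).
    * apply Rmult_le_compat_l; [left; apply Rpower_pos | apply Rmin_r].
    * replace (Rpower (INR n) (- v) * (q * Rpower (INR n) rc)) with (q * Rpower (INR n) (rc - v))
        by (unfold Rminus; rewrite Rpower_plus; ring).
      apply Rmult_le_compat_l; [lra|]. apply Rpower_le_l; lra.
  + intros n Hn. apply Rmult_le_compat_l; [left; apply Rpower_pos | apply Rmin_l].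
  + rewrite (lsum_scal_r T). pose proof (sum_power_tail v (S k) M Hv ltac:(lia)) as S2.
    assert (L1 : lsum (fun _ : nat => q * Rpower y (rc - v)) (seq 1 k) <= y * (q * Rpower y (rc - v))).
    { assert (E : forall j, lsum (fun _ : nat => q * Rpower y (rc - v)) (seq 1 j) = INR j * (q * Rpower y (rc - v))).
      { induction j as [|j IH]; [unfold lsum; simpl; ring|]. rewrite lsum_seq_S, IH, S_INR. ring. }
      rewrite E. apply Rmult_le_compat_r; [|exact Hk1].
      apply Rmult_le_pos; [lra | left; apply Rpower_pos]. }
    assert (L2 : y * (q * Rpower y (rc - v)) = T * Rpower y (1 - v)).
    { rewrite <- Hqy. replace (y * (q * Rpower y (rc - v))) with (q * (y * Rpower y (rc - v))) by ring.
      rewrite Rpower_mult_1 by lra. replace (1 + (rc - v)) with (rc + (1 - v)) by ring.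
      rewrite Rpower_plus. ring. }
    assert (L3 : Rpower (INR (S k)) (1 - v) <= Rpower y (1 - v)) by (apply Rpower_le_neg; rewrite ?S_INR; lra).
    fold Cv in S2. pose proof (Rpower_pos (INR (S k)) (1 - v)).
    assert (lsum (fun n => Rpower (INR n) (- v)) (seq (S k) M) * T <= Cv * Rpower y (1 - v) * T).
    { apply Rmult_le_compat_r; [lra|]. eapply Rle_trans; [exact S2|]. apply Rmult_le_compat_l; lra. }
    lra.
- assert (Em : Rmin 1 (Rpower y (1 - v)) = 1).
  { apply Rmin_left. apply Rle_trans with (Rpower 1 (1 - v)); [rewrite Rpower_base1; lra | apply Rpower_le_neg; lra]. }
  rewrite Em. eapply Rle_trans; [exact B1|]. nra.
Qed.

(** After the sum over n3 with q = n2^b, the exponent of n2 is -(1/2 + b/(2c)). For b > c this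
    converges; for b = c it is -1, and the harmonic sum up to n2 = T^(1/b) produces the
    logarithm. *)
Lemma pair_sum_uncond (a b c : nat) : (1 <= a)%nat -> (a < c)%nat -> (c <= b)%nat ->
  exists K, 0 < K /\ forall T M, 3 <= T ->
   lsum (fun q => pair_weight a b c q * Rmin T (INR (bc_prod b c (fst q) (snd q)))) (pair_box M)
    <= K * (Rpower T (1 - 1 / (2 * INR a) + 1 / (2 * INR c)) * (ln T) ^ (if Nat.eqb b c then 1 else 0)).
Proof.
intros Ha Hac Hcb. destruct (inner_sum a c Ha Hac) as [K [HK IS]].
assert (Ha' := INR_ge1 a Ha). apply lt_INR in Hac as Hac'. apply le_INR in Hcb as Hcb'.
assert (Hne : b <> c -> INR c < INR b) by (intros; apply lt_INR; lia).
set (ra := INR a) in *. set (rb := INR b) in *. set (rc := INR c) in *.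
set (u := 1 / 2 + rb / (2 * ra)). set (al := (rc - ra) / (2 * ra * rc)).
assert (Hal : 0 < al) by (apply Rdiv_lt_0_compat; [lra | apply Rmult_lt_0_compat; lra]).
set (B := 1 - 1 / (2 * ra) + 1 / (2 * rc)).
assert (EB : B = 1 - al) by (unfold B, al; field; lra).
assert (Hu : 1 < u).
{ unfold u. apply Rmult_lt_reg_r with (2 * ra); [lra|].
  replace ((1 / 2 + rb / (2 * ra)) * (2 * ra)) with (ra + rb) by (field; lra). lra. }
assert (St : forall T M, 0 < T -> lsum (fun q => pair_weight a b c q * Rmin T (INR (bc_prod b c (fst q) (snd q)))) (pair_box M)
   <= lsum (fun n => Rpower (INR n) (- u) * (K * (T * Rmin 1 (Rpower (T / Rpower (INR n) rb) (- al))))) (seq 1 M)).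
{ intros T M HT. unfold pair_box. rewrite lsum_prod. apply lsum_le. intros n2 Hn2. apply in_seq in Hn2.
  cbn [fst snd]. pose proof (IS T (Rpower (INR n2) rb) M HT (Rpower_pos _ _)) as I.
  apply Rmult_le_compat_l with (r := Rpower (INR n2) (- u)) in I; [|left; apply Rpower_pos].
  rewrite <- lsum_scal in I. eapply Rle_trans; [|exact I]. right. apply lsum_ext.
  intros n3 Hn3. apply in_seq in Hn3. unfold pair_weight; cbn [fst snd]. fold ra rb rc u.
  rewrite <- Rmult_assoc. f_equal. f_equal. unfold bc_prod. rewrite mult_INR, !pow_INR.
  unfold rb, rc. rewrite !Rpower_pow; auto; (apply Rlt_le_trans with 1; [lra | apply INR_ge1; lia]). }
assert (Pq : forall T n, 0 < T -> (1 <= n)%nat ->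
  Rpower (INR n) (- u) * (T * Rpower (T / Rpower (INR n) rb) (- al)) = Rpower T B * Rpower (INR n) (- (1 / 2 + rb / (2 * rc)))).
{ intros T n HT Hn. apply INR_ge1 in Hn. rewrite EB.
  rewrite <- (Rpower_1 T) at 1 by lra. unfold Rpower at 1 2 3 5 6. rewrite <- !exp_plus. f_equal.
  rewrite ln_div by (try lra; apply Rpower_pos). unfold Rpower. rewrite ln_exp.
  unfold u, al. field. lra. }
destruct (Nat.eqb_spec b c) as [Ebc|Ebc].
- assert (Erb : rb = rc) by (unfold rb, rc; now rewrite Ebc).
  set (Cu := u / (u - 1)). assert (HCu : 0 < Cu) by (apply Rdiv_lt_0_compat; lra).
  exists (K * (2 + Cu)). split; [apply Rmult_lt_0_compat; lra|].
  intros T M HT. assert (HlnT : 1 <= ln T).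
  { rewrite <- (ln_exp 1). apply Rcomplements.ln_le; [apply exp_pos|]. pose proof exp_le_3. lra. }
  eapply Rle_trans; [apply St; lra|].
  (* Beyond Z the minimum is replaced by 1; the tail of n2^(-u) then contributes T Z^(1-u) = T^B. *)
  set (Z := Rpower T (/ rb)). assert (HZ : 1 <= Z).
  { apply Rpower_ge1; [lra|]. left; apply Rinv_0_lt_compat; lra. }
  destruct (nfloor_ex Z) as [k [Hk1 Hk2]]; [lra|].
  assert (Hk : (1 <= k)%nat).
  { destruct k; [simpl in Hk2; lra | lia]. }
  eapply Rle_trans; [apply (lsum_cut _ (fun n => K * Rpower T B * / INR n) (fun n => K * T * Rpower (INR n) (- u)) k)|].
  + intros n _. apply Rmult_le_pos; [left; apply Rpower_pos|]. apply Rmult_le_pos; [lra|].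
    apply Rmult_le_pos; [lra|]. apply Rmin_glb; [lra | left; apply Rpower_pos].
  + intros n Hn. 
    apply Rle_trans with (K * (Rpower (INR n) (- u) * (T * Rpower (T / Rpower (INR n) rb) (- al)))).
    * rewrite (Rmult_comm (Rpower (INR n) (- u))), !Rmult_assoc. apply Rmult_le_compat_l; [lra|].
      rewrite (Rmult_comm (Rpower (INR n) (- u))), !Rmult_assoc.
      apply Rmult_le_compat_l; [lra|]. apply Rmult_le_compat_r; [left; apply Rpower_pos | apply Rmin_r].
    * rewrite Pq by (lra || lia). right. rewrite Rmult_assoc. do 2 f_equal.
      rewrite Erb. replace (- (1 / 2 + rc / (2 * rc))) with (- (1)) by (field; lra).
      rewrite Rpower_Ropp, Rpower_1; [reflexivity|]. apply Rlt_le_trans with 1; [lra | apply INR_ge1; lia].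
  + intros n Hn. rewrite (Rmult_comm (K * T)). apply Rmult_le_compat_l; [left; apply Rpower_pos|].
    apply Rmult_le_compat_l; [lra|]. apply Rle_trans with (T * 1); [|lra]. apply Rmult_le_compat_l; [lra | apply Rmin_l].
  + rewrite !lsum_scal. pose proof (sum_harmonic k) as S1. pose proof (sum_power_tail u (S k) M Hu ltac:(lia)) as S2.
    fold Cu in S2.
    assert (Lk : ln (INR k) <= ln T).
    { apply Rle_trans with (ln Z).
      - apply Rcomplements.ln_le; [apply Rlt_le_trans with 1; [lra | now apply INR_ge1] | exact Hk1].
      - unfold Z, Rpower. rewrite ln_exp. rewrite <- (Rmult_1_l (ln T)) at 2. apply Rmult_le_compat_r; [lra|].
        rewrite <- Rinv_1. apply Rinv_le_contravar; lra. }
    assert (E3 : T * Rpower (INR (S k)) (1 - u) <= Rpower T B).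
    { apply Rle_trans with (T * Rpower Z (1 - u)).
      - apply Rmult_le_compat_l; [lra|]. apply Rpower_le_neg; rewrite ?S_INR; lra.
      - right. unfold Z. rewrite Rpower_mult, Rpower_mult_1 by lra. f_equal.
        unfold u, B. rewrite Erb. field. lra. }
    simpl. rewrite Rmult_1_r.
    pose proof (Rpower_pos T B) as PB. assert (HKB : 0 < K * Rpower T B) by (now apply Rmult_lt_0_compat).
    assert (A1 : K * Rpower T B * lsum (fun n => / INR n) (seq 1 k) <= K * Rpower T B * (2 * ln T))
      by (apply Rmult_le_compat_l; lra).
    assert (A2 : K * T * lsum (fun n => Rpower (INR n) (- u)) (seq (S k) M) <= K * Cu * Rpower T B).
    { apply Rle_trans with (K * T * (Cu * Rpower (INR (S k)) (1 - u))).
      - apply Rmult_le_compat_l; [apply Rmult_le_pos; lra | exact S2].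
      - replace (K * T * (Cu * Rpower (INR (S k)) (1 - u))) with (K * Cu * (T * Rpower (INR (S k)) (1 - u))) by ring.
        apply Rmult_le_compat_l; [apply Rmult_le_pos; lra | exact E3]. }
    assert (K * Cu * Rpower T B * 1 <= K * Cu * Rpower T B * ln T).
    { apply Rmult_le_compat_l; [|lra]. apply Rmult_le_pos; [apply Rmult_le_pos|]; lra. }
    lra.
- specialize (Hne Ebc). set (w := 1 / 2 + rb / (2 * rc)).
  assert (Hw : 1 < w).
  { unfold w. apply Rmult_lt_reg_r with (2 * rc); [lra|].
    replace ((1 / 2 + rb / (2 * rc)) * (2 * rc)) with (rc + rb) by (field; lra). lra. }
  set (Cw := w / (w - 1)). assert (HCw : 0 < Cw) by (apply Rdiv_lt_0_compat; lra).
  exists (K * Cw). split; [now apply Rmult_lt_0_compat|].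
  intros T M HT. eapply Rle_trans; [apply St; lra|]. simpl. rewrite Rmult_1_r.
  apply Rle_trans with (lsum (fun n => K * Rpower T B * Rpower (INR n) (- w)) (seq 1 M)).
  + apply lsum_le. intros n Hn. apply in_seq in Hn.
    apply Rle_trans with (K * (Rpower (INR n) (- u) * (T * Rpower (T / Rpower (INR n) rb) (- al)))).
    * rewrite (Rmult_comm (Rpower (INR n) (- u))), !Rmult_assoc. apply Rmult_le_compat_l; [lra|].
      rewrite (Rmult_comm (Rpower (INR n) (- u))), !Rmult_assoc.
      apply Rmult_le_compat_l; [lra|]. apply Rmult_le_compat_r; [left; apply Rpower_pos | apply Rmin_r].
    * rewrite Pq by (lra || lia). right; fold w; ring.
  + rewrite lsum_scal. pose proof (sum_power_tail w 1 M Hw (le_n 1)) as S. simpl (INR 1) in S.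
    rewrite Rpower_base1, Rmult_1_r in S. fold Cw in S.
    replace (K * Cw * Rpower T B) with (K * Rpower T B * Cw) by ring.
    apply Rmult_le_compat_l; [|exact S]. apply Rmult_le_pos; [lra | left; apply Rpower_pos].
Qed.

(** * The error terms *)

Lemma pair_weight_sum_bounded (a b c : nat) : (1 <= a)%nat -> (a < c)%nat -> (c <= b)%nat ->
  exists B, 0 < B /\ forall M, lsum (pair_weight a b c) (pair_box M) <= B.
Proof.
intros Ha Hac Hcb. apply INR_ge1 in Ha. apply lt_INR in Hac. apply le_INR in Hcb.
assert (H : forall k, INR a < k -> 1 < 1 / 2 + k / (2 * INR a)).
{ intros k Hk. apply Rmult_lt_reg_r with (2 * INR a); [lra|].
  replace ((1 / 2 + k / (2 * INR a)) * (2 * INR a)) with (INR a + k) by (field; lra). lra. }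
pose proof (H (INR b) ltac:(lra)) as Hb. pose proof (H (INR c) ltac:(lra)) as Hc.
set (u := 1 / 2 + INR b / (2 * INR a)) in *. set (v := 1 / 2 + INR c / (2 * INR a)) in *.
exists (u / (u - 1) * (v / (v - 1))). split.
- apply Rmult_lt_0_compat; apply Rdiv_lt_0_compat; lra.
- intros M. exact (pair_sum_product u v M Hb Hc).
Qed.

(** The bounded sum of pair weights excludes the value plus infinity, the empty list excludes minus
    infinity. *)
Lemma sigma_spec (a b c : nat) : (1 <= a)%nat -> (a < c)%nat -> (c <= b)%nat ->
  is_finite (sigma_abc a b c) /\
  (forall l, is_sol_list a b c l -> lsum sigma_term l <= real (sigma_abc a b c)) /\
  (forall X, (forall l, is_sol_list a b c l -> lsum sigma_term l <= X) -> real (sigma_abc a b c) <= X).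
Proof.
intros Ha Hac Hcb. destruct (pair_weight_sum_bounded a b c Ha Hac Hcb) as [B [HB HS]].
assert (Bd : forall l, is_sol_list a b c l -> lsum sigma_term l <= B).
{ intros l Hl. destruct (sigma_list_pairs a b c l Ha Hl) as [l' [D [E [P _]]]].
  destruct (pairs_in_box l' P) as [M HM]. rewrite E. eapply Rle_trans; [|apply (HS M)].
  apply lsum_incl; [exact D | exact HM |]. intros q _. left.
  apply Rmult_lt_0_compat; apply Rpower_pos. }
unfold sigma_abc.
match goal with |- is_finite (Lub_Rbar ?S) /\ _ => pose proof (Lub_Rbar_correct S) as [H1 H2] end.
match goal with |- is_finite ?S /\ _ => destruct S as [s| |] end.
- split; [reflexivity|]. split.
  + intros l [Hd Hf]. apply (H1 (lsum sigma_term l)). exists l. auto.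
  + intros X HX. apply (H2 X). intros x [l [Hd [Hf ->]]]. apply (HX l). now split.
- exfalso. apply (H2 B). intros x [l [Hd [Hf ->]]]. apply (Bd l). now split.
- exfalso. apply (H1 0). exists nil. split; [constructor | split; [constructor | reflexivity]].
Qed.

Lemma sigma_gt1 (a b c : nat) : (1 <= a)%nat -> (a < c)%nat -> (c <= b)%nat -> 1 < real (sigma_abc a b c).
Proof.
intros Ha Hac Hcb. destruct (sigma_spec a b c Ha Hac Hcb) as [_ [H _]].
pose proof (pow_ge1_nat 2 c ltac:(lia)). pose proof (pow_ge1_nat 2 a ltac:(lia)).
(* The first triple contributes exactly 1; the second is a solution since (2^c)^a = (2^a)^c. *)
eapply Rlt_le_trans; [|apply (H ((1, 1, 1) :: (2 ^ c, 1, 2 ^ a) :: nil)%nat)].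
- unfold lsum; simpl. rewrite !Rmult_1_r, Rpower_base1.
  match goal with |- 1 < 1 + (?x + 0) => assert (0 < x) by apply Rpower_pos end. lra.
- split.
  + constructor; [|constructor; [auto | constructor]]. intros [E|[]]. injection E as E1 E2.
    assert (2 ^ 1 <= 2 ^ c)%nat by (apply Nat.pow_le_mono_r; lia). simpl in *. lia.
  + constructor; [|constructor; [|constructor]].
    * unfold solution. rewrite !Nat.pow_1_l. lia.
    * unfold solution. rewrite Nat.pow_1_l, Nat.mul_1_l, <- !Nat.pow_mul_r.
      repeat split; try lia. f_equal; lia.
Qed.

(** W is used twice: in the off-diagonal sum, and through [diag_tail] for T times the missing part
    of sigma. *)
Lemma E_bound (a b c : nat) th Y CY : (2 <= a)%nat -> (a < c)%nat -> (c <= b)%nat -> 0 < th ->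
  INR a * th < 1 / 2 -> 1 / 2 < INR c * th -> admissible a b c Y CY ->
  exists K, 0 < K /\ forall T W, 1 <= T ->
   (forall M, lsum (fun q => pair_weight a b c q * Rmin T (Y q)) (pair_box M) <= W) ->
   Cmod (E_abc a b c T) <= K * (Rpower T (3 / 4) + Rpower T (1 / 2 + INR a * th) * (1 + ln T) + W).
Proof.
intros Ha Hac Hcb Hth Hat Hct Had.
destruct (mean_value a b c th Ha Hac Hcb Hth Hat Hct) as [K1 [H [HK1 [HH MV]]]].
apply le_INR in Ha as Ha'. simpl (INR 2) in Ha'. apply le_INR in Hcb as Hcb'.
assert (Hat0 : 0 < INR a * th) by (apply Rmult_lt_0_compat; lra).
assert (Hbt : 1 / 2 < INR b * th) by (apply Rlt_le_trans with (1 := Hct), Rmult_le_compat_r; lra).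
destruct (off_sum_bound a b c th Y CY ltac:(lia) ltac:(lra) Hbt Hct Had) as [K2 [HK2 OB]].
destruct (sigma_spec a b c ltac:(lia) Hac Hcb) as [_ [Sge Sle]].
pose proof (ln_nonneg H HH) as HLH.
exists (K1 + K2 * (H * (1 + ln H)) + K2 + 1).
assert (HKH : 0 < K2 * (H * (1 + ln H))) by (repeat apply Rmult_lt_0_compat; lra).
split; [lra|]. intros T W HT HW.
destruct (MV T HT) as [N [HN [[HN1 HN2] [M0 HM0]]]].
(* M must be large for the Dirichlet polynomials and at least N^a for [diag_tail]. *)
set (M := Nat.max M0 (N ^ a)). specialize (HM0 M ltac:(lia)).
pose proof (OB N M T W HN ltac:(lra) (HW M)) as O.
set (sg := real (sigma_abc a b c)) in *. set (dg := diag_sum a b c N M) in *.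
assert (D1 : dg <= sg) by (apply Sge, diag_is_sol_list).
assert (D2 : T * (sg - dg) <= W).
{ assert (sg <= dg + W / T).
  { apply Sle. intros l Hl.
    pose proof (diag_tail a b c Y CY N M T W ltac:(lia) ltac:(lia) ltac:(lia) Had ltac:(lra) HN ltac:(lia) HW l Hl) as D.
    fold dg in D. apply Rmult_le_reg_l with T; [lra|].
    replace (T * (dg + W / T)) with (T * dg + W) by (field; lra). lra. }
  apply Rle_trans with (T * (W / T)); [apply Rmult_le_compat_l; lra | right; field; lra]. }
assert (HW0 : 0 <= W).
{ apply Rle_trans with (2 := D2). apply Rmult_le_pos; lra. }
unfold E_abc. fold sg.
eapply Rle_trans; [apply Cmod_triangle3 with (y := RtoC (dg * T))|].
rewrite <- RtoC_minus, Cmod_R.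
assert (Ab : Rabs (dg * T - sg * T) <= W).
{ replace (dg * T - sg * T) with (- (T * (sg - dg))) by ring. rewrite Rabs_Ropp, Rabs_pos_eq; [exact D2|].
  apply Rmult_le_pos; lra. }
pose proof (ln_nonneg T HT) as HL.
set (P := Rpower T (1 / 2 + INR a * th)) in *. assert (HP : 0 < P) by apply Rpower_pos.
assert (ON : Rpower (INR N) (1 / 2 + INR a * th) * (1 + ln (INR N)) <= H * (1 + ln H) * (P * (1 + ln T))).
{ assert (HN0 := INR_ge1 N HN).
  apply Rle_trans with (H * P * (1 + (ln H + ln T))).
  - apply Rmult_le_compat; [left; apply Rpower_pos | pose proof (ln_nonneg _ HN0); lra | |].
    + apply Rle_trans with (Rpower (H * T) (1 / 2 + INR a * th)).
      * apply Rpower_le_l; lra.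
      * rewrite <- Rpower_mult_distr by lra. apply Rmult_le_compat_r; [lra|].
        apply Rle_trans with (Rpower H 1); [apply Rpower_le_r; lra | rewrite Rpower_1; lra].
    + rewrite <- ln_mult by lra. assert (ln (INR N) <= ln (H * T)) by (apply Rcomplements.ln_le; lra). lra.
  - replace (H * (1 + ln H) * (P * (1 + ln T))) with (H * P * ((1 + ln H) * (1 + ln T))) by ring.
    apply Rmult_le_compat_l; [apply Rmult_le_pos; lra|]. nra. }
assert (OK : K2 * (Rpower (INR N) (1 / 2 + INR a * th) * (1 + ln (INR N))) <= K2 * (H * (1 + ln H)) * (P * (1 + ln T))).
{ rewrite Rmult_assoc. apply Rmult_le_compat_l; lra. }
pose proof (Rpower_pos T (3 / 4)) as P34. set (Q := Rpower T (3 / 4)) in *.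
assert (HPL : 0 <= P * (1 + ln T)) by (apply Rmult_le_pos; lra).
assert (0 <= (K2 * (H * (1 + ln H)) + K2 + 1) * Q) by (apply Rmult_le_pos; lra).
assert (0 <= (K2 + 1) * (P * (1 + ln T))) by (apply Rmult_le_pos; lra).
assert (0 <= (K1 + K2 * (H * (1 + ln H))) * W) by (apply Rmult_le_pos; lra).
lra.
Qed.

(** * Admissible majorants and the two error bounds *)

Lemma near_bounds (a b c n1 n2 n3 : nat) : (1 <= a)%nat -> (1 <= n1)%nat -> (1 <= n2)%nat -> (1 <= n3)%nat ->
  Rabs (INR n1 - bc_root a b c n2 n3) < 1 -> INR n1 <= 2 * bc_root a b c n2 n3 /\ bc_root a b c n2 n3 <= 2 * INR n1.
Proof.
intros Ha H1 H2 H3 H. pose proof (bc_root_ge1 a b c n2 n3 Ha H2 H3). apply INR_ge1 in H1.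
apply Rabs_lt_between in H. lra.
Qed.

Lemma inv_freq_bound (a b c n1 n2 n3 : nat) M d : (1 <= n1)%nat -> (1 <= n2)%nat -> (1 <= n3)%nat ->
  INR (n1 ^ a) <= M -> INR (bc_prod b c n2 n3) <= M -> 0 < d <= Rabs (INR (bc_prod b c n2 n3) - INR (n1 ^ a)) ->
  3 / Rabs (freq (INR a) (INR b) (INR c) (n1, n2, n3)) <= 3 * (M / d).
Proof.
intros H1 H2 H3 HM1 HM2 Hd. rewrite freq_ln by assumption. fold (bc_prod b c n2 n3).
pose proof (bc_prod_ge1 b c n2 n3 H2 H3) as P1. assert (P2 := INR_ge1 _ (pow_ge1_nat n1 a H1)).
pose proof (ln_gap_abs (INR (bc_prod b c n2 n3)) (INR (n1 ^ a)) M ltac:(lra) ltac:(lra)) as G.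
set (L := Rabs (ln (INR (bc_prod b c n2 n3)) - ln (INR (n1 ^ a)))) in *.
assert (HL : 0 < L).
{ destruct (Rle_lt_or_eq_dec 0 L (Rabs_pos _)) as [|E]; [assumption|]. rewrite <- E in G. lra. }
apply Rmult_le_compat_l; [lra|].
apply Rmult_le_reg_r with L; [exact HL|]. rewrite Rinv_l by lra.
apply Rmult_le_reg_r with d; [lra|].
replace (M / d * L * d) with (M * L) by (field; lra). lra.
Qed.

(** Distinct integers differ by at least 1, and both n1^a and n2^b n3^c are at most 2^a n2^b n3^c
    near the diagonal, where n1 <= 2x. *)
Lemma admissible_trivial (a b c : nat) : (1 <= a)%nat ->
  admissible a b c (fun q => INR (bc_prod b c (fst q) (snd q))) (3 * 2 ^ a).
Proof.
intros Ha. assert (H2a : 1 <= 2 ^ a) by (apply pow_R1_Rle; lra). split; [lra|]. split.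
- intros n2 n3 H2 H3; cbn [fst snd]. pose proof (bc_prod_ge1 b c n2 n3 H2 H3) as P. unfold bc_root.
  apply Rle_trans with (Rpower (INR (bc_prod b c n2 n3)) 1); [|rewrite Rpower_1; lra].
  apply Rpower_le_r; [exact P|]. apply INR_ge1 in Ha. rewrite <- Rinv_1. apply Rinv_le_contravar; lra.
- intros n1 n2 n3 H1 H2 H3 Hne Hn; cbn [fst snd].
  destruct (near_bounds a b c n1 n2 n3 Ha H1 H2 H3 Hn) as [N1 N2].
  pose proof (bc_prod_ge1 b c n2 n3 H2 H3) as P. pose proof (bc_root_pow a b c n2 n3 Ha H2 H3) as X.
  pose proof (bc_root_ge1 a b c n2 n3 Ha H2 H3) as Hx.
  eapply Rle_trans; [apply (inv_freq_bound a b c n1 n2 n3 (2 ^ a * INR (bc_prod b c n2 n3)) 1); auto|].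
  + rewrite pow_INR, <- X, <- Rpow_mult_distr. apply pow_incr. apply INR_ge1 in H1. lra.
  + nra.
  + split; [lra|]. destruct (Nat.lt_total (bc_prod b c n2 n3) (n1 ^ a)) as [L|[L|L]].
    * apply le_INR in L. rewrite S_INR in L. rewrite Rabs_left1; lra.
    * congruence.
    * apply le_INR in L. rewrite S_INR in L. rewrite Rabs_pos_eq; lra.
  + right; field.
Qed.

(** The conjectured lower bound for the difference, divided into n1^a, leaves n1^(1+eps) n2 n3, and
    n1 <= 2x. The factor 2^a covers n2^b n3^c = x^a <= (2 n1)^a. *)
Lemma admissible_abc (a b c : nat) eps : (1 <= a)%nat -> (1 <= b)%nat -> (1 <= c)%nat -> 0 < eps -> ConjectureW ->
  exists CY, admissible a b c
   (fun q => Rpower (bc_root a b c (fst q) (snd q)) (1 + eps) * INR (fst q) * INR (snd q)) CY.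
Proof.
intros Ha Hb Hc He HW. destruct (HW eps a b c He Ha Hb Hc) as [K [HK HD]].
set (CY := 3 * 2 ^ a * Rpower 2 (1 + eps) / K).
exists (Rmax 1 CY). split; [apply Rmax_l|]. split.
- intros n2 n3 H2 H3; cbn [fst snd]. pose proof (bc_root_ge1 a b c n2 n3 Ha H2 H3) as Hx.
  apply INR_ge1 in H2. apply INR_ge1 in H3.
  assert (bc_root a b c n2 n3 <= Rpower (bc_root a b c n2 n3) (1 + eps)).
  { apply Rle_trans with (Rpower (bc_root a b c n2 n3) 1); [rewrite Rpower_1; lra | apply Rpower_le_r; lra]. }
  rewrite Rmult_assoc. rewrite <- (Rmult_1_r (bc_root a b c n2 n3)) at 1.
  apply Rmult_le_compat; nra.
- intros n1 n2 n3 H1 H2 H3 Hne Hn; cbn [fst snd].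
  destruct (near_bounds a b c n1 n2 n3 Ha H1 H2 H3 Hn) as [N1 N2].
  pose proof (bc_root_pow a b c n2 n3 Ha H2 H3) as X. pose proof (bc_root_ge1 a b c n2 n3 Ha H2 H3) as Hx.
  specialize (HD n1 n2 n3 H1 H2 H3). cbv zeta in HD.
  assert (ED : INR n1 ^ a - INR n2 ^ b * INR n3 ^ c = INR (n1 ^ a) - INR (bc_prod b c n2 n3))
    by (unfold bc_prod; rewrite mult_INR, !pow_INR; reflexivity).
  rewrite ED in HD. specialize (HD ltac:(intros E; apply Hne, INR_eq; lra)).
  rewrite Rabs_minus_sym in HD.
  apply INR_ge1 in H1 as H1'. apply INR_ge1 in H2 as H2'. apply INR_ge1 in H3 as H3'.
  set (d := K * (Rpower (INR n1) (INR a - 1 - eps) * / INR n2 * / INR n3)) in *.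
  pose proof (Rpower_pos (INR n1) (INR a - 1 - eps)) as PR.
  assert (Hd : 0 < d).
  { apply Rmult_lt_0_compat; [exact HK|]. apply Rmult_lt_0_compat; [apply Rmult_lt_0_compat; [exact PR|]|];
     apply Rinv_0_lt_compat; lra. }
  assert (H2a : 0 < 2 ^ a) by (apply pow_lt; lra).
  assert (HM1 : INR (n1 ^ a) <= 2 ^ a * INR n1 ^ a).
  { rewrite pow_INR. assert (1 <= 2 ^ a) by (apply pow_R1_Rle; lra). assert (0 < INR n1 ^ a) by (apply pow_lt; lra). nra. }
  assert (HM2 : INR (bc_prod b c n2 n3) <= 2 ^ a * INR n1 ^ a).
  { rewrite <- X, <- Rpow_mult_distr. apply pow_incr. lra. }
  eapply Rle_trans; [apply (inv_freq_bound a b c n1 n2 n3 (2 ^ a * INR n1 ^ a) d); auto|].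
  assert (EM : 3 * (2 ^ a * INR n1 ^ a / d) = 3 * 2 ^ a / K * (Rpower (INR n1) (1 + eps) * INR n2 * INR n3)).
  { unfold d. replace (INR n1 ^ a) with (Rpower (INR n1) (1 + eps) * Rpower (INR n1) (INR a - 1 - eps)).
    - field. repeat split; lra.
    - rewrite <- Rpower_plus, <- Rpower_pow by lra. f_equal. ring. }
  rewrite EM.
  assert (Pw : Rpower (INR n1) (1 + eps) <= Rpower 2 (1 + eps) * Rpower (bc_root a b c n2 n3) (1 + eps)).
  { rewrite Rpower_mult_distr by lra. apply Rpower_le_l; lra. }
  set (S := Rpower (bc_root a b c n2 n3) (1 + eps) * INR n2 * INR n3).
  assert (HS : 0 < S) by (apply Rmult_lt_0_compat; [apply Rmult_lt_0_compat; [apply Rpower_pos|]|]; lra).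
  apply Rle_trans with (CY * S).
  + unfold CY, S. 
    replace (3 * 2 ^ a * Rpower 2 (1 + eps) / K * (Rpower (bc_root a b c n2 n3) (1 + eps) * INR n2 * INR n3)) with
     (3 * 2 ^ a / K * (Rpower 2 (1 + eps) * Rpower (bc_root a b c n2 n3) (1 + eps) * INR n2 * INR n3)) by (field; lra).
    apply Rmult_le_compat_l; [left; apply Rdiv_lt_0_compat; lra|].
    apply Rmult_le_compat_r; [lra|]. apply Rmult_le_compat_r; [lra | exact Pw].
  + apply Rmult_le_compat_r; [lra | apply Rmax_r].
Qed.

Lemma Rpower_log_absorb e f : e < f -> exists K, 0 < K /\ forall T, 1 <= T ->
  Rpower T e * (1 + ln T) <= K * Rpower T f.
Proof.
intros H. assert (Hi : 0 < / (f - e)) by (apply Rinv_0_lt_compat; lra).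
exists (1 + / (f - e)). split; [lra|]. intros T HT.
pose proof (log_bound (f - e) (ln T) ltac:(lra) (ln_nonneg T HT)) as L.
replace f with (e + (f - e)) at 2 by ring. rewrite Rpower_plus.
pose proof (Rpower_pos T e). unfold Rpower in *. nra.
Qed.

(** As th decreases to 1/(2c), a th tends to [lo] = a/(2c). This lies below [u1] because (a-1)(c-a)
    > 0 and below [u2] because a < c; a th is put midway. Since [u1] < 1/2, also a th < 1/2. *)
Lemma exists_theta (a c : nat) : (2 <= a)%nat -> (a < c)%nat -> exists th, 0 < th /\
  INR a * th < 1 / 2 /\ 1 / 2 < INR c * th /\
  1 / 2 + INR a * th < 1 - 1 / (2 * INR a) + 1 / (2 * INR c) /\
  1 / 2 + INR a * th < 1 / 2 + INR a / (INR a + INR c).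
Proof.
intros Ha Hac. apply le_INR in Ha. simpl (INR 2) in Ha. apply lt_INR in Hac.
set (ra := INR a) in *. set (rc := INR c) in *.
set (u1 := 1 / 2 - 1 / (2 * ra) + 1 / (2 * rc)). set (u2 := ra / (ra + rc)). set (lo := ra / (2 * rc)).
assert (L1 : lo < u1).
{ unfold lo, u1. apply Rmult_lt_reg_r with (2 * ra * rc); [nra|].
  replace (ra / (2 * rc) * (2 * ra * rc)) with (ra * ra) by (field; lra).
  replace ((1 / 2 - 1 / (2 * ra) + 1 / (2 * rc)) * (2 * ra * rc)) with (ra * rc - rc + ra) by (field; lra). nra. }
assert (L2 : lo < u2).
{ unfold lo, u2. apply Rmult_lt_reg_r with (2 * rc * (ra + rc)); [nra|].
  replace (ra / (2 * rc) * (2 * rc * (ra + rc))) with (ra * (ra + rc)) by (field; lra).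
  replace (ra / (ra + rc) * (2 * rc * (ra + rc))) with (ra * (2 * rc)) by (field; lra). nra. }
assert (U1 : u1 < 1 / 2).
{ unfold u1. assert (1 / (2 * rc) < 1 / (2 * ra)) by (apply Rmult_lt_compat_l; [lra|]; apply Rinv_lt_contravar; nra). lra. }
set (al := (lo + Rmin u1 u2) / 2).
assert (HM : lo < Rmin u1 u2) by (now apply Rmin_glb_lt).
pose proof (Rmin_l u1 u2) as M1. pose proof (Rmin_r u1 u2) as M2.
assert (Hlo : 0 < lo) by (apply Rdiv_lt_0_compat; lra).
exists (al / ra). replace (ra * (al / ra)) with al by (field; lra).
assert (Hal : lo < al < Rmin u1 u2) by (unfold al; lra).
split; [apply Rdiv_lt_0_compat; lra|]. split; [lra|]. split.
- replace (rc * (al / ra)) with (al / ra * rc) by ring.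
  apply Rle_lt_trans with (lo / ra * rc); [right; unfold lo; field; lra|].
  apply Rmult_lt_compat_r; [lra|]. apply Rmult_lt_compat_r; [apply Rinv_0_lt_compat; lra | lra].
- fold u2. unfold u1 in *. lra.
Qed.

Lemma ln_ge1 T : 3 <= T -> 1 <= ln T.
Proof.
intros HT. rewrite <- (ln_exp 1). apply Rcomplements.ln_le; [apply exp_pos|]. pose proof exp_le_3. lra.
Qed.

Lemma error_unconditional (a b c : nat) : (2 <= a)%nat -> (a < c)%nat -> (c <= b)%nat ->
  dominated_at_infty (E_abc a b c)
    (fun T => Rpower T (1 - 1 / (2 * INR a) + 1 / (2 * INR c)) * (ln T) ^ (if Nat.eqb b c then 1 else 0)).
Proof.
intros Ha Hac Hcb. destruct (exists_theta a c Ha Hac) as [th [T1 [T2 [T3 [T4 _]]]]].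
destruct (E_bound a b c th _ _ Ha Hac Hcb T1 T2 T3 (admissible_trivial a b c ltac:(lia))) as [K [HK EB]].
destruct (pair_sum_uncond a b c ltac:(lia) Hac Hcb) as [K2 [HK2 PS]].
destruct (Rpower_log_absorb _ _ T4) as [K3 [HK3 LA]].
apply le_INR in Ha. simpl (INR 2) in Ha. apply lt_INR in Hac.
set (B := 1 - 1 / (2 * INR a) + 1 / (2 * INR c)) in *.
(* Because a >= 2, the T^(3/4) from the horizontal sides is admissible. *)
assert (HB : 3 / 4 <= B).
{ unfold B. assert (1 / (2 * INR a) <= 1 / 4) by (apply Rmult_le_compat_l; [lra|]; apply Rinv_le_contravar; lra).
  assert (0 < 1 / (2 * INR c)) by (apply Rdiv_lt_0_compat; lra). lra. }
exists (K * (1 + K3 + K2)), 3. intros T HT.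
eapply Rle_trans; [exact (EB T _ ltac:(lra) (fun M => PS T M HT))|].
specialize (LA T ltac:(lra)).
set (L := ln T ^ (if Nat.eqb b c then 1 else 0)) in *.
assert (HL : 1 <= L) by (apply pow_R1_Rle, ln_ge1, HT).
assert (P34 : Rpower T (3 / 4) <= Rpower T B) by (apply Rpower_le_r; lra).
pose proof (Rpower_pos T B) as PB. rewrite Rmult_assoc. apply Rmult_le_compat_l; [lra|].
assert (Rpower T B <= Rpower T B * L) by nra.
assert (K3 * Rpower T B <= K3 * (Rpower T B * L)) by (apply Rmult_le_compat_l; lra). lra.
Qed.

Lemma error_conditional (a b c : nat) eps : (2 <= a)%nat -> (a < c)%nat -> (c <= b)%nat -> ConjectureW -> 0 < eps ->
  dominated_at_infty (E_abc a b c)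
    (fun T => Rpower T (1 / 2 + INR a / (INR a + INR c) + eps) + Rpower T (3 / 4) * ln T).
Proof.
intros Ha Hac Hcb HW He. destruct (exists_theta a c Ha Hac) as [th [T1 [T2 [T3 [_ T4]]]]].
destruct (admissible_abc a b c eps ltac:(lia) ltac:(lia) ltac:(lia) He HW) as [CY Had].
destruct (E_bound a b c th _ _ Ha Hac Hcb T1 T2 T3 Had) as [K [HK EB]].
destruct (pair_sum_cond a b c eps ltac:(lia) Hac Hcb He) as [K2 [HK2 PS]].
destruct (Rpower_log_absorb _ (1 / 2 + INR a / (INR a + INR c) + eps) ltac:(apply Rlt_trans with (1 := T4); lra))
  as [K3 [HK3 LA]].
set (B := 1 / 2 + INR a / (INR a + INR c) + eps) in *.
exists (K * (1 + K3 + K2)), 3. intros T HT.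
eapply Rle_trans; [exact (EB T _ ltac:(lra) (fun M => PS T M ltac:(lra)))|].
specialize (LA T ltac:(lra)). pose proof (ln_ge1 T HT).
pose proof (Rpower_pos T B) as PB. pose proof (Rpower_pos T (3 / 4)) as P34.
rewrite Rmult_assoc. apply Rmult_le_compat_l; [lra|].
assert (Rpower T (3 / 4) <= Rpower T (3 / 4) * ln T) by nra.
assert (0 <= (K3 + K2) * (Rpower T (3 / 4) * ln T)) by (apply Rmult_le_pos; lra). lra.
Qed.

(** * Computability of sigma *)

Lemma rec_ext f g : recursive f -> (forall l, f l = g l) -> recursive g.
Proof. intros H E. replace g with f; [exact H|]. apply functional_extensionality; exact E. Qed.

Lemma rec_app1 (F : nat -> nat) g : recursive (fun l => F (nth 0 l 0%nat)) -> recursive g ->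
  recursive (fun l => F (g l)).
Proof. intros HF Hg. exact (rec_comp _ (g :: nil) HF (Forall_cons _ Hg (Forall_nil _))). Qed.

Lemma rec_app2 (F : nat -> nat -> nat) g h : recursive (fun l => F (nth 0 l 0%nat) (nth 1 l 0%nat)) ->
  recursive g -> recursive h -> recursive (fun l => F (g l) (h l)).
Proof.
intros HF Hg Hh.
exact (rec_comp _ (g :: h :: nil) HF (Forall_cons _ Hg (Forall_cons _ Hh (Forall_nil _)))).
Qed.

Lemma rec_S g : recursive g -> recursive (fun l => S (g l)).
Proof. apply (rec_app1 S), rec_succ. Qed.

Lemma rec_const k : recursive (fun _ => k).
Proof. induction k; [apply rec_zero | now apply rec_S]. Qed.

Lemma rec_add g h : recursive g -> recursive h -> recursive (fun l => g l + h l)%nat.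
Proof.
apply (rec_app2 Nat.add).
eapply rec_ext; [apply (rec_prim (fun l => nth 0 l 0%nat) (fun l => S (nth 1 l 0%nat)))|].
- apply rec_proj.
- apply rec_S, rec_proj.
- intros [|x [|y l]]; simpl; [reflexivity | |]; induction x; simpl; auto.
Qed.

Lemma rec_mul g h : recursive g -> recursive h -> recursive (fun l => g l * h l)%nat.
Proof.
apply (rec_app2 Nat.mul).
eapply rec_ext; [apply (rec_prim (fun _ => 0%nat) (fun l => (nth 2 l 0 + nth 1 l 0)%nat))|].
- apply rec_zero.
- apply rec_add; apply rec_proj.
- intros [|x [|y l]]; simpl; [reflexivity | |]; induction x; simpl; auto.
Qed.

Lemma rec_pred g : recursive g -> recursive (fun l => Nat.pred (g l)).
Proof.
apply (rec_app1 Nat.pred).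
eapply rec_ext; [apply (rec_prim (fun _ => 0%nat) (fun l => nth 0 l 0%nat))|].
- apply rec_zero.
- apply rec_proj.
- intros [|[|x] l]; reflexivity.
Qed.

Lemma rec_sub g h : recursive g -> recursive h -> recursive (fun l => g l - h l)%nat.
Proof.
intros Hg Hh. apply (rec_app2 (fun x y => (y - x)%nat) h g); auto.
eapply rec_ext; [apply (rec_prim (fun l => nth 0 l 0%nat) (fun l => Nat.pred (nth 1 l 0%nat)))|].
- apply rec_proj.
- apply rec_pred, rec_proj.
- intros [|x l]; simpl; [reflexivity|]. induction x as [|x IH]; simpl; [now rewrite Nat.sub_0_r|].
  rewrite IH. lia.
Qed.

Lemma rec_pow g k : recursive g -> recursive (fun l => g l ^ k)%nat.
Proof. intros H. induction k; simpl; [apply rec_const | now apply rec_mul]. Qed.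

Definition ind_le (x y : nat) : nat := (1 - (x - y))%nat.

Lemma rec_ind_le g h : recursive g -> recursive h -> recursive (fun l => ind_le (g l) (h l)).
Proof. intros Hg Hh. apply rec_sub; [apply rec_const | now apply rec_sub]. Qed.

Definition nsum (f : nat -> nat) (n : nat) : nat := nat_rec (fun _ => nat) 0%nat (fun i r => (r + f i)%nat) n.

(* The environment is cut to k entries, since [rec_comp] feeds finitely many arguments. *)
Lemma rec_nsum f h k : recursive f -> recursive h ->
  recursive (fun l => nsum (fun i => f (i :: map (fun j => nth j l 0%nat) (seq 0 k))) (h l)).
Proof.
intros Hf Hh.
set (g := fun l : list nat => (nth 1 l 0 + f (nth 0 l 0 :: map (fun j => nth (S (S j)) l 0) (seq 0 k)))%nat).
assert (Hg : recursive g).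
{ apply rec_add; [apply rec_proj|].
  eapply rec_ext.
  - apply (rec_comp f ((fun l => nth 0 l 0%nat) :: map (fun j l => nth (S (S j)) l 0%nat) (seq 0 k)) Hf).
    constructor; [apply rec_proj|]. apply Forall_forall. intros x Hx. apply in_map_iff in Hx.
    destruct Hx as [j [<- _]]. apply rec_proj.
  - intros l. simpl. now rewrite map_map. }
pose proof (rec_prim (fun _ => 0%nat) g rec_zero Hg) as P.
eapply rec_ext.
- apply (rec_comp _ (h :: map (fun j l => nth j l 0%nat) (seq 0 k)) P).
  constructor; [exact Hh|]. apply Forall_forall. intros x Hx. apply in_map_iff in Hx.
  destruct Hx as [j [<- _]]. apply rec_proj.
- intros l. simpl. rewrite map_map. unfold nsum.
  induction (h l) as [|n IH]; simpl; [reflexivity|]. rewrite IH. unfold g at 1. simpl.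
  f_equal. f_equal. f_equal. apply map_ext_in. intros j Hj. apply in_seq in Hj.
  rewrite (nth_indep _ 0%nat (nth 0 l 0%nat)) by (rewrite length_map, length_seq; lia).
  rewrite (map_nth (fun j => nth j l 0%nat)), seq_nth by lia. reflexivity.
Qed.

Lemma nsum_S f n : nsum f (S n) = (nsum f n + f n)%nat.
Proof. reflexivity. Qed.

Lemma INR_nsum f n : INR (nsum f n) = lsum (fun i => INR (f i)) (seq 0 n).
Proof.
induction n as [|n IH]; [reflexivity|]. rewrite nsum_S, plus_INR, lsum_seq_S, IH. reflexivity.
Qed.

(** The integer part of r is the number of positive integers up to r; counting them among n
    candidates is a bounded sum, hence recursive. *)
Lemma nsum_floor (f : nat -> nat) r n : 0 <= r <= INR n ->
  (forall k, f k = if Rle_dec (INR (S k)) r then 1%nat else 0%nat) ->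
  INR (nsum f n) <= r < INR (nsum f n) + 1.
Proof.
intros [Hr0 Hrn] Hf.
(* Either every candidate so far has been counted, or the count has already reached the integer
   part. *)
assert (I : forall m, INR (nsum f m) <= r /\ (nsum f m = m \/ r < INR (nsum f m) + 1)).
{ induction m as [|m [I1 I2]]; [simpl; auto|].
  rewrite nsum_S, Hf. destruct (Rle_dec (INR (S m)) r) as [H|H].
  - assert (E : nsum f m = m).
    { destruct I2 as [I2|I2]; [exact I2|].
      assert (B : (nsum f m <= m)%nat).
      { clear - Hf. induction m as [|m IH]; [auto|]. rewrite nsum_S, Hf. destruct (Rle_dec _ _); lia. }
      assert (L : INR (S m) < INR (S (nsum f m))) by (rewrite (S_INR (nsum f m)); lra).
      apply INR_lt in L. lia. }
    rewrite E. replace (m + 1)%nat with (S m) by lia. auto.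
  - rewrite Nat.add_0_r. split; [exact I1|]. right. apply Rnot_le_lt in H.
    destruct I2 as [I2|I2]; [|exact I2]. rewrite I2, <- S_INR. exact H. }
destruct (I n) as [I1 [I2|I2]]; [|lra]. rewrite I2 in I1 |- *. lra.
Qed.

Lemma ind_le_spec x y : ind_le x y = if (x <=? y)%nat then 1%nat else 0%nat.
Proof. unfold ind_le. destruct (Nat.leb_spec x y); lia. Qed.

(* [floor_isqrt Q m] is the integer part of Q / sqrt m. *)
Definition floor_div (U V : nat) : nat := nsum (fun k => ind_le (S k * V) U) U.
Definition floor_isqrt (Q m : nat) : nat := nsum (fun k => ind_le (S k ^ 2 * m) (Q ^ 2)) Q.

Lemma floor_div_spec U V : (1 <= V)%nat ->
  INR (floor_div U V) <= INR U / INR V < INR (floor_div U V) + 1.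
Proof.
intros HV. apply INR_ge1 in HV as HV'. unfold floor_div. pose proof (pos_INR U). apply nsum_floor.
- split; [apply Rcomplements.Rdiv_le_0_compat; lra|].
  apply Rmult_le_reg_r with (INR V); [lra|]. unfold Rdiv. rewrite Rmult_assoc, Rinv_l by lra. nra.
- intros k. rewrite ind_le_spec. destruct (Nat.leb_spec (S k * V) U) as [L|L]; destruct (Rle_dec _ _) as [D|D]; auto; exfalso.
  + apply D. apply le_INR in L. rewrite mult_INR in L.
    apply Rmult_le_reg_r with (INR V); [lra|]. unfold Rdiv. rewrite Rmult_assoc, Rinv_l; lra.
  + apply lt_INR in L. rewrite mult_INR in L.
    apply Rmult_le_compat_r with (r := INR V) in D; [|lra]. unfold Rdiv in D. rewrite Rmult_assoc, Rinv_l in D by lra. lra.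
Qed.

Lemma Rpower_half_sq x : 0 < x -> Rpower x (- (1 / 2)) ^ 2 * x = 1.
Proof.
intros Hx. simpl. rewrite Rmult_1_r, <- Rpower_plus.
replace (- (1 / 2) + - (1 / 2)) with (- (1)) by field. rewrite Rpower_Ropp, Rpower_1 by exact Hx. field; lra.
Qed.

Lemma floor_isqrt_spec Q m : (1 <= m)%nat ->
  INR (floor_isqrt Q m) <= INR Q * Rpower (INR m) (- (1 / 2)) < INR (floor_isqrt Q m) + 1.
Proof.
intros Hm. apply INR_ge1 in Hm as Hm'. pose proof (pos_INR Q) as HQ.
pose proof (Rpower_half_sq (INR m) ltac:(lra)) as Sq. set (s := Rpower (INR m) (- (1 / 2))) in *.
assert (Hs : 0 < s) by apply Rpower_pos.
assert (Hs1 : s <= 1) by nra.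
unfold floor_isqrt. apply nsum_floor; [split; nra|].
intros k. rewrite ind_le_spec. pose proof (INR_S_ge1 k) as Hk.
assert (E : (S k ^ 2 * m <= Q ^ 2)%nat <-> INR (S k) ^ 2 * INR m <= INR Q ^ 2).
{ rewrite <- !pow_INR, <- mult_INR. split; [apply le_INR | apply INR_le]. }
destruct (Nat.leb_spec (S k ^ 2 * m) (Q ^ 2)) as [L|L]; destruct (Rle_dec _ _) as [D|D]; auto; exfalso.
- apply D. apply E in L. apply Rsqr_incr_0_var; [|nra]. unfold Rsqr.
  apply Rmult_le_reg_r with (INR m); [lra|].
  replace (INR Q * s * (INR Q * s) * INR m) with (INR Q ^ 2 * (s ^ 2 * INR m)) by ring. rewrite Sq. simpl in *; lra.
- apply Nat.lt_nge in L. apply L, E.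
  apply Rle_trans with ((INR Q * s) ^ 2 * INR m).
  + apply Rmult_le_compat_r; [lra|]. apply pow_incr. lra.
  + right. replace ((INR Q * s) ^ 2 * INR m) with (INR Q ^ 2 * (s ^ 2 * INR m)) by ring. rewrite Sq. ring.
Qed.

Definition ind_eq (x y : nat) : nat := (ind_le x y * ind_le y x)%nat.

Lemma ind_eq_spec x y : ind_eq x y = if Nat.eqb x y then 1%nat else 0%nat.
Proof.
unfold ind_eq. rewrite !ind_le_spec.
destruct (Nat.leb_spec x y), (Nat.leb_spec y x), (Nat.eqb_spec x y); simpl; lia.
Qed.

(* Q times the sum of the sigma terms over a box, each term rounded down. *)
Definition box_floor (a b c N M Q : nat) : nat :=
  nsum (fun i1 => nsum (fun i2 => nsum (fun i3 =>
    (ind_eq (S i1 ^ a) (S i2 ^ b * S i3 ^ c) * floor_isqrt Q (S i1 * S i2 * S i3))%nat) M) M) N.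

Lemma lsum_shift (f : nat -> R) n : lsum f (seq 1 n) = lsum (fun i => f (S i)) (seq 0 n).
Proof. rewrite <- seq_shift. apply lsum_map. Qed.

Lemma lsum_const_seq (k : R) s n : lsum (fun _ : nat => k) (seq s n) = INR n * k.
Proof. induction n as [|n IH]; [unfold lsum; simpl; ring|]. rewrite lsum_seq_S, IH, S_INR. ring. Qed.

Lemma lsum_approx (f g : nat -> R) n d : (forall i, f i <= g i <= f i + d) ->
  lsum f (seq 0 n) <= lsum g (seq 0 n) <= lsum f (seq 0 n) + INR n * d.
Proof.
intros H. split; [apply lsum_le; intros; apply H|].
rewrite <- (lsum_const_seq d 0 n), <- lsum_plus. apply lsum_le. intros; apply H.
Qed.

Lemma box_floor_spec a b c N M Q :
  INR (box_floor a b c N M Q) <= INR Q * diag_sum a b c N M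
   <= INR (box_floor a b c N M Q) + INR N * (INR M * (INR M * 1)).
Proof.
assert (E : INR Q * diag_sum a b c N M = lsum (fun i1 => lsum (fun i2 => lsum (fun i3 =>
   INR Q * (if sol_b a b c (S i1, S i2, S i3) then sigma_term (S i1, S i2, S i3) else 0))
    (seq 0 M)) (seq 0 M)) (seq 0 N)).
{ unfold diag_sum, triple_box. rewrite lsum_filter, <- lsum_scal, !lsum_prod, lsum_shift.
  apply lsum_ext. intros i1 _. rewrite lsum_shift. apply lsum_ext. intros i2 _. apply lsum_shift. }
rewrite E. unfold box_floor. rewrite INR_nsum. apply lsum_approx. intros i1.
rewrite INR_nsum. apply lsum_approx. intros i2. rewrite INR_nsum. apply lsum_approx. intros i3.
rewrite mult_INR, ind_eq_spec. unfold sol_b. destruct (Nat.eqb_spec (S i1 ^ a) (S i2 ^ b * S i3 ^ c)).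
- simpl (INR 1). pose proof (floor_isqrt_spec Q (S i1 * S i2 * S i3) ltac:(lia)) as F.
  unfold sigma_term. rewrite !mult_INR in F. lra.
- simpl (INR 0). lra.
Qed.

(** * The algorithm for sigma and its error *)

Definition n1_bound (K e n : nat) : nat := ((K * S n) ^ e)%nat.
Definition n23_bound (a K e n : nat) : nat := (n1_bound K e n ^ a)%nat.
(** Scaled so that rounding down every term of the box, each by at most one unit, costs at most
    1/(8(n+1)) in total. *)
Definition precision (a K e n : nat) : nat := (8 * S n * (n1_bound K e n * (n23_bound a K e n * n23_bound a K e n)))%nat.
Definition scaled_sum (a b c K e n : nat) : nat := box_floor a b c (n1_bound K e n) (n23_bound a K e n) (precision a K e n).
(* (n + 1) * scaled_sum / precision, rounded to the nearest integer. *)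
Definition sigma_num (a b c K e n : nat) : nat :=
  floor_div (2 * S n * scaled_sum a b c K e n + precision a K e n) (2 * precision a K e n).

Lemma rec_n1_bound K e g : recursive g -> recursive (fun l => n1_bound K e (g l)).
Proof. intros H. unfold n1_bound. apply rec_pow, rec_mul; [apply rec_const | now apply rec_S]. Qed.

Lemma rec_n23_bound a K e g : recursive g -> recursive (fun l => n23_bound a K e (g l)).
Proof. intros H. unfold n23_bound. now apply rec_pow, rec_n1_bound. Qed.

Lemma rec_precision a K e g : recursive g -> recursive (fun l => precision a K e (g l)).
Proof.
intros H. unfold precision. apply rec_mul; [apply rec_mul; [apply rec_const | now apply rec_S]|].
apply rec_mul; [now apply rec_n1_bound | apply rec_mul; now apply rec_n23_bound].
Qed.

(** Each nested sum pushes its index in front of the environment. In the innermost test position 0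
    is the candidate integer part, positions 1, 2, 3 are the indices for n3, n2, n1, and position 4
    is the input n. *)
Lemma rec_scaled_sum a b c K e : recursive (fun l => scaled_sum a b c K e (nth 0 l 0%nat)).
Proof.
set (v := fun i (l : list nat) => nth i l 0%nat).
assert (Hv : forall i, recursive (v i)) by apply rec_proj.
set (t1 := fun l => ind_le (S (v 0%nat l) ^ 2 * (S (v 3%nat l) * S (v 2%nat l) * S (v 1%nat l))) (precision a K e (v 4%nat l) ^ 2)).
assert (H1 : recursive t1).
{ apply rec_ind_le; [apply rec_mul; [apply rec_pow | apply rec_mul; [apply rec_mul|]] | apply rec_pow, rec_precision];
   try apply rec_S; apply Hv. }
set (t2 := fun l => (ind_eq (S (v 2%nat l) ^ a) (S (v 1%nat l) ^ b * S (v 0%nat l) ^ c) *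
   nsum (fun k => t1 (k :: map (fun j => nth j l 0%nat) (seq 0 4))) (precision a K e (v 3%nat l)))%nat).
assert (H2 : recursive t2).
{ apply rec_mul; [|apply rec_nsum; [exact H1 | apply rec_precision, Hv]].
  apply rec_mul; apply rec_ind_le; try apply rec_mul; apply rec_pow, rec_S, Hv. }
set (t3 := fun l => nsum (fun k => t2 (k :: map (fun j => nth j l 0%nat) (seq 0 3))) (n23_bound a K e (v 2%nat l))).
assert (H3 : recursive t3) by (apply rec_nsum; [exact H2 | apply rec_n23_bound, Hv]).
set (t4 := fun l => nsum (fun k => t3 (k :: map (fun j => nth j l 0%nat) (seq 0 2))) (n23_bound a K e (v 1%nat l))).
assert (H4 : recursive t4) by (apply rec_nsum; [exact H3 | apply rec_n23_bound, Hv]).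
exact (rec_nsum t4 _ 1 H4 (rec_n1_bound K e _ (Hv 0%nat))).
Qed.

Lemma rec_floor_div g h : recursive g -> recursive h -> recursive (fun l => floor_div (g l) (h l)).
Proof.
apply (rec_app2 floor_div).
set (t := fun l : list nat => ind_le (S (nth 0 l 0%nat) * nth 2 l 0%nat) (nth 1 l 0%nat)).
assert (H : recursive t).
{ apply rec_ind_le; [apply rec_mul; [apply rec_S|]|]; apply rec_proj. }
exact (rec_nsum t _ 2 H (rec_proj 0)).
Qed.

Lemma rec_sigma_num a b c K e : recursive (fun l => sigma_num a b c K e (nth 0 l 0%nat)).
Proof.
unfold sigma_num. pose proof (rec_proj 0) as H0. apply rec_floor_div.
- apply rec_add; [apply rec_mul; [apply rec_mul; [apply rec_const | now apply rec_S] | apply rec_scaled_sum] | now apply rec_precision].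
- apply rec_mul; [apply rec_const | now apply rec_precision].
Qed.

(** [diag_tail] with T = N bounds the tail by N^(-(c-a)/(2ac)) times at most a logarithm. As c - a
    >= 1, this is O(N^(-1/(4ac))), and the exponent 4ac in N turns it into O(1/(K(n+1))). *)
Lemma tail_effective (a b c : nat) : (1 <= a)%nat -> (a < c)%nat -> (c <= b)%nat ->
  exists K, (3 <= K)%nat /\ forall n, let N := ((K * S n) ^ (4 * a * c))%nat in
    0 <= real (sigma_abc a b c) - diag_sum a b c N (N ^ a) <= / (8 * INR (S n)).
Proof.
intros Ha Hac Hcb. destruct (sigma_spec a b c Ha Hac Hcb) as [_ [Sge Sle]].
destruct (pair_sum_uncond a b c Ha Hac Hcb) as [K2 [HK2 PS]].
set (B := 1 - 1 / (2 * INR a) + 1 / (2 * INR c)) in *.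
assert (Ha' := INR_ge1 a Ha). assert (Hac' : INR (S a) <= INR c) by (apply le_INR; lia). rewrite S_INR in Hac'.
set (f := - (1 / (4 * INR a * INR c))).
assert (Hac0 : 0 < INR a * INR c) by (apply Rmult_lt_0_compat; lra).
assert (HBf : B - 1 < f).
{ unfold B, f. apply Rmult_lt_reg_r with (4 * (INR a * INR c)); [lra|].
  replace ((1 - 1 / (2 * INR a) + 1 / (2 * INR c) - 1) * (4 * (INR a * INR c))) with (2 * INR a - 2 * INR c) by (field; lra).
  replace (- (1 / (4 * INR a * INR c)) * (4 * (INR a * INR c))) with (- (1)) by (field; lra). lra. }
destruct (Rpower_log_absorb _ _ HBf) as [K3 [HK3 LA]].
(* The summand 3 gives N >= 3, where [pair_sum_uncond] applies; 8 [K2] [K3] gives the constant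
   1/8. *)
destruct (exists_nat_above (3 + 8 * (K2 * K3))) as [K [HK [HK4 _]]].
{ assert (0 < K2 * K3) by (now apply Rmult_lt_0_compat). lra. }
assert (HK5 : 0 < K2 * K3) by (now apply Rmult_lt_0_compat).
assert (HK6 : (3 <= K)%nat) by (apply INR_le; simpl (INR 3); lra).
exists K. split; [exact HK6|]. intros n. cbv zeta. set (N := ((K * S n) ^ (4 * a * c))%nat).
assert (HX : (3 <= K * S n)%nat) by nia.
assert (HN : (3 <= N)%nat).
{ unfold N. apply Nat.le_trans with ((K * S n) ^ 1)%nat; [simpl; lia|]. apply Nat.pow_le_mono_r; nia. }
assert (HN' : 3 <= INR N) by (apply le_INR in HN; simpl (INR 3) in HN; lra).
split.
{ pose proof (Sge _ (diag_is_sol_list a b c N (N ^ a))) as S. unfold diag_sum. lra. }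
set (W := K2 * (Rpower (INR N) B * ln (INR N) ^ (if Nat.eqb b c then 1 else 0))).
assert (D : real (sigma_abc a b c) <= diag_sum a b c N (N ^ a) + W / INR N).
{ apply Sle. intros l Hl.
  pose proof (diag_tail a b c _ _ N (N ^ a) (INR N) W Ha ltac:(lia) ltac:(lia) (admissible_trivial a b c Ha)
    ltac:(lra) ltac:(lia) (le_n _) (fun M => PS (INR N) M HN') l Hl) as D.
  apply Rmult_le_reg_l with (INR N); [lra|].
  replace (INR N * (diag_sum a b c N (N ^ a) + W / INR N)) with (INR N * diag_sum a b c N (N ^ a) + W) by (field; lra). lra. }
assert (HW : W / INR N <= K2 * (K3 * Rpower (INR N) f)).
{ unfold W, Rdiv. rewrite Rmult_assoc. apply Rmult_le_compat_l; [lra|].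
  specialize (LA (INR N) ltac:(lra)). eapply Rle_trans; [|exact LA].
  replace (B - 1) with (B + - (1)) by ring. rewrite Rpower_plus, (Rpower_Ropp _ 1), Rpower_1 by lra.
  pose proof (Rpower_pos (INR N) B). pose proof (ln_ge1 (INR N) HN').
  assert (0 < / INR N) by (apply Rinv_0_lt_compat; lra).
  replace (Rpower (INR N) B * ln (INR N) ^ (if (b =? c)%nat then 1 else 0) * / INR N) with
    (Rpower (INR N) B * / INR N * ln (INR N) ^ (if (b =? c)%nat then 1 else 0)) by ring.
  apply Rmult_le_compat_l; [apply Rmult_le_pos; lra|].
  destruct (b =? c)%nat; simpl; lra. }
assert (HNf : Rpower (INR N) f = / (INR K * INR (S n))).
{ unfold N, f. apply le_INR in HX. rewrite mult_INR in HX. simpl (INR 3) in HX.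
  rewrite pow_INR, <- Rpower_pow, Rpower_mult, mult_INR by (rewrite ?mult_INR; lra).
  rewrite !mult_INR. replace (INR 4) with 4 by (simpl; ring).
  replace (4 * INR a * INR c * - (1 / (4 * INR a * INR c))) with (- (1)) by (field; lra).
  rewrite Rpower_Ropp, Rpower_1 by lra. reflexivity. }
rewrite HNf in HW. pose proof (INR_S_ge1 n) as Hn.
assert (K2 * (K3 * / (INR K * INR (S n))) <= / (8 * INR (S n))).
{ apply Rmult_le_reg_r with (8 * INR (S n) * INR K); [repeat apply Rmult_lt_0_compat; lra|].
  replace (K2 * (K3 * / (INR K * INR (S n))) * (8 * INR (S n) * INR K)) with (8 * (K2 * K3)) by (field; lra).
  replace (/ (8 * INR (S n)) * (8 * INR (S n) * INR K)) with (INR K) by (field; lra). lra. }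
lra.
Qed.

(** K enters the algorithm as a fixed numeral, so its existence is enough. In units of 1/(n+1) the
    errors are 1/8 for the tail, 1/8 for rounding the terms and 1/2 for the final rounding. *)
Lemma sigma_computable (a b c : nat) : (1 <= a)%nat -> (a < c)%nat -> (c <= b)%nat ->
  computable_real (real (sigma_abc a b c)).
Proof.
intros Ha Hac Hcb. destruct (tail_effective a b c Ha Hac Hcb) as [K [HK TE]].
exists (fun l => sigma_num a b c K (4 * a * c) (nth 0 l 0%nat)), (fun _ => 0%nat).
split; [apply rec_sigma_num|]. split; [apply rec_zero|]. intros n. simpl (nth 0 (n :: nil) 0%nat).
simpl (INR 0). specialize (TE n). cbv zeta in TE. fold (n1_bound K (4 * a * c) n) in TE.
fold (n23_bound a K (4 * a * c) n) in TE.
set (N := n1_bound K (4 * a * c) n) in *. set (M := n23_bound a K (4 * a * c) n) in *.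
pose proof (box_floor_spec a b c N M (precision a K (4 * a * c) n)) as BF.
unfold sigma_num. set (Q := precision a K (4 * a * c) n) in *. set (An0 := scaled_sum a b c K (4 * a * c) n) in *.
change (box_floor a b c N M Q) with An0 in BF.
set (dg := diag_sum a b c N M) in *. set (sg := real (sigma_abc a b c)) in *.
assert (HN : (1 <= N)%nat) by (apply pow_ge1_nat; nia).
assert (HM : (1 <= M)%nat) by (now apply pow_ge1_nat).
apply INR_ge1 in HN as HN'. apply INR_ge1 in HM as HM'. pose proof (INR_S_ge1 n) as Hn.
assert (EQ : INR Q = 8 * INR (S n) * (INR N * (INR M * INR M))).
{ unfold Q, precision. fold N M. rewrite !mult_INR. replace (INR 8) with 8 by (simpl; ring). reflexivity. }
assert (HNMM : 1 <= INR N * (INR M * INR M)) by nra.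
assert (HQ : 1 <= INR Q) by (rewrite EQ; nra).
assert (HQn : (1 <= Q)%nat) by (apply INR_le; simpl (INR 1); lra).
pose proof (floor_div_spec (2 * S n * An0 + Q) (2 * Q) ltac:(lia)) as FD.
set (p := INR (floor_div (2 * S n * An0 + Q) (2 * Q))) in *.
rewrite plus_INR, !mult_INR in FD. replace (INR 2) with 2 in FD by (simpl; ring).
set (x := INR (S n)) in *.
replace ((2 * x * INR An0 + INR Q) / (2 * INR Q)) with (x * (INR An0 / INR Q) + 1 / 2) in FD by (field; lra).
assert (AQ : INR An0 / INR Q <= dg <= INR An0 / INR Q + / (8 * x)).
{ split.
  - apply Rmult_le_reg_r with (INR Q); [lra|]. unfold Rdiv. rewrite Rmult_assoc, Rinv_l by lra. lra.
  - apply Rmult_le_reg_r with (INR Q); [lra|].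
    replace ((INR An0 / INR Q + / (8 * x)) * INR Q) with (INR An0 + INR Q / (8 * x)) by (field; lra).
    replace (INR Q / (8 * x)) with (INR N * (INR M * INR M)) by (rewrite EQ; field; lra). lra. }
assert (Hd : - (1 / 2) <= x * (INR An0 / INR Q) - p <= 1 / 2) by lra.
assert (Hs : 0 <= x * sg - x * (INR An0 / INR Q) <= 1 / 4).
{ replace (x * sg - x * (INR An0 / INR Q)) with (x * ((sg - dg) + (dg - INR An0 / INR Q))) by ring.
  split; [apply Rmult_le_pos; lra|].
  apply Rle_trans with (x * (/ (8 * x) + / (8 * x))); [apply Rmult_le_compat_l; lra | right; field; lra]. }
replace (sg - (p - 0) / x) with ((x * sg - p) * / x) by (field; lra).
rewrite Rabs_mult, (Rabs_pos_eq (/ x)) by (left; apply Rinv_0_lt_compat; lra).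
rewrite <- (Rmult_1_l (/ x)) at 2. apply Rmult_le_compat_r; [left; apply Rinv_0_lt_compat; lra|].
apply Rabs_le. lra.
Qed.

Theorem theorem1p1 (a b c : nat)
  (hgcd : Nat.gcd (Nat.gcd a b) c = 1%nat)
  (ha : (2 <= a)%nat) (hac : (a < c)%nat) (hcb : (c <= b)%nat) :
  is_finite (sigma_abc a b c)
  /\ computable_real (real (sigma_abc a b c))
  /\ 1 < real (sigma_abc a b c)
  /\ dominated_at_infty (E_abc a b c)
       (fun T => Rpower T (1 - 1 / (2 * INR a) + 1 / (2 * INR c))
                 * (ln T) ^ (if Nat.eqb b c then 1 else 0))
  /\ (ConjectureW ->
      forall eps : R, 0 < eps ->
        dominated_at_infty (E_abc a b c)
          (fun T => Rpower T (1/2 + INR a / (INR a + INR c) + eps)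
                    + Rpower T (3/4) * ln T)).
Proof.
assert (ha1 : (1 <= a)%nat) by lia.
split; [apply sigma_spec; assumption|].
split; [apply sigma_computable; assumption|].
split; [apply sigma_gt1; assumption|].
split; [apply error_unconditional; assumption|].
intros HW eps He; apply error_conditional; assumption.
Qed.
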